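(* There is an absolute constant $c>0$ such that the following holds. Let $n\ge1$ and $1\le r<\infty$ be integers, and let $s>0$, $c_*>0$, $\lambda_{\max}>0$, $\sigma>0$. Set $$l_1=\max\left(\left\lceil n^{\frac1{2s+1}}\right\rceil,\ \left\lceil(rn)^{\frac1{2(s+1)}}\right\rceil\right)$$ and let $$\hat A^{(l_1)}\in\operatorname{argmin}_{A\in\mathcal S_{l_1},\,A\ge 0}\left(\|R_n^{(l_1)}-A-\sigma^2I^{(l_1)}\|_2^2+\mu\|A\|_1\right),\qquad\mu=c(\lambda_{\max}+\sigma^2)\,\delta_n(l_1,l_1).$$ Then $$\sup_{K\in\mathcal K_r(s,c_*;\lambda_{\max})}\mathbb E\left[\|\hat A^{(l_1)}-K\|_2^2\right]\le C\min\left(r\,n^{-\frac{2s}{2s+1}},\ r^{\frac1{s+1}}n^{-\frac s{s+1}}\right),$$ where $C>0$ is a constant depending only on $\lambda_{\max}$, $\sigma$ and $c_*$.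
   Context: Model: $X_1,\dots,X_n$ are i.i.d. copies of $X(t)$, $t\in[0,1]$, satisfying $dX(t)=S(t)\,dt+\sigma\,dW(t)$, where $W$ is standard Brownian motion, $\sigma>0$ is a known noise level, and $S(t)=\sum_{k}\sqrt{\lambda_k}\,\xi_k\varphi_k(t)$ (finite sum) with $\xi_k$ i.i.d. standard Gaussian variables independent of $W$, $\{\varphi_k\}$ orthonormal in $L_2[0,1]$, $\lambda_k>0$. The covariance function of $S$ is $K(t,u)=\sum_{k}\lambda_k\varphi_k(t)\varphi_k(u)$; the expectation is taken under the law of the data for the given $K$. Fix an orthonormal basis $e_1,e_2,\dots$ of $L_2[0,1]$. For $l\ge1$, set $\dot X_i^{(l)}=\sum_{k=1}^l\left(\int_0^1e_k(t)\,dX_i(t)\right)e_k$, $R_n^{(l)}(t,u)=\frac1n\sum_{i=1}^n\dot X_i^{(l)}(t)\dot X_i^{(l)}(u)$, $I^{(l)}(t,u)=\sum_{k=1}^le_k(t)e_k(u)$. $\mathcal S_l=\{\sum_{j,k=1}^ls_{jk}\,e_j\otimes e_k:\ s_{jk}=s_{kj}\}$, where $(e_j\otimes e_k)(t,u)=e_j(t)e_k(u)$. An element $A\in\mathcal S_l$ is identified with the symmetric $l\times l$ matrix of its coefficients; $A\ge0$ means this matrix is non-negative definite and $\|A\|_1$ is its nuclear norm. $\|\cdot\|_2$ is the norm of $L_2([0,1]^2)$. $\delta_n(l,t)=\max\left\{\sqrt{\frac{l+t}{n}},\frac{l+t}{n}\right\}$. For $\varphi\in L_2[0,1]$, $\|\varphi\|_{s,2}=\left(\sum_{k\ge1}k^{2s}\langle\varphi,e_k\rangle^2\right)^{1/2}$.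 $\mathcal K_r(s,c_*;\lambda_{\max})$ is the class of all kernels $K=\sum_j\lambda_j\varphi_j\otimes\varphi_j$ with at most $r$ terms ($\lambda_j>0$, $\varphi_j$ orthonormal in $L_2[0,1]$) such that $\|\varphi_j\|_{s,2}\le c_*$ for every $j$ and $\|K\|_\infty<\lambda_{\max}$, where $\|K\|_\infty$ is the operator (spectral) norm, i.e. $\max_j\lambda_j$. *)

(* Defs.v *)
From HB Require Import structures.
From mathcomp Require Import all_boot all_order all_algebra.
From mathcomp Require Import all_classical all_reals all_analysis.
Import Order.TTheory GRing.Theory Num.Theory.
Import numFieldNormedType.Exports.

Set Implicit Arguments.
Unset Strict Implicit.
Unset Printing Implicit Defensive.

Local Open Scope classical_set_scope.
Local Open Scope ring_scope.

(* Elements of L_2[0,1] are represented by functions R -> R, of which only the *)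
(* restriction to `[0, 1] matters.                                            *)

Section L2_unit_interval.
Context {R : realType}.
Local Notation mu := (@lebesgue_measure R).

Definition sqnorm01 (f : R -> R) : \bar R :=
  (\int[mu]_(t in `[0%R, 1%R]) ((f t) ^+ 2)%:E)%E.

Definition in_L2 (f : R -> R) : Prop :=
  measurable_fun (`[0, 1] : set R) f /\ (sqnorm01 f < +oo)%E.

Definition inner01 (f g : R -> R) : R :=
  \int[mu]_(t in `[0, 1]) (f t * g t).

Definition orthonormal01 (I : eqType) (f : I -> R -> R) : Prop :=
  (forall i, in_L2 (f i)) /\ (forall i j, inner01 (f i) (f j) = (i == j)%:R).

(* e k is the (k+1)-st element of the basis. *)
Definition orthonormal_basis01 (e : nat -> R -> R) : Prop :=
  orthonormal01 e /\
  forall f, in_L2 f ->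
    sqnorm01 (fun t => f t - \sum_(k < N) inner01 f (e k) * e k t)
      @[N --> \oo] --> 0%E.

(* ||f||_{s,2}; the weight is (k+1)^{2s} because e is indexed from 0. *)
Definition sobolev_norm (e : nat -> R -> R) (s : R) (f : R -> R) : \bar R :=
  ((\sum_(0 <= k <oo) (k.+1%:R `^ (2 * s) * inner01 f (e k) ^+ 2)%:E)
    `^ 2^-1)%E.

(* Square of the norm of L_2([0,1]^2). *)
Definition sqnorm_square (F : R -> R -> R) : \bar R :=
  (\int[mu \x mu]_(z in `[0%R, 1%R] `*` `[0%R, 1%R]) ((F z.1 z.2) ^+ 2)%:E)%E.

End L2_unit_interval.

Section kernels.
Context {R : realType}.

Definition spectral_decomposition (K : R -> R -> R) (m : nat)
    (lam : 'I_m -> R) (phi : 'I_m -> R -> R) : Prop :=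
  [/\ forall j, 0 < lam j, orthonormal01 phi &
      forall t u, t \in `[0, 1] -> u \in `[0, 1] ->
        K t u = \sum_(j < m) lam j * phi j t * phi j u].

Definition sobolev_kernels (e : nat -> R -> R) (r : nat) (s cstar lmax : R) :
    set (R -> R -> R) :=
  [set K | exists (m : nat) (lam : 'I_m -> R) (phi : 'I_m -> R -> R),
    [/\ (m <= r)%N, spectral_decomposition K lam phi,
        forall j, (sobolev_norm e s (phi j) <= cstar%:E)%E &
        \big[Num.max/0]_(j < m) lam j < lmax]].

(* The kernel \sum_{j,k} A_{jk} e_j \otimes e_k. *)
Definition kernel_of (e : nat -> R -> R) (l : nat) (A : 'M[R]_l) (t u : R) : R :=
  \sum_(j < l) \sum_(k < l) A j k * (e j t * e k u).

Definition sym_psd (l : nat) (A : 'M[R]_l) : Prop :=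
  A^T = A /\ forall v : 'rV[R]_l, 0 <= (v *m A *m v^T) 0 0.

(* Sum of the singular values of A, i.e. of the square roots of the           *)
(* eigenvalues of A^T A, each counted with its multiplicity.                  *)
Definition nuclear_norm (l : nat) (A : 'M[R]_l) : R :=
  \sum_(x \in [set x : R | eigenvalue (A^T *m A) x])
    Num.sqrt x *+ mup x (char_poly (A^T *m A)).

End kernels.

Section probability_notions.
Context {R : realType} {d : measure_display} {T : measurableType d}.
Variable P : probability T R.

Definition sigma_gen (I : Type) (D : set I) (X : I -> {RV P >-> R}) :
    set (set T) :=
  <<s \bigcup_(i in D) preimage_set_system setT (X i) measurable >>.

(* A single preimage system is already a sigma-algebra. *)
Definition sigma1 (X : T -> R) : set (set T) :=
  preimage_set_system setT X measurable.

Definition mutually_independent (I : eqType) (F : I -> set (set T)) : Prop :=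
  forall (J : seq I) (A : I -> set T), uniq J -> (forall i, i \in J -> F i (A i)) ->
    P (\bigcap_(i in [set` J]) A i) = (\prod_(i <- J) P (A i))%E.

Definition independent2 (F G : set (set T)) : Prop :=
  forall A B, F A -> G B -> P (A `&` B) = (P A * P B)%E.

(* normal_prob m s is the normal law with mean m and standard deviation s. *)
Definition has_normal_law (X : T -> R) (m s : R) : Prop :=
  forall B : set R, measurable B -> P (X @^-1` B) = normal_prob m s B.

(* Standard Brownian motion on [0,1]; only (W t) with t in [0,1] matters. *)
Definition brownian_motion (W : R -> {RV P >-> R}) : Prop :=
  [/\ {ae P, forall w, W 0 w = 0},
      {ae P, forall w, {within `[0, 1], continuous (fun t => W t w)}},
      forall u v : R, 0 <= u -> u < v -> v <= 1 ->
        has_normal_law (fun w => W v w - W u w) 0 (Num.sqrt (v - u)) &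
      forall (N : nat) (t : nat -> R), 0 <= t 0%N -> t N <= 1 ->
        (forall j, (j < N)%N -> t j <= t j.+1) ->
        mutually_independent
          (fun j : 'I_N => sigma1 (fun w => W (t j.+1) w - W (t j) w))].

(* The step function \sum_j a_j 1_{]u_j, v_j]}, encoded as the list of the     *)
(* triples (u_j, v_j, a_j), and its integral with respect to dX.              *)
Definition step_valid (g : seq (R * R * R)) : Prop :=
  forall q, q \in g -> [/\ 0 <= q.1.1, q.1.1 <= q.1.2 & q.1.2 <= 1].

Definition step_fun (g : seq (R * R * R)) (t : R) : R :=
  \sum_(q <- g) q.2 * \1_`]q.1.1, q.1.2] t.

Definition step_integral (X : R -> {RV P >-> R}) (g : seq (R * R * R)) (w : T) : R :=
  \sum_(q <- g) q.2 * (X q.1.2 w - X q.1.1 w).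

(* Y is (a version of) \int_0^1 f(t) dX(t): the limit in L_2(P) of the         *)
(* integrals of step functions that converge to f in L_2[0,1].                *)
Definition is_wiener_integral (X : R -> {RV P >-> R}) (f : R -> R)
    (Y : {RV P >-> R}) : Prop :=
  exists g : nat -> seq (R * R * R),
    [/\ forall m, step_valid (g m),
        sqnorm01 (fun t => f t - step_fun (g m) t) @[m --> \oo] --> 0%E &
        (\int[P]_w ((step_integral X (g m) w - Y w) ^+ 2)%:E)%E
          @[m --> \oo] --> 0%E].

(* dX(t) = S(t) dt + sigma dW(t) on [0,1], where                              *)
(* S(t) = \sum_k (lambda_k)^{1/2} xi_k phi_k(t) has covariance function K.    *)
(* The initial value X 0 is left free.                                        *)
Definition signal_plus_noise (K : R -> R -> R) (sigma : R)
    (X : R -> {RV P >-> R}) : Prop :=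
  exists (m : nat) (lam : 'I_m -> R) (phi : 'I_m -> R -> R)
         (xi : 'I_m -> {RV P >-> R}) (W : R -> {RV P >-> R}),
    [/\ spectral_decomposition K lam phi,
        (forall k, has_normal_law (xi k) 0 1) /\
          mutually_independent (fun k => sigma1 (xi k)),
        brownian_motion W,
        independent2 (sigma_gen setT xi) (sigma_gen `[0, 1] W) &
        {ae P, forall w, forall t, t \in `[0, 1] ->
          X t w - X 0 w =
          \int[lebesgue_measure]_(u in `[0, t])
             (\sum_(k < m) Num.sqrt (lam k) * xi k w * phi k u)
          + sigma * W t w}].

End probability_notions.

Section estimator.
Context {R : realType}.

(* Coefficients of R_n^{(l)} in the basis (e_j \otimes e_k), where y i k = \int_0^1 e_k dX_i. *)
Definition sample_cov (n l : nat) (y : 'I_n -> nat -> R) : 'M[R]_l :=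
  \matrix_(j < l, k < l) (n%:R^-1 * \sum_(i < n) y i j * y i k).

Definition objective (e : nat -> R -> R) (l : nat) (Rn : 'M[R]_l) (sigma mu : R)
    (A : 'M[R]_l) : \bar R :=
  (sqnorm_square
     (fun t u => kernel_of e Rn t u - kernel_of e A t u
                            - sigma ^+ 2 * kernel_of e (1%:M : 'M[R]_l) t u)%R
   + (mu * nuclear_norm A)%:E)%E.

Definition is_estimator (e : nat -> R -> R) (l : nat) (Rn : 'M[R]_l) (sigma mu : R)
    (A : 'M[R]_l) : Prop :=
  sym_psd A /\
  forall B : 'M[R]_l, sym_psd B ->
    (objective e Rn sigma mu A <= objective e Rn sigma mu B)%E.

Definition delta (n l : nat) (t : R) : R :=
  Num.max (Num.sqrt ((l%:R + t) / n%:R)) ((l%:R + t) / n%:R).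

Definition resolution (n r : nat) (s : R) : nat :=
  maxn (absz (Num.ceil (n%:R `^ (1 / (2 * s + 1)))))
       (absz (Num.ceil ((r * n)%:R `^ (1 / (2 * (s + 1)))))).

End estimator.

(* Main.v *)
Require Import Defs.
From HB Require Import structures.
From mathcomp Require Import all_boot all_order all_algebra.
From mathcomp Require Import all_classical all_reals all_analysis.
From mathcomp Require Import complex measurable_realfun ring lra.
Import Order.TTheory GRing.Theory Num.Theory.
Import numFieldNormedType.Exports.

Set Implicit Arguments.
Unset Strict Implicit.
Unset Printing Implicit Defensive.

Local Open Scope classical_set_scope.
Local Open Scope ring_scope.

(** Let [A0] be the matrix of the first [l] by [l] coefficients of [K] in the
    basis [e] ([compression]), and [D] the difference between the sample
    covariance of the data and its mean [A0 + sigma ^+ 2 *: 1%:M]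
    ([fluctuation]). The estimator [A] is then a penalized least squares fit
    to [A0 + D], and [A0] is a non-negative definite matrix of rank at most
    [r]. Since [A0] is the orthogonal projection of [K], the loss is the
    squared Frobenius norm of [A - A0] plus a bias ([sqnorm_kernel_sub]),
    and the Sobolev condition on the eigenfunctions makes the bias of order
    [r * l `^ (- 2 s)] ([compression_bias], [sobolev_tail]).

    On the non-negative definite cone the nuclear norm is the trace, so the
    penalty is linear there and the convex analysis reduces to one
    variational inequality in the direction [A0 - A]: the squared norm of [A
    - A0] is at most the Frobenius product of [mu / 2 - D] with [A0 - A].
    The difference [A0 - A] has at most [rank A0] positive eigenvalues. If
    the operator norm of [D] is at most [mu / 2], then [mu / 2 - D] lies
    between [0] and [mu], only these eigenvalues contribute, and
    Cauchy-Schwarz yields the bound [r * mu ^+ 2] ([error_le_rank]). In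
    general the same inequality bounds the error by the Frobenius norm of
    [D] and a term in [mu] ([error_le_noise_norm]).

    All probabilistic information is an exponential moment of [qform D v] for a
    fixed vector [v] ([expR_qform_bound]). The combination of the data with
    coefficients [v] is a limit of integrals of step functions against the
    observed processes. For step functions the Laplace transform is an
    explicit product of Gaussian integrals ([signal_step_expR]); the square
    is linearized by one more Gaussian integral, which gives a bound of
    Bernstein type ([quad_expR_bound]); independence multiplies the bounds
    over the sample, and Fatou's lemma transports the result to the limit
    ([sample_expR_bound]).

    Two consequences are integrated. When [l <= n], the operator norm of [D] is
    controlled on a net of at most [2 ^ (66 * l)] points, and the part of
    the error above [r * mu ^+ 2] has expectation of order [l / n]
    ([fluctuation_tail_bound], [risk_low_rank]), so that the error is of
    order [r * l / n]. For every [l], summing over the entries of [D] shows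
    an error of order [l ^+ 2 / n] ([risk_large_scale]). The resolution [l]
    is the maximum of two rounded powers; when the first is the larger one
    the first bound matches the first rate, and otherwise the second bound
    matches the second rate ([rate_cases]). In both cases it is the smaller
    of the two rates, and the bias is below it as well. *)

(** * Frobenius product and spectral theorem *)

Section SpectralTheorem.
Context {R : rcfType}.

Definition qform n (A : 'M[R]_n) (v : 'rV[R]_n) : R := (v *m A *m v^T) 0 0.
Definition frob m n (A B : 'M[R]_(m, n)) : R := \tr (A *m B^T).

Lemma frobE m n (A B : 'M[R]_(m, n)) : frob A B = \sum_i \sum_j A i j * B i j.
Proof.
rewrite /frob /mxtrace; apply: eq_bigr => i _; rewrite mxE.
by apply: eq_bigr => j _; rewrite mxE.
Qed.

Lemma frobC m n (A B : 'M[R]_(m, n)) : frob A B = frob B A.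
Proof. by rewrite /frob -mxtrace_tr trmx_mul trmxK. Qed.

Lemma frobDl m n (A B C : 'M[R]_(m, n)) : frob (A + B) C = frob A C + frob B C.
Proof. by rewrite /frob mulmxDl mxtraceD. Qed.
Lemma frobZl m n a (A C : 'M[R]_(m, n)) : frob (a *: A) C = a * frob A C.
Proof. by rewrite /frob -scalemxAl mxtraceZ. Qed.
Lemma frobNl m n (A C : 'M[R]_(m, n)) : frob (- A) C = - frob A C.
Proof. by rewrite -scaleN1r frobZl mulN1r. Qed.
Lemma frobDr m n (A B C : 'M[R]_(m, n)) : frob C (A + B) = frob C A + frob C B.
Proof. by rewrite frobC frobDl !(frobC _ C). Qed.
Lemma frobZr m n a (A C : 'M[R]_(m, n)) : frob C (a *: A) = a * frob C A.
Proof. by rewrite frobC frobZl frobC. Qed.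
Lemma frobNr m n (A C : 'M[R]_(m, n)) : frob C (- A) = - frob C A.
Proof. by rewrite frobC frobNl frobC. Qed.
Lemma frob_ge0 m n (A : 'M[R]_(m, n)) : 0 <= frob A A.
Proof.
rewrite frobE; apply: sumr_ge0 => i _; apply: sumr_ge0 => j _.
by rewrite -expr2 sqr_ge0.
Qed.

Lemma frob_eq0 m n (A : 'M[R]_(m, n)) : (frob A A == 0) = (A == 0).
Proof.
apply/idP/eqP => [|->]; last by rewrite /frob mul0mx mxtrace0.
rewrite frobE psumr_eq0; last first.
  by move=> i _; apply: sumr_ge0 => j _; rewrite -expr2 sqr_ge0.
move=> /allP h; apply/matrixP => i j; rewrite mxE.
have /(_ (mem_index_enum i)) := h i; rewrite psumr_eq0 => [/allP h'|k _].
  by have /(_ (mem_index_enum j)) := h' j; rewrite -expr2 sqrf_eq0 => /eqP.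
by rewrite -expr2 sqr_ge0.
Qed.

Lemma frob_tr1 n (A : 'M[R]_n) : frob 1%:M A = \tr A.
Proof. by rewrite /frob mul1mx mxtrace_tr. Qed.

Lemma mx11E (x : 'M[R]_1) : x = (x 0 0)%:M.
Proof. by apply/matrixP=> i j; rewrite !ord1 mxE eqxx mulr1n. Qed.

Lemma frob_row n (u v : 'rV[R]_n) : frob u v = (u *m v^T) 0 0.
Proof. by rewrite /frob /mxtrace big_ord1. Qed.

(** Over the complexification some eigenvector exists, because the field is
    algebraically closed; symmetry forces the eigenvalue to be real, and then
    the real or the imaginary part of the eigenvector is a real eigenvector.
    *)
Lemma sym_eigenvector n (A : 'M[R]_n.+1) : A^T = A ->
  exists a (v : 'rV[R]_n.+1), v != 0 /\ v *m A = a *: v.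
Proof.
move=> sA.
have [z] := eigenvalue_closed (map_mx (real_complex R) A) (ltn0Sn n).
case/eigenvalueP => v vA v0.
pose x := map_mx (@complex.Re R) v; pose y := map_mx (@complex.Im R) v.
have xA : x *m A = complex.Re z *: x - complex.Im z *: y.
  apply/rowP => j; have /rowP/(_ j) := vA; rewrite !mxE => /(congr1 (@complex.Re R)).
  rewrite raddf_sum /= => h; transitivity (\sum_(i < n.+1) complex.Re (v ord0 i * (map_mx (real_complex R) A) i j)).
    by apply: eq_bigr => k _; rewrite !mxE; case: (v _ _) => a b /=; ring.
  by rewrite h; case: (z); case: (v _ _) => a b c d /=; ring.
have yA : y *m A = complex.Re z *: y + complex.Im z *: x.
  apply/rowP => j; have /rowP/(_ j) := vA; rewrite !mxE => /(congr1 (@complex.Im R)).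
  rewrite raddf_sum /= => h; transitivity (\sum_(i < n.+1) complex.Im (v ord0 i * (map_mx (real_complex R) A) i j)).
    by apply: eq_bigr => k _; rewrite !mxE; case: (v _ _) => a b /=; ring.
  by rewrite h; case: (z); case: (v _ _) => a b c d /=; ring.
have sE : frob (x *m A) y = frob (y *m A) x.
  by rewrite [RHS]frobC !frob_row trmx_mul sA mulmxA.
(* Pairing the two real equations with [y] and [x] and using the symmetry of
   [A] cancels everything but the imaginary part of the eigenvalue. *)
have Iz : complex.Im z = 0.
  move: sE; rewrite xA yA !frobDl frobNl !frobZl (frobC y x) => sE.
  have : complex.Im z * (frob x x + frob y y) = 0 by lra.
  move/eqP; rewrite mulf_eq0 => /orP[/eqP//|].
  rewrite paddr_eq0 ?frob_ge0// !frob_eq0 => /andP[/eqP x0 /eqP y0].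
  case/eqP: v0; apply/rowP => j; rewrite mxE.
  have /rowP/(_ j) := x0; have /rowP/(_ j) := y0; rewrite !mxE.
  by case: (v _ _) => a b /= -> ->.
move: xA yA; rewrite Iz !scale0r subr0 addr0 => xA yA.
have [x0|x0] := eqVneq x 0; last by exists (complex.Re z), x.
exists (complex.Re z), y; split => //; apply: contra v0 => /eqP y0.
apply/eqP/rowP => j; rewrite mxE.
have /rowP/(_ j) := x0; have /rowP/(_ j) := y0; rewrite !mxE.
by case: (v _ _) => a b /= -> ->.
Qed.

(** The matrix is the Householder reflection that exchanges the first basis
    vector and [v]; it is a symmetric involution, so that conjugation by it
    preserves symmetry. *)
Lemma orthogonal_first_row n (v : 'rV[R]_n.+1) : frob v v = 1 ->
  exists Q : 'M[R]_n.+1, [/\ Q^T = Q, Q *m Q = 1%:M & delta_mx 0 0 *m Q = v].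
Proof.
move=> v1; pose e : 'rV[R]_n.+1 := delta_mx 0 0; pose w := v - e.
have [w0|w0] := eqVneq w 0.
  exists 1%:M; split; rewrite ?trmx1 ?mulmx1//.
  by apply/eqP; rewrite eq_sym -subr_eq0; apply/eqP.
have ww : frob w w != 0 by rewrite frob_eq0.
have ee : frob e e = 1.
  rewrite frob_row trmx_delta mul_delta_mx mxE eqxx//.
have wE : frob w w = - 2 * frob e w.
  by rewrite /w !(frobDl, frobDr, frobNl, frobNr) v1 ee (frobC v e); lra.
exists (1%:M - (2 / frob w w) *: (w^T *m w)).
have wwT : w *m w^T = (frob w w)%:M by rewrite [LHS]mx11E frob_row.
split.
- by rewrite raddfB /= trmx1 linearZ /= trmx_mul trmxK.
- set X := _ *: _.
  have XX : X *m X = X + X.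
    rewrite /X -scalemxAl -!scalemxAr !mulmxA -(mulmxA w^T w w^T) wwT.
    rewrite -mulmxA mul_scalar_mx -scalemxAr !scalerA -scalerDl; congr (_ *: _).
    by field.
  by rewrite mulmxBl mul1mx mulmxBr mulmx1 XX opprB addrK subrK.
- rewrite mulmxBr mulmx1 -scalemxAr mulmxA [e *m w^T]mx11E -frob_row mul_scalar_mx.
  rewrite scalerA (_ : _ / _ * _ = -1) ?scaleN1r ?opprK; last first.
    have ew : frob e w != 0.
      by apply: contra ww; rewrite wE => /eqP ->; rewrite mulr0.
    rewrite wE; field; exact: ew.
  by rewrite -/e /w addrC subrK.
Qed.

(** Induction on the size: a reflection that sends the first basis vector to a
    unit eigenvector splits off a one by one block. *)
Lemma sym_spectral n (A : 'M[R]_n) : A^T = A ->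
  exists (U : 'M[R]_n) (d : 'rV[R]_n), U *m U^T = 1%:M /\ A = U^T *m diag_mx d *m U.
Proof.
elim: n A => [|n IH] A sA.
  by exists 1%:M, 0; split; apply/matrixP; case.
have [a [v [v0 vA]]] := sym_eigenvector sA.
have vv : 0 < frob v v by rewrite lt_def frob_eq0 v0 frob_ge0.
pose u := (Num.sqrt (frob v v))^-1 *: v.
have u1 : frob u u = 1.
  rewrite frobZl frobZr mulrA -expr2 exprVn sqr_sqrtr ?frob_ge0// mulVf//.
  by rewrite gt_eqF.
have uA : u *m A = a *: u by rewrite -scalemxAl vA !scalerA mulrC.
have [Q [sQ QQ eQ]] := orthogonal_first_row u1.
have [B defB] : exists B : 'M[R]_(1 + n), B = Q *m A *m Q by eexists.
have sB : B^T = B by rewrite defB !trmx_mul sQ sA mulmxA.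
have AB : A = Q *m B *m Q.
  by rewrite defB !mulmxA QQ mul1mx -mulmxA QQ mulmx1.
have eB : (delta_mx 0 0 : 'rV[R]_(1 + n)) *m B = a *: delta_mx 0 0.
  by rewrite defB !mulmxA eQ uA -scalemxAl -eQ -mulmxA QQ mulmx1.
have B0 (j : 'I_(1 + n)) : B ord0 j = a *+ (j == ord0).
  by have /rowP/(_ j) := eB; rewrite -rowE !mxE /= => ->; rewrite mulr_natr.
have urB : ursubmx B = 0.
  apply/rowP => j; rewrite !mxE (_ : lshift n 0 = ord0 :> 'I_(1 + n)); last exact/val_inj.
  exact: (B0 (rshift 1 j)).
have BE : B = block_mx a%:M 0 0 (drsubmx B).
  rewrite -[LHS]submxK urB; congr block_mx.
    apply/matrixP => i j; rewrite !ord1 !mxE (_ : lshift n 0 = ord0 :> 'I_(1 + n)); last exact/val_inj.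
    by apply: etrans (B0 ord0) _; rewrite eqxx.
  by rewrite -[LHS]trmxK trmx_dlsub sB urB trmx0.
have sC : (drsubmx B)^T = drsubmx B by rewrite trmx_drsub sB.
have [U [d [UU UdU]]] := IH _ sC.
have [V defV] : exists V : 'M[R]_(1 + n), V = block_mx 1%:M 0 0 U by eexists.
have VV : V *m V^T = 1%:M.
  rewrite defV tr_block_mx !trmx0 trmx1 mulmx_block.
  by rewrite !(mulmx0, mul0mx, addr0, add0r, mulmx1) UU -scalar_mx_block.
have VBV : B = V^T *m diag_mx (row_mx a%:M d) *m V.
  rewrite BE UdU defV diag_mx_row tr_block_mx !trmx0 trmx1 !mulmx_block.
  rewrite !(mulmx0, mul0mx, addr0, add0r, mulmx1, mul1mx).
  by congr block_mx; apply/matrixP => i j; rewrite !ord1 !mxE.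
exists (V *m Q), (row_mx a%:M d); split.
  by rewrite trmx_mul sQ mulmxA -(mulmxA V Q Q) QQ mulmx1 VV.
by rewrite AB VBV trmx_mul sQ !mulmxA.
Qed.

End SpectralTheorem.

(** * Penalized least squares over the non-negative definite cone *)

Section Penalized.
Context {R : rcfType}.

Lemma char_poly_orthogonal n (U : 'M[R]_n) (d : 'rV[R]_n) : U *m U^T = 1%:M ->
  char_poly (U^T *m diag_mx d *m U) = \prod_i ('X - (d 0 i)%:P).
Proof.
move=> UU; have UU' : U^T *m U = 1%:M by exact: mulmx1C.
have -> : \prod_i ('X - (d 0 i)%:P) = char_poly (diag_mx d).
  rewrite char_poly_trig ?diag_mx_is_trig//; apply: eq_bigr => i _.
  by rewrite !mxE eqxx mulr1n.
rewrite /char_poly /char_poly_mx !map_mxM /=.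
have PP : map_mx polyC U^T *m map_mx polyC U = 1%:M.
  by rewrite -map_mxM UU' map_scalar_mx.
rewrite [in LHS](_ : 'X%:M = map_mx polyC U^T *m 'X%:M *m map_mx polyC U); last first.
  by rewrite -mulmxA mul_scalar_mx -scalemxAr PP scalemx1.
rewrite -mulmxBl -mulmxBr !det_mulmx mulrC mulrA -det_mulmx mulmx1C// det1 mul1r.
by [].
Qed.

Lemma qform_diag n (d v : 'rV[R]_n) : qform (diag_mx d) v = \sum_i d 0 i * v 0 i ^+ 2.
Proof.
rewrite /qform mxE; apply: eq_bigr => i _.
by rewrite mul_mx_diag !mxE; ring.
Qed.

Lemma qform1 n (v : 'rV[R]_n) : qform 1%:M v = frob v v.
Proof. by rewrite /qform mulmx1 frob_row. Qed.

Lemma qformD n (A B : 'M[R]_n) v : qform (A + B) v = qform A v + qform B v.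
Proof. by rewrite /qform mulmxDr mulmxDl mxE. Qed.
Lemma qformZ n a (A : 'M[R]_n) v : qform (a *: A) v = a * qform A v.
Proof. by rewrite /qform -scalemxAr -scalemxAl mxE. Qed.
Lemma qformN n (A : 'M[R]_n) v : qform (- A) v = - qform A v.
Proof. by rewrite -scaleN1r qformZ mulN1r. Qed.

Lemma qform_conj m n (V : 'M[R]_(m, n)) (A : 'M[R]_n) v :
  qform (V *m A *m V^T) v = qform A (v *m V).
Proof. by rewrite /qform trmx_mul !mulmxA. Qed.

Lemma qform_gram m n (V : 'M[R]_(m, n)) v :
  qform (V^T *m V) v = frob (v *m V^T) (v *m V^T).
Proof. by rewrite frob_row /qform trmx_mul trmxK !mulmxA. Qed.

(** Cauchy-Schwarz against the constant function [1], obtained from the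
    variance identity. *)
Lemma sqr_sum_le (I : finType) (S : {pred I}) (h : I -> R) :
  (\sum_(i in S) h i) ^+ 2 <= #|S|%:R * \sum_(i in S) h i ^+ 2.
Proof.
set s := \sum_(i in S) h i; set q := \sum_(i in S) h i ^+ 2.
have [k0|k0] := posnP #|S|.
  suff -> : s = 0 by rewrite expr0n /= k0 mul0r.
  by rewrite /s big_pred0// => i; apply: card0_eq.
have kp : 0 < #|S|%:R :> R by rewrite ltr0n.
have : 0 <= \sum_(i in S) (#|S|%:R * h i - s) ^+ 2 by apply: sumr_ge0 => i _; exact: sqr_ge0.
have -> : \sum_(i in S) (#|S|%:R * h i - s) ^+ 2 =
   #|S|%:R * (#|S|%:R * q - s ^+ 2).
  transitivity (#|S|%:R ^+ 2 * q - (2 * #|S|%:R * s) * s + s ^+ 2 * #|S|%:R).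
    rewrite (eq_bigr (fun i => #|S|%:R ^+ 2 * h i ^+ 2 - 2 * #|S|%:R * s * h i + s ^+ 2)).
      by rewrite big_split sumrB /= sumr_const -!mulr_sumr -[s ^+ 2 *+ _]mulr_natr.
    by move=> i _; ring.
  by ring.
by rewrite pmulr_rge0// subr_ge0.
Qed.

(** The number [s] is the sum of the positive eigenvalues of [V^T *m V - A].
    There are at most [m] of them: on the span of the corresponding
    eigenvectors the quadratic form is positive, while it is non-positive on
    the kernel of [V]. A matrix between [0] and [kappa] pairs with the
    negative eigenvalues to a non-positive number and with the positive ones
    to at most [kappa * s]. *)
Lemma frob_sub_psd_le m l (V : 'M[R]_(m, l)) (A : 'M[R]_l) :
  A^T = A -> (forall v, 0 <= qform A v) ->
  let D := V^T *m V - A in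
  exists s, [/\ 0 <= s, s ^+ 2 <= (minn m l)%:R * frob D D &
    forall (N : 'M[R]_l) kappa,
      (forall v, 0 <= qform N v <= kappa * frob v v) ->
      frob N D <= kappa * s].
Proof.
move=> sA pA D.
have sD : D^T = D by rewrite /D linearB /= trmx_mul trmxK sA.
have [U [h [UU DE]]] := sym_spectral sD.
have UU' : U^T *m U = 1%:M by exact: mulmx1C.
(* The rows of [U] are the eigenvectors of the difference, with eigenvalues
   [h]. *)
pose S := [pred i : 'I_l | 0 < h 0 i].
have fD : frob D D = \sum_i h 0 i ^+ 2.
  rewrite /frob sD DE -!mulmxA (mulmxA U) UU mul1mx mxtrace_mulC -!mulmxA UU mulmx1.
  rewrite /mxtrace; apply: eq_bigr => i _.
  by rewrite mul_diag_mx !mxE eqxx mulr1n.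
have frobN (N : 'M[R]_l) : frob N D = \sum_i qform N (row i U) * h 0 i.
  rewrite /frob sD DE !mulmxA mxtrace_mulC !mulmxA /mxtrace.
  apply: eq_bigr => i _; rewrite mul_mx_diag !mxE; congr (_ * _).
  rewrite /qform mxE; apply: eq_bigr => k _; rewrite !mxE; congr (_ * _).
  by apply: eq_bigr => j _; rewrite !mxE.
have rowU i : frob (row i U) (row i U) = 1.
  rewrite frob_row mxE; have /matrixP/(_ i i) := UU; rewrite !mxE eqxx => h1.
  by apply: etrans h1; apply: eq_bigr => k _; rewrite !mxE.
have cardS : (#|S| <= minn m l)%N.
  rewrite leq_min; apply/andP; split; last by rewrite (leq_trans (max_card _))// card_ord.
  pose f (i : 'I_#|S|) : 'I_l := enum_val i.
  pose W := rowsub f U *m V^T.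
  suff : row_free W by rewrite /row_free => /eqP <-; exact: rank_leq_col.
  apply: inj_row_free => x; rewrite /W mulmxA => xW0.
  pose v := x *m rowsub f U.
  have : qform D v <= 0.
    by rewrite /D qformD qformN qform_gram -/v xW0 /frob mul0mx mxtrace0 sub0r oppr_le0.
  have -> : qform D v = \sum_i h 0 (f i) * x 0 i ^+ 2.
    rewrite DE (_ : _ *m U = U^T *m diag_mx h *m U^T^T); last by rewrite trmxK.
    rewrite qform_conj.
    have -> : v *m U^T = x *m rowsub f 1%:M by rewrite /v -mulmxA mul_rowsub_mx UU.
    rewrite -qform_conj mul_rowsub_mx mul1mx.
    have -> : rowsub f (diag_mx h) *m (rowsub f 1%:M)^T = diag_mx (\row_i h 0 (f i)).
      apply/matrixP => i j; rewrite !mxE (bigD1 (f i)) //= big1 => [|k kfi].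
        rewrite !mxE eqxx mulr1n addr0 (inj_eq enum_val_inj) eq_sym.
        by case: eqP => _; rewrite ?(mulr1, mulr0).
      by rewrite !mxE eq_sym (negbTE kfi) mul0r.
    by rewrite qform_diag; apply: eq_bigr => i _; rewrite mxE.
  have hp i : 0 < h 0 (f i) by have := enum_valP i.
  move=> le0; apply/rowP => i; rewrite mxE.
  have : \sum_i h 0 (f i) * x 0 i ^+ 2 == 0.
    rewrite eq_le le0 /=; apply: sumr_ge0 => j _.
    by rewrite mulr_ge0 ?sqr_ge0 ?ltW.
  rewrite psumr_eq0 => [/allP/(_ i (mem_index_enum i))|j _]; last first.
    by rewrite mulr_ge0 ?sqr_ge0 ?ltW.
  by rewrite mulf_eq0 gt_eqF //= sqrf_eq0 => /eqP.
exists (\sum_(i in S) h 0 i); split.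
- by apply: sumr_ge0 => i; rewrite inE => /ltW.
- apply: le_trans (sqr_sum_le _ _) _; apply: ler_pM => //.
    by apply: sumr_ge0 => i _; exact: sqr_ge0.
    by rewrite ler_nat.
  rewrite fD [leRHS](bigID (mem S)) /= lerDl; apply: sumr_ge0 => i _; exact: sqr_ge0.
- move=> N kappa hN; rewrite frobN mulr_sumr [leLHS](bigID (mem S)) /=.
  rewrite -[leRHS]addr0 lerD//.
    apply: ler_sum => i; rewrite inE => hi; rewrite ler_pM2r//.
    by have /andP[_] := hN (row i U); rewrite rowU mulr1.
  apply: sumr_le0 => i; rewrite inE -leNgt => hi; rewrite mulr_ge0_le0//.
  by have /andP[] := hN (row i U).
Qed.

Lemma frob_le_cross m n (D H : 'M[R]_(m, n)) :
  frob D H <= frob D D + frob H H / 4.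
Proof.
have := frob_ge0 (D - 2^-1 *: H).
rewrite !(frobDl, frobDr, frobNl, frobNr, frobZl, frobZr) (frobC H D); lra.
Qed.

Section estimator.
Variables (l : nat) (G A : 'M[R]_l) (mu : R).
Hypotheses (sA : A^T = A) (pA : forall v, 0 <= qform A v).
Hypothesis optA : forall B : 'M[R]_l, B^T = B -> (forall v, 0 <= qform B v) ->
  frob (G - A) (G - A) + mu * \tr A <= frob (G - B) (G - B) + mu * \tr B.

(** First-order optimality: the segment from [A] to [B] stays in the cone,
    where the objective is a quadratic polynomial in the parameter that is
    minimal at [0]. *)
Lemma variational_inequality (B : 'M[R]_l) : B^T = B -> (forall v, 0 <= qform B v) ->
  0 <= 2 * frob (A - G) (B - A) + mu * \tr (B - A).
Proof.
move=> sB pB; set L := _ + _; set Q := frob (B - A) (B - A).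
have Q0 : 0 <= Q by exact: frob_ge0.
have step t : 0 < t <= 1 -> 0 <= t * (L + t * Q).
  move=> /andP[t0 t1].
  have s1 : ((1 - t) *: A + t *: B)^T = (1 - t) *: A + t *: B.
    by rewrite linearD /= !linearZ /= sA sB.
  have p1 v : 0 <= qform ((1 - t) *: A + t *: B) v.
    by rewrite qformD !qformZ addr_ge0// mulr_ge0 ?pA ?pB ?subr_ge0// ltW.
  have := optA s1 p1.
  have -> : (1 - t) *: A + t *: B = A + t *: (B - A).
    by rewrite scalerBl scale1r scalerBr addrAC -addrA.
  rewrite opprD addrA mxtraceD mxtraceZ.
  rewrite (_ : frob (G - A - _) _ = frob (G - A) (G - A) + 2 * t * frob (A - G) (B - A) + t ^+ 2 * Q).
    by rewrite /L => h; nra.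
  rewrite -(opprB G A) /Q; move: (G - A) (B - A) => W E.
  rewrite !(frobDl, frobDr, frobNl, frobNr, frobZl, frobZr) (frobC E W); ring.
clearbody L Q; rewrite leNgt; apply/negP => L0.
(* If [L] were negative, the parameter [- L / (2 * Q - L)] would make the
   objective decrease. *)
have d0 : 0 < 2 * Q - L by lra.
have /step : 0 < - L / (2 * Q - L) <= 1.
  by rewrite divr_gt0 ?oppr_gt0//= ler_pdivrMr// mul1r; lra.
rewrite pmulr_rge0 ?divr_gt0 ?oppr_gt0//.
have -> : L + - L / (2 * Q - L) * Q = L * (Q - L) / (2 * Q - L).
  by field; rewrite gt_eqF.
rewrite pmulr_lge0 ?invr_gt0// nmulr_rge0//; lra.
Qed.

Variables (m : nat) (V : 'M[R]_(m, l)) (Delta : 'M[R]_l).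
Hypothesis GE : G = V^T *m V + Delta.
Hypothesis mu0 : 0 <= mu.
Let A0 := V^T *m V.
Let H := A - A0.

Let sA0 : A0^T = A0. Proof. by rewrite /A0 trmx_mul trmxK. Qed.
Let pA0 v : 0 <= qform A0 v. Proof. by rewrite qform_gram frob_ge0. Qed.

(** The variational inequality at [B = A0], with the penalty absorbed in the
    pairing as [mu / 2] times the identity. *)
Lemma basic_inequality : frob H H <= frob ((mu / 2)%:M - Delta) (A0 - A).
Proof.
have := variational_inequality sA0 pA0.
rewrite GE -/A0 -(opprB A A0) -/H opprD addrA -/H !frobNr !frobDl !frobNl.
rewrite raddfN /= -scalemx1 frobZl frob_tr1 => h; lra.
Qed.

(** The hypothesis places [mu / 2 - Delta] between [0] and [mu], so that the
    pairing of the basic inequality is at most [mu * s] with [s ^+ 2 <= m *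
    frob H H]. *)
Lemma error_le_rank :
  (forall v, `|qform Delta v| <= mu / 2 * frob v v) ->
  frob H H <= m%:R * mu ^+ 2.
Proof.
move=> hD; have [s [s0 s2 hs]] := frob_sub_psd_le V sA pA.
have /hs : forall v, 0 <= qform ((mu / 2)%:M - Delta) v <= mu * frob v v.
  move=> v; rewrite qformD qformN -scalemx1 qformZ qform1.
  by have := hD v; rewrite ler_norml => /andP[h1 h2]; apply/andP; split; lra.
move/(le_trans basic_inequality) => Hs.
move: s2; rewrite -/A0 -(opprB A A0) -/H frobNl frobNr opprK => s2.
have x0 := frob_ge0 H.
have s2m : s ^+ 2 <= m%:R * frob H H.
  by apply: le_trans s2 _; apply: ler_wpM2r => //; rewrite ler_nat geq_minl.
have [->|xn0] := eqVneq (frob H H) 0; first by rewrite mulr_ge0 ?sqr_ge0.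
have xp : 0 < frob H H by rewrite lt_def xn0.
rewrite -(ler_pM2r xp).
have : frob H H ^+ 2 <= (mu * s) ^+ 2 by rewrite ler_pXn2r ?nnegrE ?mulr_ge0.
rewrite exprMn -expr2 => /le_trans; apply.
by apply: le_trans (ler_wpM2l (sqr_ge0 mu) s2m) _; rewrite mulrCA mulrA.
Qed.

(** This bound covers the outcomes where the operator norm of [Delta] exceeds
    [mu / 2]: the term in [Delta] is absorbed by Young's inequality and only
    the identity part of the pairing uses the rank. *)
Lemma error_le_noise_norm :
  frob H H <= 2 * frob Delta Delta + (minn m l)%:R * mu ^+ 2.
Proof.
have [s [s0 s2 hs]] := frob_sub_psd_le V sA pA.
have /hs h1 : forall v, 0 <= qform ((mu / 2)%:M : 'M[R]_l) v <= mu / 2 * frob v v.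
  move=> v; rewrite -scalemx1 qformZ qform1 lexx andbT mulr_ge0 ?frob_ge0//.
  by rewrite divr_ge0.
have := basic_inequality; rewrite (frobDl (mu / 2)%:M) (frobNl Delta).
move: s2 h1; rewrite -/A0 -(opprB A A0) -/H !frobNl !frobNr !opprK.
set k := (minn m l)%:R; set x := frob H H => s2 h1 h2.
have x0 : 0 <= x := frob_ge0 H.
(* Each of the two terms of the pairing gives up a quarter of the left-hand
   side. *)
have h3 : frob Delta H <= frob Delta Delta + x / 4.
  exact: frob_le_cross.
have k0 : 0 <= k by rewrite ler0n.
have h4 : mu / 2 * s <= x / 4 + k * mu ^+ 2 / 4.
  have [k00|kn0] := eqVneq k 0.
    have -> : s = 0.
      by apply/eqP; rewrite -sqrf_eq0 eq_le sqr_ge0 andbT -(mul0r x) -k00.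
    by rewrite k00; lra.
  have kp : 0 < k by rewrite lt_def kn0.
  rewrite -(ler_pM2l kp).
  have := sqr_ge0 (s - k * mu); nra.
have h5 := mulr_ge0 k0 (sqr_ge0 mu); have := frob_ge0 Delta; lra.
Qed.

(** Comparison of [A] with the zero matrix. It replaces the other bounds when
    [mu] is too large to appear in the error, namely when the dimension
    exceeds the sample size. *)
Lemma error_le_signal_norm :
  frob H H <= 18 * frob A0 A0 + 16 * frob Delta Delta.
Proof.
have := @optA 0 (trmx0 _ _ _) (fun v => _).
rewrite mxtrace0 mulr0 addr0 subr0 => h0.
have {h0} h : frob (G - A) (G - A) + mu * \tr A <= frob G G.
  by apply: h0 => v; rewrite /qform mulmx0 mul0mx mxE.
have trA : 0 <= \tr A.
  apply: sumr_ge0 => i _; have := pA (delta_mx 0 i).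
  by rewrite /qform trmx_delta -rowE -colE !mxE.
have {h} h : frob (G - A) (G - A) <= frob G G by have := mulr_ge0 mu0 trA; lra.
(* The bound is a combination of the comparison with zero and of these three
   squares. *)
have p1 := frob_ge0 (G - 2^-1 *: A).
have p2 := frob_ge0 (A0 - Delta).
have p3 := frob_ge0 (A + A0).
move: h p1 p2 p3; rewrite /H GE -/A0 !(frobDl, frobDr, frobNl, frobNr, frobZl, frobZr).
rewrite (frobC Delta A0) (frobC A A0) (frobC A Delta).
nra.
Qed.

End estimator.
End Penalized.

(** * A net of the unit ball *)

Section Net.
Context {R : realType}.

Lemma frob_rowE n (u v : 'rV[R]_n) : frob u v = \sum_i u 0 i * v 0 i.
Proof. by rewrite frobE big_ord1. Qed.

(** A point of the net has coordinates in the grid of step [1 / (8 * sqrt l)],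
    encoded by a sign and an absolute value. The absolute values of a point in
    the unit ball are at most [8 * sqrt l], and [64 * l] is a bound for them
    that avoids rounding a square root. *)
Definition net_index l := {ffun 'I_l -> bool * 'I_(64 * l).+1}.

Definition in_net l : pred (net_index l) :=
  [pred z : net_index l | (\sum_i (z i).2 ^ 2 <= 64 * l)%N].

Definition net_point l (z : net_index l) : 'rV[R]_l :=
  \row_i ((-1) ^+ (z i).1 * (z i).2%:R / (8 * Num.sqrt l%:R)).

Lemma net_point_norm l (z : net_index l) : (0 < l)%N -> in_net z ->
  frob (net_point z) (net_point z) <= 1.
Proof.
move=> l0; rewrite /in_net /= => hz; have lp : 0 < l%:R :> R by rewrite ltr0n.
have -> : frob (net_point z) (net_point z) = (\sum_i (z i).2 ^ 2)%N%:R / (64 * l%:R).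
  rewrite frob_rowE natr_sum mulr_suml; apply: eq_bigr => i _.
  rewrite !mxE -expr2 !exprMn exprVn exprMn sqr_sqrtr ?ler0n// -exprM mulnC exprM.
  by rewrite sqrrN expr1n expr1n mul1r natrX; congr (_ / (_ * _)); ring.
rewrite ler_pdivrMr ?mulr_gt0// mul1r.
by move: hz; rewrite -(ler_nat R) natrM.
Qed.

(** Each coordinate is rounded towards zero, which keeps the point in the unit
    ball and moves each of the [l] coordinates by at most [1 / (8 * sqrt l)].
    *)
Lemma net_approx l (u : 'rV[R]_l) : (0 < l)%N -> frob u u = 1 ->
  exists2 z : net_index l, in_net z &
    frob (u - net_point z) (u - net_point z) <= 64^-1.
Proof.
move=> l0 u1; have lp : 0 < l%:R :> R by rewrite ltr0n.
pose D : R := 8 * Num.sqrt l%:R; have Dp : 0 < D by rewrite mulr_gt0 ?sqrtr_gt0.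
have D2 : D ^+ 2 = 64 * l%:R by rewrite exprMn sqr_sqrtr ?ler0n//; ring.
pose k i := Num.truncn (D * `|u 0 i|).
have kP i : (k i)%:R <= D * `|u 0 i| < (k i).+1%:R.
  by apply: truncn_itv; rewrite mulr_ge0// ltW.
have ks : (\sum_i k i ^ 2 <= 64 * l)%N.
  rewrite -(ler_nat R) natr_sum natrM -D2.
  have -> : D ^+ 2 = \sum_i (D * `|u 0 i|) ^+ 2.
    rewrite -[LHS]mulr1 -u1 frob_rowE mulr_sumr; apply: eq_bigr => i _.
    by rewrite [in RHS]exprMn real_normK ?num_real// expr2.
  apply: ler_sum => j _; have /andP[kj _] := kP j.
  by rewrite natrX ler_pXn2r ?nnegrE// mulr_ge0// ltW.
have kb i : (k i < (64 * l).+1)%N.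
  rewrite ltnS; apply: leq_trans ks; rewrite (bigD1 i) //=.
  by apply: leq_trans (leq_addr _ _); case: (k i) => // n; rewrite leq_pmulr.
exists [ffun i => (u 0 i < 0, Ordinal (kb i))].
  by rewrite /in_net /= (eq_bigr (fun i => k i ^ 2)%N)// => i _; rewrite ffunE.
have -> : 64^-1 = \sum_(i < l) D ^- 2.
  rewrite sumr_const card_ord D2 -[LHS]mulr1 -mulr_natr; field.
  by rewrite gt_eqF.
rewrite frob_rowE; apply: ler_sum => i _; rewrite -expr2 !mxE ffunE /= -/D.
have -> : (u 0 i - (-1) ^+ (u 0 i < 0)%R * (k i)%:R / D) ^+ 2 =
          (`|u 0 i| - (k i)%:R / D) ^+ 2.
  case: (ltrP (u 0 i) 0) => h /=.
    by rewrite expr1 ltr0_norm// -[LHS]sqrrN; congr (_ ^+ 2); rewrite !mulN1r mulNr; ring.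
  by rewrite expr0 mul1r ger0_norm.
have /andP[k1 k2] := kP i.
have h1 : 0 <= `|u 0 i| - (k i)%:R / D by rewrite subr_ge0 ler_pdivrMr// mulrC.
have h2 : 0 <= D^-1 by rewrite invr_ge0 ltW.
rewrite -exprVn ler_pXn2r ?nnegrE//.
rewrite -(ler_pM2l Dp) mulrBr mulrCA !divff ?gt_eqF// mulr1 lerBlDl natr1.
exact: ltW.
Qed.

(** A point of the net satisfies [\sum_i k_i <= \sum_i k_i ^ 2 <= 64 * l],
    where [k_i] is the grid value of its [i]-th coordinate. It therefore
    contributes at least [1] to the sum over all indices of [2 ^ (64 * l -
    \sum_i k_i)], which factors over the coordinates into geometric series of
    sum at most [4]. *)
Lemma card_in_net l : (#|@in_net l| <= 2 ^ (66 * l))%N.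
Proof.
rewrite -(ler_nat R).
have w (z : net_index l) : in_net z ->
    1 <= 2 ^+ (64 * l) * \prod_i 2^-1 ^+ (z i).2 :> R.
  rewrite /in_net /= => hz; rewrite -expr_sum exprVn.
  rewrite ler_pdivlMr ?exprn_gt0// mul1r ler_eXn2l ?ltr1n//.
  apply: leq_trans hz; apply: leq_sum => i _.
  by case: (nat_of_ord _) => // n; rewrite leq_pmulr.
have -> : #|@in_net l|%:R = \sum_(z : net_index l | in_net z) 1 :> R.
  by rewrite -sum1_card natr_sum; apply: eq_bigl => z; rewrite unfold_in.
apply: (@le_trans _ _ (\sum_(z : net_index l) 2 ^+ (64 * l) * \prod_i 2^-1 ^+ (z i).2)).
  rewrite [leRHS](bigID (@in_net l)) /= -[leLHS]addr0 lerD//.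
    by apply: ler_sum => z /w.
  apply: sumr_ge0 => z _; rewrite mulr_ge0 ?exprn_ge0//.
  by apply: prodr_ge0 => i _; rewrite exprn_ge0// invr_ge0.
rewrite -mulr_sumr.
have -> : \sum_(z : net_index l) \prod_i 2^-1 ^+ (z i).2 =
          \prod_(i < l) \sum_(p : bool * 'I_(64 * l).+1) 2^-1 ^+ p.2 :> R.
  by rewrite bigA_distr_bigA.
have g (n : nat) : \sum_(i < n) 2^-1 ^+ i = 2 - 2 * 2^-1 ^+ n :> R.
  elim: n => [|n IH]; first by rewrite big_ord0 expr0; ring.
  by rewrite big_ord_recr /= IH exprS; field.
have -> : \sum_(p : bool * 'I_(64 * l).+1) 2^-1 ^+ p.2 = 4 - 4 * 2^-1 ^+ (64 * l).+1 :> R.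
  rewrite -(pair_big xpredT xpredT (fun (b : bool) (i : 'I_(64 * l).+1) => 2^-1 ^+ i)) /=.
  by rewrite big_const card_bool /= addr0 g; ring.
rewrite prodr_const card_ord natrX (mulnDl 64 2) exprD ler_pM2l ?exprn_gt0//.
rewrite exprM; have h0 : 0 <= 2^-1 ^+ (64 * l).+1 :> R by rewrite exprn_ge0// invr_ge0.
have h1 : 2^-1 ^+ (64 * l).+1 <= 1 :> R by rewrite exprn_ile1 ?invr_ge0// invf_le1// ler1n.
by apply: lerXn2r; rewrite ?nnegrE; lra.
Qed.

Lemma qform_frob n (A : 'M[R]_n) v : qform A v = frob (v *m A) v.
Proof. by rewrite frob_row. Qed.

Lemma frob_sym n (A : 'M[R]_n) (u v : 'rV[R]_n) : A^T = A -> frob (v *m A) u = frob (u *m A) v.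
Proof. by move=> sA; rewrite [RHS]frobC !frob_row trmx_mul sA mulmxA. Qed.

Lemma polar_form_le n (A : 'M[R]_n) (kappa : R) : A^T = A ->
  (forall v, `|qform A v| <= kappa * frob v v) ->
  forall u v : 'rV[R]_n, `|frob (u *m A) v| <= kappa * (frob u u + frob v v) / 2.
Proof.
move=> sA hA u v.
have := hA (u + v); have := hA (u - v).
rewrite !ler_norml => /andP[a1 a2] /andP[b1 b2].
move: a1 a2 b1 b2; rewrite !qform_frob !mulmxDl !mulNmx !(frobDl, frobDr, frobNl, frobNr).
rewrite (frob_sym v u sA) (frobC v u) => a1 a2 b1 b2.
by apply/andP; split; lra.
Qed.

(** Among unit vectors, the absolute value of the quadratic form is largest at
    an eigenvector [u]. A point [z] of the net within [1/8] of [u] loses at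
    most [5/16] of the extreme eigenvalue, by polarization of the difference
    into [u - z] and [u + z]. *)
Lemma net_bound l (A : 'M[R]_l) (a : R) : (0 < l)%N -> A^T = A ->
  (forall z : net_index l, in_net z -> `|qform A (net_point z)| <= a) ->
  forall v, `|qform A v| <= 2 * a * frob v v.
Proof.
move=> l0 sA hz; have [U [d [UU AE]]] := sym_spectral sA.
have UU' : U^T *m U = 1%:M by exact: mulmx1C.
have qE v : qform A v = \sum_i d 0 i * (v *m U^T) 0 i ^+ 2.
  by rewrite AE (_ : _ *m U = U^T *m diag_mx d *m U^T^T) ?qform_conj ?qform_diag// trmxK.
have nE (v : 'rV[R]_l) : frob v v = \sum_i (v *m U^T) 0 i ^+ 2.
  have -> : frob v v = frob (v *m U^T) (v *m U^T).
    by rewrite !frob_row trmx_mul trmxK !mulmxA -(mulmxA v) UU' mulmx1.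
  by rewrite frob_rowE; apply: eq_bigr => i _; rewrite expr2.
have [j _ jmax] := @Order.TotalTheory.arg_maxP _ _ _ (Ordinal l0) xpredT (fun i => `|d 0 i|) isT.
pose kappa := `|d 0 j|.
have hk v : `|qform A v| <= kappa * frob v v.
  rewrite qE nE mulr_sumr; apply: le_trans (ler_norm_sum _ _ _) _.
  apply: ler_sum => i _; rewrite normrM [X in _ * X]ger0_norm ?sqr_ge0//.
  by apply: ler_wpM2r; rewrite ?sqr_ge0//; exact: jmax.
pose u := row j U.
have uU : u *m U^T = delta_mx 0 j by rewrite /u -row_mul UU row1.
have u1 : frob u u = 1.
  rewrite nE uU (bigD1 j) //= big1 => [|i ij]; first by rewrite mxE !eqxx expr1n addr0.
  by rewrite mxE (negbTE ij) andbF expr0n.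
have qu : `|qform A u| = kappa.
  rewrite qE uU (bigD1 j) //= big1 => [|i ij].
    by rewrite mxE !eqxx expr1n addr0 mulr1.
  by rewrite mxE (negbTE ij) andbF expr0n mulr0.
have [z zin zu] := net_approx l0 u1.
have k0 : 0 <= kappa by exact: normr_ge0.
have zn := net_point_norm l0 zin.
have diff : `|qform A u - qform A (net_point z)| <= kappa * 5 / 16.
  have -> : qform A u - qform A (net_point z) =
      frob ((8 *: (u - net_point z)) *m A) (u + net_point z) / 8.
    rewrite -scalemxAl frobZl mulmxBl !(frobDl, frobDr, frobNl, frobNr).
    by rewrite (frob_sym u (net_point z) sA) !qform_frob; field.
  rewrite normrM [X in _ * X]ger0_norm ?invr_ge0//.
  have h1 : frob (8 *: (u - net_point z)) (8 *: (u - net_point z)) <= 1.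
    by rewrite frobZl frobZr; lra.
  have h2 : frob (u + net_point z) (u + net_point z) <= 4.
    have := frob_ge0 (u - net_point z).
    rewrite !(frobDl, frobDr, frobNl, frobNr) (frobC (net_point z) u) u1.
    move: zn; set q := frob (net_point z) _; set w := frob u _ => zn h; lra.
  have := polar_form_le sA hk (8 *: (u - net_point z)) (u + net_point z).
  by move=> h; nra.
have kle : kappa <= 2 * a.
  have := hz z zin; have := ler_normD (qform A u - qform A (net_point z)) (qform A (net_point z)).
  rewrite subrK qu => h1 h2; lra.
by move=> v; apply: le_trans (hk v) _; apply: ler_wpM2r => //; exact: frob_ge0.
Qed.

(** Every entry of [A] is a value of the polar form at two unit vectors. *)
Lemma frob_le_qform l (A : 'M[R]_l) (kappa : R) : 0 <= kappa -> A^T = A ->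
  (forall v, `|qform A v| <= kappa * frob v v) ->
  frob A A <= l%:R ^+ 2 * kappa ^+ 2.
Proof.
move=> k0 sA hA.
have hij i j : `|A i j| <= kappa.
  have := polar_form_le sA hA (delta_mx 0 i) (delta_mx 0 j).
  rewrite !frob_row !trmx_delta !mul_delta_mx -rowE -colE !mxE !eqxx.
  rewrite /= mulr1n => h; apply: le_trans h _; lra.
rewrite frobE; apply: (@le_trans _ _ (\sum_(i < l) \sum_(j < l) kappa ^+ 2)).
  apply: ler_sum => i _; apply: ler_sum => j _.
  by rewrite -expr2 -[_ ^+ 2]real_normK ?num_real// lerXn2r ?nnegrE.
by rewrite !sumr_const !card_ord expr2 -mulrA !mulr_natl.
Qed.

End Net.

(** * The nuclear norm of a non-negative definite matrix *)

Section Nuclear.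
Context {R : realType}.

Lemma mup_prod_XsubC (n : nat) (a : 'I_n -> R) x :
  mup x (\prod_(i < n) ('X - (a i)%:P)) = (\sum_(i < n) (a i == x))%N.
Proof.
elim: n a => [|n IH] a.
  by rewrite !big_ord0 mupNroot// root1.
rewrite !big_ord_recr /= mupM ?IH ?polyXsubC_eq0//; last first.
  by apply/prodf_neq0 => i _; rewrite polyXsubC_eq0.
congr (_ + _)%N; have := mup_XsubCX 1 x (a ord_max).
by rewrite expr1 => ->; rewrite eq_sym; case: eqP.
Qed.

(** The singular values of [A = U^T *m diag_mx d *m U] are the numbers [d 0 i]
    themselves. Since the nuclear norm is a sum over distinct eigenvalues of
    [A^T *m A] weighted by their multiplicities, the characteristic polynomial
    is used in factored form. *)
Lemma nuclear_norm_psd l (A : 'M[R]_l) : sym_psd A -> nuclear_norm A = \tr A.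
Proof.
move=> [sA pA]; have [U [d [UU AE]]] := sym_spectral sA.
have UU' : U^T *m U = 1%:M by exact: mulmx1C.
pose c i := d 0 i ^+ 2.
have A2 : A^T *m A = U^T *m diag_mx (\row_i c i) *m U.
  rewrite sA {1 2}AE -!mulmxA (mulmxA U) UU mul1mx (mulmxA (diag_mx d)).
  congr (_ *m (_ *m _)); apply/matrixP => i j; rewrite mul_diag_mx !mxE.
  by rewrite /c; case: eqP => [->|_]; rewrite ?mulr1n ?mulr0n ?mulr0// expr2.
have d0 i : 0 <= d 0 i.
  have := pA (row i U); rewrite -/(qform A (row i U)) AE.
  rewrite (_ : _ *m U = U^T *m diag_mx d *m U^T^T); last by rewrite trmxK.
  rewrite qform_conj -row_mul UU row1 qform_diag (bigD1 i) //= big1 => [|j ji].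
    by rewrite mxE !eqxx expr1n addr0 mulr1.
  by rewrite mxE (negbTE ji) andbF expr0n mulr0.
rewrite /nuclear_norm.
have cp : char_poly (A^T *m A) = \prod_i ('X - (c i)%:P).
  by rewrite A2 char_poly_orthogonal//; apply: eq_bigr => i _; rewrite mxE.
have setE : [set x : R | eigenvalue (A^T *m A) x] = [set` undup (codom c)].
  apply/seteqP; split => x /=; rewrite mem_undup eigenvalue_root_char cp /root horner_prod.
    case/prodf_eq0 => i _; rewrite hornerXsubC subr_eq0 => /eqP ->; exact: codom_f.
  case/codomP => i ->; apply/prodf_eq0; exists i => //.
  by rewrite hornerXsubC subrr.
rewrite setE -fsbig_seq ?undup_uniq// cp.
transitivity (\sum_i Num.sqrt (c i)).
  transitivity (\sum_(x <- undup (codom c)) \sum_i (if c i == x then Num.sqrt (c i) else 0)).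
        apply: eq_bigr => x _; rewrite mup_prod_XsubC -sumrMnr.
    by apply: eq_bigr => i _; case: eqP => [->|_].
  rewrite exchange_big /=; apply: eq_bigr => i _.
  rewrite -big_mkcond /= (eq_bigl (xpred1 (c i))); last by move=> x; rewrite eq_sym.
  rewrite -big_filter filter_pred1_uniq ?undup_uniq ?big_seq1//.
  by rewrite mem_undup codom_f.
rewrite AE mxtrace_mulC mulmxA UU mul1mx mxtrace_diag.
by apply: eq_bigr => i _; rewrite /c sqrtr_sqr ger0_norm.
Qed.

End Nuclear.

(** * Square integrable functions on the unit interval *)

Section L2.
Context {R : realType}.
Local Notation mu := (@lebesgue_measure R).
Local Notation D := (`[0%R, 1%R]%classic : set R).
Implicit Types f g h : R -> R.

Let mD : measurable (D : set (g_sigma_algebraType (R.-ocitv.-measurable))).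
Proof. exact: measurable_itv. Qed.

Lemma in_L2_measurable f : in_L2 f -> measurable_fun D f.
Proof. by case. Qed.

Lemma in_L2_sqr_integrable f : in_L2 f -> mu.-integrable D (EFin \o (fun t => f t ^+ 2)).
Proof.
move=> [mf fi]; apply/integrableP; split.
  by apply/measurable_EFinP; exact: measurable_funX.
apply: le_lt_trans fi; rewrite /sqnorm01 le_eqVlt; apply/orP; left; apply/eqP.
by apply: eq_integral => x _ /=; rewrite ger0_norm ?sqr_ge0.
Qed.

Lemma in_L2_mul_integrable f g : in_L2 f -> in_L2 g ->
  mu.-integrable D (EFin \o (fun t => f t * g t)).
Proof.
move=> hf hg.
have := integrableD mD (in_L2_sqr_integrable hf) (in_L2_sqr_integrable hg).
apply: le_integrable => //.
  by apply/measurable_EFinP; apply: measurable_funM; exact: in_L2_measurable.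
move=> x _ /=; rewrite lee_fin normrM [leRHS]ger0_norm ?addr_ge0 ?sqr_ge0//.
rewrite -[f x ^+ 2]real_normK ?num_real// -[g x ^+ 2]real_normK ?num_real//.
have := normr_ge0 (f x); have := normr_ge0 (g x); nra.
Qed.

Lemma in_L2I f : measurable_fun D f ->
  mu.-integrable D (EFin \o (fun t => f t ^+ 2)) -> in_L2 f.
Proof.
move=> mf /integrableP[_ fi]; split=> //; apply: le_lt_trans fi.
rewrite /sqnorm01 le_eqVlt; apply/orP; left; apply/eqP.
by apply: eq_integral => x _ /=; rewrite ger0_norm ?sqr_ge0.
Qed.

Lemma in_L2D f g : in_L2 f -> in_L2 g -> in_L2 (fun t => f t + g t).
Proof.
move=> hf hg; apply: in_L2I.
  by apply: measurable_funD; exact: in_L2_measurable.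
have := integrableD mD (integrableD mD (in_L2_sqr_integrable hf) (in_L2_sqr_integrable hg))
  (integrableD mD (in_L2_mul_integrable hf hg) (in_L2_mul_integrable hf hg)).
apply: eq_integrable => // x _ /=; rewrite -!EFinD; congr EFin; ring.
Qed.

Lemma in_L2Z a f : in_L2 f -> in_L2 (fun t => a * f t).
Proof.
move=> hf; apply: in_L2I.
  by apply: measurable_funM => //; exact: in_L2_measurable.
have := integrableZl mD (a ^+ 2) (in_L2_sqr_integrable hf).
by apply: eq_integrable => // x _ /=; rewrite -EFinM exprMn.
Qed.

Lemma in_L2_0 : in_L2 (fun _ : R => 0).
Proof.
split; first exact: measurable_cst.
rewrite /sqnorm01 (eq_integral (fun=> 0%E)) ?integral0 ?ltry// => x _.
by rewrite expr0n.
Qed.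

Lemma in_L2_sum (I : Type) (s : seq I) (F : I -> R -> R) :
  (forall i, in_L2 (F i)) -> in_L2 (fun t => \sum_(i <- s) F i t).
Proof.
move=> hF; elim: s => [|i s IH].
  by under eq_fun do rewrite big_nil; exact: in_L2_0.
by under eq_fun do rewrite big_cons; exact: in_L2D.
Qed.

Lemma in_L2_lin (I : Type) (s : seq I) (c : I -> R) (F : I -> R -> R) :
  (forall i, in_L2 (F i)) -> in_L2 (fun t => \sum_(i <- s) c i * F i t).
Proof. by move=> hF; apply: in_L2_sum => i; exact: in_L2Z. Qed.

Lemma in_L2B f g : in_L2 f -> in_L2 g -> in_L2 (fun t => f t - g t).
Proof.
move=> hf hg; have := in_L2D hf (in_L2Z (-1) hg).
by under eq_fun do rewrite mulN1r.
Qed.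

Lemma sqnorm01E f : in_L2 f -> sqnorm01 f = (inner01 f f)%:E.
Proof.
move=> hf; rewrite /inner01 /Rintegral fineK; last first.
  by apply: integrable_fin_num => //; exact: in_L2_mul_integrable.
by apply: eq_integral => x _; rewrite expr2.
Qed.

Lemma inner01C f g : inner01 f g = inner01 g f.
Proof. by apply: eq_Rintegral => x _; rewrite mulrC. Qed.

Lemma inner01_ge0 f : 0 <= inner01 f f.
Proof. by apply: Rintegral_ge0 => x _; rewrite -expr2 sqr_ge0. Qed.

Lemma inner01Dl f g h : in_L2 f -> in_L2 g -> in_L2 h ->
  inner01 (fun t => f t + g t) h = inner01 f h + inner01 g h.
Proof.
move=> hf hg hh; rewrite /inner01 -RintegralD//; last 2 first.
- exact: in_L2_mul_integrable.
- exact: in_L2_mul_integrable.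
by apply: eq_Rintegral => x _; rewrite mulrDl.
Qed.

Lemma inner01Zl a f h : in_L2 f -> in_L2 h ->
  inner01 (fun t => a * f t) h = a * inner01 f h.
Proof.
move=> hf hh; rewrite /inner01 -RintegralZl//; last exact: in_L2_mul_integrable.
by apply: eq_Rintegral => x _; rewrite mulrA.
Qed.

Lemma inner01_0l h : inner01 (fun=> 0) h = 0.
Proof.
rewrite /inner01 (@eq_Rintegral _ _ _ _ _ (fun=> 0)); last by move=> x _; rewrite mul0r.
by rewrite Rintegral_cst// mul0r.
Qed.

Lemma inner01_suml (I : Type) (s : seq I) (c : I -> R) (F : I -> R -> R) h :
  (forall i, in_L2 (F i)) -> in_L2 h ->
  inner01 (fun t => \sum_(i <- s) c i * F i t) h = \sum_(i <- s) c i * inner01 (F i) h.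
Proof.
move=> hF hh; elim: s => [|i s IH].
  by under eq_fun do rewrite big_nil; rewrite big_nil inner01_0l.
rewrite big_cons -IH -inner01Zl// -inner01Dl//; last 2 first.
- exact: in_L2Z.
- exact: in_L2_lin.
by congr (inner01 _ h); apply/funext => t; rewrite big_cons.
Qed.

Lemma inner01_sumr (I : Type) (s : seq I) (c : I -> R) (F : I -> R -> R) h :
  (forall i, in_L2 (F i)) -> in_L2 h ->
  inner01 h (fun t => \sum_(i <- s) c i * F i t) = \sum_(i <- s) c i * inner01 h (F i).
Proof.
move=> hF hh; rewrite inner01C inner01_suml//.
by apply: eq_bigr => i _; rewrite inner01C.
Qed.

Lemma inner01Bl f g h : in_L2 f -> in_L2 g -> in_L2 h ->
  inner01 (fun t => f t - g t) h = inner01 f h - inner01 g h.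
Proof.
move=> hf hg hh; rewrite -mulN1r -inner01Zl// -inner01Dl//; last exact: in_L2Z.
by congr (inner01 _ h); apply/funext => t; rewrite mulN1r.
Qed.

Lemma eq_inner01 f f' g g' : {in D, f =1 f'} -> {in D, g =1 g'} ->
  inner01 f g = inner01 f' g'.
Proof. by move=> ff gg; apply: eq_Rintegral => x xD; rewrite ff// gg. Qed.

(** By Tonelli's theorem the integral over the square is iterated, and both
    integrals of the expanded square are inner products on the interval. *)
Lemma sqnorm_square_tensor (I : finType) (f g : I -> R -> R) (F : R -> R -> R) :
  (forall a, in_L2 (f a)) -> (forall a, in_L2 (g a)) ->
  (forall t u, t \in D -> u \in D -> F t u = \sum_a f a t * g a u) ->
  sqnorm_square F =
  (\sum_a \sum_b inner01 (f a) (f b) * inner01 (g a) (g b))%:E.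
Proof.
move=> hf hg FE.
pose f' a := f a \_ D; pose g' a := g a \_ D.
have mf' a : measurable_fun setT (f' a).
  by apply/(measurable_restrictT _ _).1 => //; exact: in_L2_measurable.
have mg' a : measurable_fun setT (g' a).
  by apply/(measurable_restrictT _ _).1 => //; exact: in_L2_measurable.
pose G (z : R * R) : \bar R := ((\sum_a f' a z.1 * g' a z.2) ^+ 2)%:E.
have -> : sqnorm_square F = (\int[mu \x mu]_z G z)%E.
  rewrite /sqnorm_square integral_mkcond; apply: eq_integral => -[t u] _.
  rewrite /patch /G /= /f' /g' /patch in_setX /=.
  case: ifPn => [/andP[tD uD]|].
    by rewrite FE//; congr ((_ ^+ 2)%:E); apply: eq_bigr => a _; rewrite tD uD.
  rewrite negb_and => tu; rewrite big1 ?expr0n// => a _.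
  by case/orP: tu => /negbTE ->; rewrite ?mul0r ?mulr0.
rewrite fubini_tonelli1; last 2 first.
- apply/measurable_EFinP; apply: measurable_funX; apply: measurable_sum => a.
  by apply: measurable_funM; exact: measurableT_comp.
- by move=> z; rewrite lee_fin sqr_ge0.
rewrite /fubini_F.
transitivity (\int[mu]_(t in D) (\sum_a \sum_b inner01 (g a) (g b) * (f a t * f b t))%:E)%E.
  rewrite [RHS]integral_mkcond; apply: eq_integral => t _.
  rewrite /patch; case: ifPn => tD; last first.
    rewrite (eq_integral (fun=> 0%E)) ?integral0// => u _.
    rewrite /G /= big1 ?expr0n// => a _.
    by rewrite /f' /patch (negbTE tD) mul0r.
  pose h u := \sum_a f a t * g a u.
  have hh : in_L2 h by exact: in_L2_lin.
  transitivity (sqnorm01 h).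
    rewrite /sqnorm01 [RHS]integral_mkcond; apply: eq_integral => u _.
    rewrite /patch /G /= /f' /g' /patch tD; case: ifPn => uD //.
    by rewrite big1 ?expr0n// => a _; rewrite mulr0.
  rewrite sqnorm01E//; congr EFin; rewrite inner01_suml//.
  apply: eq_bigr => a _; rewrite inner01_sumr// mulr_sumr.
  by apply: eq_bigr => b _; ring.
under eq_integral do rewrite -sumEFin.
rewrite integral_sum//; last first.
  move=> a; under [X in _.-integrable _ X]eq_fun do rewrite -sumEFin.
  apply: integrable_sum => // b _; under [X in _.-integrable _ X]eq_fun do rewrite EFinM.
  by apply: integrableZl => //; exact: in_L2_mul_integrable.
rewrite -sumEFin; apply: eq_bigr => a _.
under eq_integral do rewrite -sumEFin.
rewrite integral_sum//; last first.
  move=> b; under [X in _.-integrable _ X]eq_fun do rewrite EFinM.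
  by apply: integrableZl => //; exact: in_L2_mul_integrable.
rewrite -sumEFin; apply: eq_bigr => b _.
under eq_integral do rewrite EFinM.
rewrite integralZl//; last exact: in_L2_mul_integrable.
rewrite mulrC EFinM; congr (_ * _)%E; rewrite /inner01 /Rintegral fineK//.
by apply: integrable_fin_num => //; exact: in_L2_mul_integrable.
Qed.

End L2.

(** * Kernels and their compressions *)

Section Kernels.
Context {R : realType}.
Local Notation D := (`[0%R, 1%R]%classic : set R).

Lemma sum_delta (I : finType) (i : I) (F : I -> R) :
  \sum_j (i == j)%:R * F j = F i.
Proof.
rewrite (bigD1 i) //= eqxx mul1r big1 ?addr0// => j ji.
by rewrite eq_sym (negbTE ji) mul0r.
Qed.

(** Pythagoras for the projection on a finite orthonormal family. *)
Lemma bessel (I : finType) (h : I -> R -> R) (f : R -> R) :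
  (forall i, in_L2 (h i)) -> (forall i j, inner01 (h i) (h j) = (i == j)%:R) ->
  in_L2 f ->
  inner01 (fun t => f t - \sum_i inner01 f (h i) * h i t)
          (fun t => f t - \sum_i inner01 f (h i) * h i t) =
  inner01 f f - \sum_i inner01 f (h i) ^+ 2.
Proof.
move=> hL ho fL; set P := fun t => \sum_i inner01 f (h i) * h i t.
have PL : in_L2 P by exact: in_L2_lin.
have PLf : in_L2 (fun t => f t - P t) by exact: in_L2B.
have fP : inner01 P f = \sum_i inner01 f (h i) ^+ 2.
  by rewrite inner01_suml//; apply: eq_bigr => i _; rewrite (inner01C (h i)) expr2.
have PP : inner01 P P = \sum_i inner01 f (h i) ^+ 2.
  rewrite inner01_suml//; apply: eq_bigr => i _.
  rewrite inner01_sumr// (eq_bigr (fun j => (i == j)%:R * inner01 f (h j))).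
    by rewrite sum_delta expr2.
  by move=> j _; rewrite ho mulrC.
rewrite inner01Bl// (inner01C f) (inner01C P) !inner01Bl//.
by rewrite (inner01C f P) fP PP; ring.
Qed.

Lemma bessel_le (I : finType) (h : I -> R -> R) (f : R -> R) :
  (forall i, in_L2 (h i)) -> (forall i j, inner01 (h i) (h j) = (i == j)%:R) ->
  in_L2 f -> \sum_i inner01 f (h i) ^+ 2 <= inner01 f f.
Proof. by move=> hL ho fL; rewrite -subr_ge0 -bessel// inner01_ge0. Qed.

Section basis.
Variable e : nat -> R -> R.
Hypothesis eO : orthonormal01 e.

Let eL k : in_L2 (e k). Proof. by case: eO. Qed.

Let eE (l : nat) (i j : 'I_l) : inner01 (e i) (e j) = (i == j)%:R.
Proof. by case: eO => _ ->. Qed.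

Definition basis_comb l (v : 'rV[R]_l) (t : R) : R := \sum_(j < l) v 0 j * e j t.

Lemma in_L2_basis_comb l (v : 'rV[R]_l) : in_L2 (basis_comb v).
Proof. exact: in_L2_lin. Qed.

Lemma inner01_basis_comb l (u v : 'rV[R]_l) : inner01 (basis_comb u) (basis_comb v) = frob u v.
Proof.
rewrite frob_rowE /basis_comb inner01_suml//; last exact: in_L2_basis_comb.
apply: eq_bigr => i _; rewrite inner01_sumr//; congr (_ * _).
rewrite (eq_bigr (fun j => (i == j)%:R * v 0 j)) ?sum_delta// => j _.
by rewrite eE mulrC.
Qed.

Lemma kernel_ofE l (A : 'M[R]_l) t u :
  kernel_of e A t u = \sum_(j < l) e j t * basis_comb (row j A) u.
Proof.
rewrite /kernel_of; apply: eq_bigr => j _; rewrite mulr_sumr.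
by apply: eq_bigr => k _; rewrite !mxE; ring.
Qed.

Lemma sqnorm_kernel_of l (A : 'M[R]_l) F :
  (forall t u, F t u = kernel_of e A t u) ->
  sqnorm_square F = (frob A A)%:E.
Proof.
move=> FE; rewrite (@sqnorm_square_tensor _ _ (fun j : 'I_l => e j)
   (fun j => basis_comb (row j A)))//; last first.
- by move=> t u _ _; rewrite FE kernel_ofE.
- by move=> a; exact: in_L2_basis_comb.
congr EFin; rewrite frobE; apply: eq_bigr => i _.
under eq_bigr do rewrite eE.
by rewrite sum_delta inner01_basis_comb frob_rowE; apply: eq_bigr => j _; rewrite !mxE.
Qed.

Section one_kernel.
Variables (m : nat) (lam : 'I_m -> R) (phi : 'I_m -> R -> R) (K : R -> R -> R).
Hypothesis KE : spectral_decomposition K lam phi.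

Let lam0 p : 0 < lam p. Proof. by case: KE. Qed.
Let phiL p : in_L2 (phi p). Proof. by case: KE => _ []. Qed.
Let phiO p q : inner01 (phi p) (phi q) = (p == q)%:R.
Proof. by case: KE => _ []. Qed.

(** The rows are weighted by the square roots of the eigenvalues so that the
    compression is a Gram matrix; its rank is then visibly at most [m]. *)
Definition coef_factor l : 'M[R]_(m, l) :=
  \matrix_(p, j) (Num.sqrt (lam p) * inner01 (phi p) (e j)).

Definition compression l : 'M[R]_l := (coef_factor l)^T *m coef_factor l.

Lemma compressionE l j k : compression l j k =
  \sum_p lam p * inner01 (phi p) (e j) * inner01 (phi p) (e k).
Proof.
rewrite mxE; apply: eq_bigr => p _; rewrite !mxE.
by rewrite mulrACA -expr2 sqr_sqrtr ?mulrA// ltW.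
Qed.

(** The right-hand side mentions only [K], hence the left-hand side is the
    same for all spectral decompositions of [K]. Each sample comes with its
    own decomposition, and this identifies their variances. *)
Lemma compression_kernel f g : in_L2 f -> in_L2 g ->
  \sum_p lam p * inner01 (phi p) f * inner01 (phi p) g =
  inner01 (fun t => inner01 (K t) f) g.
Proof.
move=> fL gL; transitivity (inner01 (fun t => \sum_p (lam p * inner01 (phi p) f) * phi p t) g).
  by rewrite inner01_suml//; apply: eq_bigr => p _; rewrite mulrA.
apply: eq_inner01 => // t tD.
transitivity (inner01 (fun u => \sum_p (lam p * phi p t) * phi p u) f).
  by rewrite inner01_suml//; apply: eq_bigr => p _; ring.
by apply: eq_inner01 => // u uD; case: KE => _ _ KE3; rewrite (KE3 _ _ (set_mem tD) (set_mem uD)).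
Qed.

Lemma qform_compression l (v : 'rV[R]_l) :
  qform (compression l) v = \sum_p lam p * inner01 (phi p) (basis_comb v) ^+ 2.
Proof.
rewrite qform_gram frob_rowE; apply: eq_bigr => p _.
have -> : (v *m (coef_factor l)^T) 0 p = Num.sqrt (lam p) * inner01 (phi p) (basis_comb v).
  rewrite inner01_sumr// mxE mulr_sumr; apply: eq_bigr => j _; rewrite !mxE; ring.
by rewrite mulrACA -!expr2 sqr_sqrtr// ltW.
Qed.

(** Pythagoras: [compression l] is the projection of [K] on the span of the
    tensors [e_j e_k] with indices below [l], and the squared norm of [K] is
    [\sum_p lam p ^+ 2]. The second summand is therefore the squared norm of
    the part of [K] outside that span. *)
Lemma sqnorm_kernel_sub l (A : 'M[R]_l) :
  sqnorm_square (fun t u => kernel_of e A t u - K t u) =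
  (frob (A - compression l) (A - compression l) +
   (\sum_p lam p ^+ 2 - frob (compression l) (compression l)))%:E.
Proof.
(* The difference of the kernels is a sum of tensors indexed by the disjoint
   union of the two families. *)
pose f (a : 'I_l + 'I_m) := match a with inl j => e j | inr p => phi p end.
pose g (a : 'I_l + 'I_m) := match a with
  | inl j => basis_comb (row j A) | inr p => fun u => (- lam p) * phi p u end.
rewrite (@sqnorm_square_tensor _ _ f g); last 3 first.
- by case=> [j|p]; [exact: eL|exact: phiL].
- by case=> [j|p]; [exact: in_L2_basis_comb|exact: in_L2Z].
- move=> t u tD uD; rewrite big_sumType /= kernel_ofE; congr (_ + _).
  case: KE => _ _ KE3; rewrite (KE3 _ _ (set_mem tD) (set_mem uD)) -sumrN; apply: eq_bigr => p _; ring.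
congr EFin; rewrite big_sumType /=.
under eq_bigr do rewrite big_sumType /=.
under [X in _ + X]eq_bigr do rewrite big_sumType /=.
rewrite !big_split /=.
have -> : \sum_(i < l) \sum_(j < l) inner01 (e i) (e j) *
    inner01 (basis_comb (row i A)) (basis_comb (row j A)) = frob A A.
  rewrite frobE; apply: eq_bigr => i _; under eq_bigr do rewrite eE.
  by rewrite sum_delta inner01_basis_comb frob_rowE; apply: eq_bigr => j _; rewrite !mxE.
have cross : \sum_(i < l) \sum_(p < m) inner01 (e i) (phi p) *
    inner01 (basis_comb (row i A)) (fun u => - lam p * phi p u) = - frob A (compression l).
  rewrite frobE -sumrN; apply: eq_bigr => i _.
  under [in RHS]eq_bigr do rewrite compressionE mulr_sumr.
  rewrite exchange_big /= -sumrN; apply: eq_bigr => p _.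
  rewrite (inner01C (basis_comb _)) inner01Zl//; last exact: in_L2_basis_comb.
  rewrite inner01_sumr// !mulr_sumr -sumrN inner01C; apply: eq_bigr => j _.
  rewrite !mxE; ring.
rewrite cross.
have -> : \sum_(p < m) \sum_(i < l) inner01 (phi p) (e i) *
    inner01 (fun u => - lam p * phi p u) (basis_comb (row i A)) = - frob A (compression l).
  rewrite exchange_big /= -cross; apply: eq_bigr => i _; apply: eq_bigr => p _.
  by rewrite inner01C; congr (_ * _); rewrite inner01C.
have -> : \sum_(p < m) \sum_(q < m) inner01 (phi p) (phi q) *
    inner01 (fun u => - lam p * phi p u) (fun u => - lam q * phi q u) =
    \sum_p lam p ^+ 2.
  apply: eq_bigr => p _; under eq_bigr do rewrite phiO.
  rewrite sum_delta inner01Zl//; last exact: in_L2Z.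
  rewrite inner01C inner01Zl// phiO eqxx mulr1n; ring.
rewrite !(frobDl, frobDr, frobNl, frobNr) (frobC (compression l) A); ring.
Qed.

Let G l p q := \sum_(j < l) inner01 (phi p) (e j) * inner01 (phi q) (e j).

Lemma frob_compression l : frob (compression l) (compression l) =
  \sum_p \sum_q lam p * lam q * G l p q ^+ 2.
Proof.
pose a p j k := inner01 (phi p) (e j) * inner01 (phi p) (e k).
transitivity (\sum_(j < l) \sum_(k < l) \sum_p \sum_q (lam p * lam q) * (a p j k * a q j k)).
  rewrite frobE; apply: eq_bigr => j _; apply: eq_bigr => k _.
  rewrite !compressionE mulr_suml; apply: eq_bigr => p _; rewrite mulr_sumr.
  by apply: eq_bigr => q _; rewrite /a; ring.
under eq_bigr => j _ do rewrite exchange_big /=.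
rewrite exchange_big /=; apply: eq_bigr => p _.
under eq_bigr => j _ do rewrite exchange_big /=.
rewrite exchange_big /=; apply: eq_bigr => q _.
under eq_bigr => j _ do rewrite -mulr_sumr.
rewrite -mulr_sumr; congr (_ * _); rewrite expr2 /G mulr_suml; apply: eq_bigr => j _.
by rewrite mulr_sumr; apply: eq_bigr => k _; rewrite /a; ring.
Qed.

Variable lmax : R.
Hypotheses (lmax0 : 0 <= lmax) (lamM : forall p, lam p <= lmax).

Lemma qform_compression_le l (v : 'rV[R]_l) :
  0 <= qform (compression l) v <= lmax * frob v v.
Proof.
rewrite qform_compression; apply/andP; split.
  by apply: sumr_ge0 => p _; rewrite mulr_ge0 ?sqr_ge0// ltW.
have := bessel_le phiL phiO (in_L2_basis_comb v); rewrite inner01_basis_comb => h.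
apply: le_trans (ler_wpM2l lmax0 h); rewrite mulr_sumr.
by apply: ler_sum => p _; rewrite inner01C ler_wpM2r ?sqr_ge0.
Qed.

(** The matrix has size [l] and operator norm at most [lmax]; the proof counts
    dimensions by applying Bessel's inequality twice. *)
Lemma frob_compression_le l : frob (compression l) (compression l) <= lmax ^+ 2 * l%:R.
Proof.
pose a p : 'rV[R]_l := \row_j inner01 (phi p) (e j).
have GE p q : G l p q = inner01 (basis_comb (a p)) (phi q).
  rewrite inner01_suml//; apply: eq_bigr => j _.
  by rewrite mxE (inner01C (e j)).
rewrite frob_compression.
apply: (@le_trans _ _ (\sum_p \sum_q lmax ^+ 2 * G l p q ^+ 2)).
  apply: ler_sum => p _; apply: ler_sum => q _; apply: ler_wpM2r; first exact: sqr_ge0.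
  by rewrite expr2 ler_pM// ltW.
under eq_bigr do rewrite -mulr_sumr.
rewrite -mulr_sumr ler_wpM2l ?sqr_ge0//.
apply: (@le_trans _ _ (\sum_p frob (a p) (a p))).
  apply: ler_sum => p _; rewrite -inner01_basis_comb.
  apply: le_trans (bessel_le phiL phiO (in_L2_basis_comb _)).
  by apply: ler_sum => q _; rewrite GE.
under eq_bigr do rewrite frob_rowE.
rewrite exchange_big /=.
apply: (@le_trans _ _ (\sum_(j < l) inner01 (e j) (e j))).
  apply: ler_sum => j _; apply: le_trans (bessel_le phiL phiO (eL j)).
  by apply: ler_sum => p _; rewrite !mxE -expr2 inner01C.
under eq_bigr do rewrite eE eqxx.
by rewrite sumr_const card_ord.
Qed.

(** Only the diagonal terms of [frob_compression] are kept: the projection of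
    [phi p] has squared norm [G l p p] at least [1 - b], hence [1 - G l p p ^+
    2 <= 2 * b]. *)
Lemma compression_bias l b :
  (forall p, 1 - \sum_(j < l) inner01 (phi p) (e j) ^+ 2 <= b) -> 0 <= b ->
  \sum_p lam p ^+ 2 - frob (compression l) (compression l) <= m%:R * (2 * lmax ^+ 2 * b).
Proof.
move=> hb b0.
have h1 : \sum_p lam p ^+ 2 * G l p p ^+ 2 <= frob (compression l) (compression l).
  rewrite frob_compression; apply: ler_sum => p _.
  rewrite (bigD1 p) //= expr2 lerDl; apply: sumr_ge0 => q _.
  by rewrite mulr_ge0 ?sqr_ge0// mulr_ge0// ltW.
apply: (@le_trans _ _ (\sum_p (lam p ^+ 2 - lam p ^+ 2 * G l p p ^+ 2))).
  by rewrite sumrB lerB.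
rewrite mulr_natl -[X in _ *+ X]card_ord -sumr_const; apply: ler_sum => p _.
have Gpp : G l p p = \sum_(j < l) inner01 (phi p) (e j) ^+ 2.
  by apply: eq_bigr => j _; rewrite expr2.
have G1 : G l p p <= 1.
  have := @bessel_le _ (fun j : 'I_l => e j) (phi p) (fun j => eL j) (@eE l) (phiL p).
  by rewrite phiO eqxx Gpp.
have G0 : 0 <= G l p p by rewrite Gpp; apply: sumr_ge0 => j _; exact: sqr_ge0.
have := hb p; rewrite -Gpp => hg.
have l0 : 0 <= lam p := ltW (lam0 p).
have l2 : lam p ^+ 2 <= lmax ^+ 2 by rewrite lerXn2r ?nnegrE.
have l20 := sqr_ge0 (lam p).
have : 1 - G l p p ^+ 2 <= 2 * b by nra.
move=> h3; have h4 : 0 <= 1 - G l p p ^+ 2 by nra.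
nra.
Qed.

End one_kernel.

(** Beyond index [l] the Sobolev weights are at least [l `^ (2 * s)], and the
    sum of the squared coefficients of [f] is [1] because [e] is a basis. *)
Lemma sobolev_tail (f : R -> R) (s c : R) l :
  orthonormal_basis01 e -> 0 <= s -> 0 <= c -> (0 < l)%N -> in_L2 f -> inner01 f f = 1 ->
  (sobolev_norm e s f <= c%:E)%E ->
  1 - \sum_(j < l) inner01 f (e j) ^+ 2 <= c ^+ 2 * l%:R `^ (- (2 * s)).
Proof.
move=> [_ eB] s0 c0 l0 fL f1 hc.
set w := fun k : nat => k.+1%:R `^ (2 * s) * inner01 f (e k) ^+ 2.
have w0 k : 0 <= w k by rewrite mulr_ge0 ?powR_ge0 ?sqr_ge0.
have hs (N : nat) : \sum_(0 <= k < N) w k <= c ^+ 2.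
  have h1 : (\sum_(0 <= k <oo) (w k)%:E <= (c ^+ 2)%:E)%E.
    have S0 : (0 <= \sum_(0 <= k <oo) (w k)%:E)%E.
      by apply: nneseries_ge0 => k _ _; rewrite lee_fin.
    move: hc; rewrite /sobolev_norm -/w; move: S0.
    case: (\sum_(0 <= k <oo) _)%E => [x| |]//.
    - move=> x0; rewrite /= !lee_fin; rewrite lee_fin in x0; rewrite powR12_sqrt// => hx.
      by rewrite -(sqr_sqrtr x0) lerXn2r ?nnegrE ?sqrtr_ge0.
    - by rewrite poweRyr// invr_neq0.
  rewrite -lee_fin; apply: le_trans h1; rewrite -sumEFin.
  by apply: nneseries_lim_ge => k _ _; rewrite lee_fin.
have lp : 0 < l%:R :> R by rewrite ltr0n.
have tail N : (l <= N)%N ->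
    \sum_(k < N) inner01 f (e k) ^+ 2 - \sum_(j < l) inner01 f (e j) ^+ 2 <=
    c ^+ 2 * l%:R `^ (- (2 * s)).
  move=> lN; rewrite powRN ler_pdivlMr ?powR_gt0//.
  rewrite -!(big_mkord xpredT (fun k => inner01 f (e k) ^+ 2)).
  rewrite (big_cat_nat (n := l))//= addrAC subrr add0r mulr_suml.
  apply: le_trans (hs N); rewrite [leRHS](big_cat_nat (n := l))//= -[leLHS]add0r lerD//.
    by apply: sumr_ge0 => k _.
  rewrite [leLHS]big_nat_cond [leRHS]big_nat_cond; apply: ler_sum => k /andP[/andP[lk _] _].
  rewrite mulrC ler_wpM2r ?sqr_ge0//; apply: ge0_ler_powR; rewrite ?nnegrE ?mulr_ge0//.
  by rewrite ler_nat ltnW.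
have cv := eB f fL.
apply/ler_addgt0Pr => eps eps0.
have /fine_cvgP[] := cv.
move=> _ /cvgrPdist_lt/(_ _ eps0)[N _ hN].
pose N' := maxn N l.
have := hN N' (leq_maxl _ _).
rewrite /= sub0r normrN sqnorm01E; last first.
  apply: in_L2B => //; exact: in_L2_lin.
rewrite /= (@bessel _ (fun k : 'I_N' => e k))// f1.
move=> /ltr_normlW h; have := tail N' (leq_maxr _ _); lra.
Qed.

End basis.
End Kernels.

(** * Expectation of a product of independent variables *)

Section Transfer.
Context {R : realType} {d d' : measure_display}.
Context {T : measurableType d} {T' : measurableType d'}.
Variables (P : {measure set T -> \bar R}) (P' : {measure set T' -> \bar R}).

Import HBNNSimple.

(** The hypothesis says that the image under [f] of the measure of density [g]
    is [c] times the image under [f'] of the other measure; the conclusion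
    integrates the identity function against both, by approximation with
    simple functions. It serves both for independence and for integrals
    against the density of a law. *)
Lemma integral_mul_transfer (f g : T -> R) (f' : T' -> R) (c : R) :
  measurable_fun setT f -> measurable_fun setT g -> measurable_fun setT f' ->
  (forall w, 0 <= f w) -> (forall w, 0 <= g w) -> (forall w, 0 <= f' w) -> 0 <= c ->
  (forall B : set R, measurable B ->
     (\int[P]_w (\1_(f @^-1` B) w * g w)%:E = c%:E * P' (f' @^-1` B))%E) ->
  (\int[P]_w (f w * g w)%:E = c%:E * \int[P']_w (f' w)%:E)%E.
Proof.
move=> mf mg mf' f0 g0 f'0 c0 hB.
pose phi (x : R) : \bar R := (Num.max x 0)%:E.
have mphi : measurable_fun setT phi.
  by apply/measurable_EFinP; apply: measurable_maxr.
have phi0 x : setT x -> (0 <= phi x)%E by rewrite /phi lee_fin le_max lexx orbT.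
(* The same simple functions [h k] of the real variable approximate both [f]
   and [f']. *)
pose h := nnsfun_approx measurableT mphi.
have hcv' w : (h k (f' w))%:E @[k --> \oo] --> (f' w)%:E.
  have := @cvg_nnsfun_approx _ _ _ _ measurableT _ mphi phi0 (f' w) I.
  by rewrite /phi max_l.
have hcv w : (h k (f w))%:E @[k --> \oo] --> (f w)%:E.
  have := @cvg_nnsfun_approx _ _ _ _ measurableT _ mphi phi0 (f w) I.
  by rewrite /phi max_l.
have hnd w : {homo (fun k => h k (f w)) : m n / (m <= n)%N >-> m <= n}.
  by move=> m n mn; exact/lefP/nd_nnsfun_approx.
have hnd' w : {homo (fun k => h k (f' w)) : m n / (m <= n)%N >-> m <= n}.
  by move=> m n mn; exact/lefP/nd_nnsfun_approx.
have mh' k : measurable_fun setT (fun w => h k (f' w)) by exact: measurableT_comp.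
have mpre' k r : measurable (f' @^-1` (h k @^-1` [set r])).
  by rewrite -[X in measurable X]setTI; exact: mf'.
have mh k : measurable_fun setT (fun w => h k (f w)) by exact: measurableT_comp.
have mpre k r : measurable (f @^-1` (h k @^-1` [set r])).
  by rewrite -[X in measurable X]setTI; exact: mf.
have step k : (\int[P]_w (h k (f w) * g w)%:E = c%:E * \int[P']_w (h k (f' w))%:E)%E.
  pose s : seq R := finmap.enum_fset (fset_set (range (h k))).
  pose u r w := r * \1_(f @^-1` (h k @^-1` [set r])) w.
  have hE w : h k (f w) = \sum_(r <- s) u r w.
    by rewrite fimfunE fsbig_finite//=; exact: fimfunP.
  pose u' r w := r * \1_(f' @^-1` (h k @^-1` [set r])) w.
  have hE' w : h k (f' w) = \sum_(r <- s) u' r w.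
    by rewrite fimfunE fsbig_finite//=; exact: fimfunP.
  have u'0 r w : 0 <= u' r w.
    have [r0|r0] := leP 0 r; first by rewrite mulr_ge0.
    by rewrite /u' preimage_nnfun0// preimage_set0 indic0 mulr0.
  have mu_' r : measurable_fun setT (u' r).
    by apply: measurable_funM => //; exact: measurable_indic.
  have u0 r w : 0 <= u r w.
    have [r0|r0] := leP 0 r; first by rewrite mulr_ge0.
    by rewrite /u preimage_nnfun0// preimage_set0 indic0 mulr0.
  have mu_ r : measurable_fun setT (u r).
    by apply: measurable_funM => //; exact: measurable_indic.
  transitivity (\sum_(r <- s) \int[P]_w (u r w * g w)%:E)%E.
    rewrite -ge0_integral_sum//.
    - by apply: eq_integral => w _; rewrite hE mulr_suml sumEFin.
    - by move=> r; apply/measurable_EFinP; exact: measurable_funM.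
    - by move=> r w _; rewrite lee_fin mulr_ge0.
  transitivity (\sum_(r <- s) c%:E * \int[P']_w (u' r w)%:E)%E.
    apply: eq_bigr => r _; have [r0|r0] := leP 0 r; last first.
      have uz w : u r w = 0 by rewrite /u preimage_nnfun0// preimage_set0 indic0 mulr0.
      under eq_integral do rewrite uz mul0r.
      have uz' w : u' r w = 0 by rewrite /u' preimage_nnfun0// preimage_set0 indic0 mulr0.
      by under [in RHS]eq_integral do rewrite uz'; rewrite !integral0 mule0.
    under eq_integral do rewrite /u -mulrA EFinM.
    rewrite ge0_integralZl//; last 2 first.
    - apply/measurable_EFinP; apply: measurable_funM => //; exact: measurable_indic.
    - by move=> w _; rewrite lee_fin mulr_ge0.
    rewrite hB//.
    under [in RHS]eq_integral do rewrite /u' EFinM.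
    rewrite ge0_integralZl//; last by apply/measurable_EFinP; exact: measurable_indic.
    by rewrite integral_indic// setIT muleCA.
  rewrite -ge0_sume_distrr; last first.
    by move=> r _; apply: integral_ge0 => w _; rewrite lee_fin.
  rewrite -ge0_integral_sum//.
  - by congr (_ * _)%E; apply: eq_integral => w _; rewrite hE' sumEFin.
  - by move=> r; apply/measurable_EFinP.
  - by move=> r w _; rewrite lee_fin.
have lim1 : (\int[P]_w (h k (f w) * g w)%:E)%E @[k --> \oo] --> (\int[P]_w (f w * g w)%:E)%E.
  have := @cvg_monotone_convergence _ _ _ P _ measurableT (fun k w => (h k (f w) * g w)%:E).
  move=> /(_ _ _ _)/cvg_trans; apply.
  - by move=> k; apply/measurable_EFinP; exact: measurable_funM.
  - by move=> k w _; rewrite lee_fin mulr_ge0.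
  - by move=> w _ m n mn; rewrite lee_fin ler_wpM2r// hnd.
  rewrite (_ : (fun x => _) = (fun w => (f w * g w)%:E))//.
  apply/funext => w; apply/cvg_lim => //.
  under eq_fun do rewrite EFinM; rewrite EFinM.
  by apply: cvgeZr => //; exact: hcv.
have lim2 : (\int[P']_w (h k (f' w))%:E)%E @[k --> \oo] --> (\int[P']_w (f' w)%:E)%E.
  have := @cvg_monotone_convergence _ _ _ P' _ measurableT (fun k w => (h k (f' w))%:E).
  move=> /(_ _ _ _)/cvg_trans; apply.
  - by move=> k; apply/measurable_EFinP.
  - by move=> k w _; rewrite lee_fin.
  - by move=> w _ m n mn; rewrite lee_fin hnd'.
  rewrite (_ : (fun x => _) = (fun w => (f' w)%:E))//.
  by apply/funext => w; apply/cvg_lim => //; exact: hcv'.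
have lim3 := cvgeZl (erefl _ : c%:E \is a fin_num) lim2.
have := lim1; under eq_fun do rewrite step.
by move=> /(cvg_unique (@ereal_hausdorff R)); exact.
Qed.

End Transfer.

Section Independence.
Context {R : realType} {d : measure_display} {T : measurableType d}.
Variable P : probability T R.

Lemma integral_mul_factor (f g : T -> R) (c : R) :
  measurable_fun setT f -> measurable_fun setT g ->
  (forall w, 0 <= f w) -> (forall w, 0 <= g w) -> 0 <= c ->
  (forall B : set R, measurable B ->
     (\int[P]_w (\1_(f @^-1` B) w * g w)%:E = c%:E * P (f @^-1` B))%E) ->
  (\int[P]_w (f w * g w)%:E = c%:E * \int[P]_w (f w)%:E)%E.
Proof. by move=> mf mg f0 g0 c0; exact: integral_mul_transfer. Qed.

(** Measurability with respect to a family of sets that need not be given as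
    the sigma-algebra of a type. *)
Definition sub_measurable (F : set (set T)) (f : T -> R) :=
  forall B : set R, measurable B -> F (f @^-1` B).

Lemma sub_measurable_fun F f : (forall A, F A -> measurable A) ->
  sub_measurable F f -> measurable_fun setT f.
Proof. by move=> hF hf _ B mB; rewrite setTI; apply: hF; exact: hf. Qed.

(** The functions are replaced by indicators one at a time, each replacement
    being an application of the transfer lemma. *)
Lemma independent2_integralM (F G : set (set T)) (f g : T -> R) :
  (forall A, F A -> measurable A) -> (forall A, G A -> measurable A) ->
  independent2 P F G -> sub_measurable F f -> sub_measurable G g ->
  (forall w, 0 <= f w) -> (forall w, 0 <= g w) ->
  (\int[P]_w (g w)%:E < +oo)%E ->
  (\int[P]_w (f w * g w)%:E = \int[P]_w (f w)%:E * \int[P]_w (g w)%:E)%E.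
Proof.
move=> hF hG FG Ff Gg f0 g0 gfin.
have mf := sub_measurable_fun hF Ff; have mg := sub_measurable_fun hG Gg.
have gge0 : (0 <= \int[P]_w (g w)%:E)%E by apply: integral_ge0 => w _; rewrite lee_fin.
have gE : (\int[P]_w (g w)%:E)%E = (fine (\int[P]_w (g w)%:E)%E)%:E.
  by rewrite fineK// ge0_fin_numE.
have Pfin A : measurable A -> P A = (fine (P A))%:E.
  by move=> mA; rewrite fineK// fin_num_measure.
rewrite muleC gE; apply: integral_mul_factor => //; first exact: fine_ge0.
move=> B mB; set A := f @^-1` B; have FA : F A by exact: Ff.
have mA := hF _ FA.
under eq_integral do rewrite mulrC.
rewrite Pfin// (integral_mul_factor (c := fine (P A)))//.
- by rewrite -gE muleC.
- exact: fine_ge0.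
move=> C mC; rewrite -Pfin//.
rewrite (eq_integral (fun w => (\1_(g @^-1` C `&` A) w)%:E)); last by move=> w _; rewrite indicI.
have mI : measurable (g @^-1` C `&` A) by apply: measurableI => //; exact/hG/Gg.
rewrite integral_indic// setIT.
by rewrite setIC; apply: FG => //; exact: Gg.
Qed.

(** The statement mixes functions and indicators so that the functions can be
    introduced one at a time by induction on [s1]. *)
Lemma mutually_independent_integral_prod (I : eqType) (F : I -> set (set T))
    (f : I -> T -> R) (s1 s2 : seq I) (A : I -> set T) :
  (forall i B, F i B -> measurable B) -> mutually_independent P F ->
  (forall i, sub_measurable (F i) (f i)) -> (forall i w, 0 <= f i w) ->
  (forall i, (\int[P]_w (f i w)%:E < +oo)%E) ->
  uniq (s1 ++ s2) -> (forall i, i \in s2 -> F i (A i)) ->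
  (\int[P]_w (\1_(\bigcap_(i in [set` s2]) A i) w * \prod_(i <- s1) f i w)%:E =
   \prod_(i <- s1) \int[P]_w (f i w)%:E * \prod_(i <- s2) P (A i))%E.
Proof.
move=> hF ind Ff f0 ffin.
have mf i : measurable_fun setT (f i) by exact: (sub_measurable_fun (hF i) (Ff i)).
have p0 i : (0 <= \int[P]_w (f i w)%:E)%E by apply: integral_ge0 => w _; rewrite lee_fin.
have pE i : (\int[P]_w (f i w)%:E)%E = (fine (\int[P]_w (f i w)%:E)%E)%:E.
  by rewrite fineK// ge0_fin_numE.
elim: s1 s2 A => [|i s1 IH] s2 A /=.
  move=> us hA; under eq_integral do rewrite big_nil mulr1.
  have mC : measurable (\bigcap_(j in [set` s2]) A j).
    by apply: fin_bigcap_measurable => // j js; apply: hF (hA j js).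
  by rewrite integral_indic// setIT big_nil mul1e; apply: ind.
move=> /andP[inot us] hA.
have us' : uniq (s1 ++ i :: s2) by rewrite -cat1s uniq_catCA /= inot.
set C := \bigcap_(j in [set` s2]) A j.
have mC : measurable C.
  by apply: fin_bigcap_measurable => // j js; apply: hF (hA j js).
set c1 := (\prod_(j <- s1) \int[P]_w (f j w)%:E)%E; set c2 := (\prod_(j <- s2) P (A j))%E.
have cE : (c1 * c2 = (fine (c1 * c2))%:E)%E.
  rewrite fineK// fin_numM// /c1 /c2.
    by apply: prode_fin_num => j _; rewrite pE.
  rewrite big_seq; apply: prode_fin_num => j js; apply: fin_num_measure; exact: hF (hA j js).
have c0 : 0 <= fine (c1 * c2)%E.
  by apply/fine_ge0/mule_ge0; apply: prode_ge0.
under eq_integral do rewrite big_cons mulrCA.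
rewrite (integral_mul_factor (c := fine (c1 * c2)%E))//; last 3 first.
- apply: measurable_funM; [exact: measurable_indic|exact: measurable_prod].
- by move=> w; rewrite mulr_ge0// prodr_ge0.
- move=> B mB; rewrite -cE.
  pose A' j := if j == i then f i @^-1` B else A j.
  have A'i : A' i = f i @^-1` B by rewrite /A' eqxx.
  have inots2 : i \notin s2 by move: inot; rewrite mem_cat negb_or => /andP[].
  have A'E j : j \in s2 -> A' j = A j.
    by rewrite /A'; case: eqP => // -> h; rewrite h in inots2.
  have hA' j : j \in i :: s2 -> F j (A' j).
    by rewrite inE => /predU1P[->|js]; [rewrite A'i; exact: Ff|rewrite A'E//; exact: hA].
  have := IH (i :: s2) A' us' hA'; rewrite big_cons A'i.
  have -> : (\prod_(j <- s2) P (A' j) = c2)%E by apply: eq_big_seq => j js; rewrite A'E.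
  rewrite -/c1 muleCA [RHS]muleC => <-.
  apply: eq_integral => w _; rewrite mulrA; congr ((_ * _)%:E).
  rewrite -[LHS]/((\1_(f i @^-1` B) \* \1_C) w) -indicI; congr (\1_ _ w).
  apply/seteqP; split => [x [Bx Cx] j /=|x hx].
    by rewrite inE => /predU1P[->|js]; rewrite ?A'i// A'E//; exact: Cx.
  split; first by have := hx i (mem_head _ _); rewrite A'i.
  move=> j /= js; rewrite -A'E//; apply: hx => /=.
  by rewrite inE js orbT.
by rewrite -cE big_cons -/c1 muleC muleA.
Qed.

Lemma mutually_independent_expectation (I : eqType) (F : I -> set (set T))
    (f : I -> T -> R) (s : seq I) :
  (forall i B, F i B -> measurable B) -> mutually_independent P F ->
  (forall i, sub_measurable (F i) (f i)) -> (forall i w, 0 <= f i w) ->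
  (forall i, (\int[P]_w (f i w)%:E < +oo)%E) -> uniq s ->
  (\int[P]_w (\prod_(i <- s) f i w)%:E = \prod_(i <- s) \int[P]_w (f i w)%:E)%E.
Proof.
move=> hF ind Ff f0 ffin us.
have := @mutually_independent_integral_prod _ F f s [::] (fun=> setT) hF ind Ff f0 ffin.
rewrite cats0 => /(_ us); rewrite big_nil mule1 => <-//.
apply: eq_integral => w _; rewrite set_nil bigcap_set0 indicT mul1r//.
Qed.

End Independence.

(** * Gaussian exponential moments *)

Section Gauss.
Context {R : realType}.
Local Notation mu := (@lebesgue_measure R).

(** Completing the square turns the integrand into a multiple of a shifted
    normal density. *)
Lemma integral_expR_normal_pdf (s t : R) : s != 0 ->
  (\int[mu]_x (expR (t * x) * normal_pdf 0 s x)%:E = (expR (t ^+ 2 * s ^+ 2 / 2))%:E)%E.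
Proof.
move=> s0.
have e x : expR (t * x) * normal_pdf 0 s x =
    expR (t ^+ 2 * s ^+ 2 / 2) * normal_pdf (t * s ^+ 2) s x.
  rewrite !normal_pdfE// mulrCA [RHS]mulrCA; congr (_ * _).
  rewrite /normal_fun -!expRD; congr expR; rewrite -mulr_natr; field; exact: s0.
under eq_integral do rewrite e EFinM.
rewrite ge0_integralZl//.
- by rewrite integral_normal_pdf mule1.
- by apply/measurable_EFinP; exact: measurable_normal_pdf.
- by move=> x _; rewrite lee_fin normal_pdf_ge0.
Qed.

(** The integrand is a multiple of the centred normal density of variance [1 /
    (1 - 2 * a)]. *)
Lemma integral_expR_sqr_normal_pdf (a : R) : 2 * a < 1 ->
  (\int[mu]_x (expR (a * x ^+ 2) * normal_pdf 0 1 x)%:E = ((Num.sqrt (1 - 2 * a))^-1)%:E)%E.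
Proof.
move=> a1; set q := Num.sqrt (1 - 2 * a).
have q0 : 0 < q by rewrite sqrtr_gt0 subr_gt0.
have q2 : q ^+ 2 = 1 - 2 * a by rewrite sqr_sqrtr// subr_ge0 ltW.
have s0 : q^-1 != 0 by rewrite invr_neq0// gt_eqF.
have e x : expR (a * x ^+ 2) * normal_pdf 0 1 x = q^-1 * normal_pdf 0 q^-1 x.
  rewrite !normal_pdfE ?oner_neq0// mulrCA [RHS]mulrA /normal_peak.
  rewrite -[in RHS](mulrnAr (q^-1 ^+ 2)) sqrtrM ?sqr_ge0// sqrtr_sqr ger0_norm ?invr_ge0 ?ltW//.
  have -> : q^-1 / (q^-1 * Num.sqrt (pi *+ 2)) = (Num.sqrt (pi *+ 2))^-1.
    by rewrite invfM invrK mulrA mulVf ?mul1r// gt_eqF.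
  rewrite expr1n mul1r; congr (_ * _).
  rewrite /normal_fun -!expRD; congr expR; rewrite exprVn q2 !mulr2n subr0.
  by field; rewrite subr_eq0 eq_sym lt_eqF.
under eq_integral do rewrite e EFinM.
rewrite ge0_integralZl//.
- by rewrite integral_normal_pdf mule1.
- by apply/measurable_EFinP; exact: measurable_normal_pdf.
- by move=> x _; rewrite lee_fin normal_pdf_ge0.
- by rewrite lee_fin invr_ge0 ltW.
Qed.

Section law.
Context {d : measure_display} {T : measurableType d}.
Variable P : probability T R.

Lemma normal_law_expR (X : T -> R) (s t : R) : measurable_fun setT X -> s != 0 ->
  has_normal_law P X 0 s ->
  (\int[P]_w (expR (t * X w))%:E = (expR (t ^+ 2 * s ^+ 2 / 2))%:E)%E.
Proof.
move=> mX s0 hX; rewrite -integral_expR_normal_pdf//.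
have mE : measurable_fun setT (fun x : R => expR (t * x)).
  by apply: measurableT_comp => //; exact: measurable_funM.
rewrite -[LHS]mul1e; apply/esym; apply: integral_mul_transfer => //.
- exact: measurable_normal_pdf.
- exact: (measurableT_comp mE).
- by move=> x; exact: normal_pdf_ge0.
move=> B mB; rewrite mul1e /=.
pose C := (fun x : R => expR (t * x)) @^-1` B.
have mC : measurable C by rewrite -[C]setTI; exact: mE.
transitivity (normal_prob 0 s C); last exact/esym/hX.
rewrite /normal_prob [RHS]integral_mkcond; apply: eq_integral => x _.
by rewrite patchE indicE; case: (x \in C); rewrite ?mul1r ?mul0r.
Qed.

(** For [a >= 0], [expR (a * z ^+ 2)] is the Laplace transform of a standard
    normal variable at [sqrt (2 * a) * z]. After exchanging the integrals the
    inner one is the Laplace transform of [Z], which the hypothesis provides.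
    *)
Lemma integral_expR_sqr (Z : T -> R) (v a : R) : measurable_fun setT Z ->
  (forall t, (\int[P]_w (expR (t * Z w))%:E = (expR (t ^+ 2 * v / 2))%:E)%E) ->
  0 <= a -> 2 * (a * v) < 1 ->
  (\int[P]_w (expR (a * Z w ^+ 2))%:E = ((Num.sqrt (1 - 2 * (a * v)))^-1)%:E)%E.
Proof.
move=> mZ hZ a0 av; rewrite -integral_expR_sqr_normal_pdf//.
pose q := Num.sqrt (2 * a).
have q2 : q ^+ 2 = 2 * a by rewrite sqr_sqrtr// mulr_ge0.
pose F (z : T * R) : \bar R := (expR (q * z.2 * Z z.1) * normal_pdf 0 1 z.2)%:E.
have mF : measurable_fun setT F.
  apply/measurable_EFinP; apply: measurable_funM.
    apply: measurableT_comp => //; apply: measurable_funM.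
      by apply: measurable_funM => //; exact: measurable_snd.
    by apply: measurableT_comp => //; exact: measurable_fst.
  by apply: measurableT_comp; [exact: measurable_normal_pdf|exact: measurable_snd].
have F0 z : (0 <= F z)%E by rewrite lee_fin mulr_ge0 ?expR_ge0 ?normal_pdf_ge0.
have := @fubini_tonelli _ _ _ _ _ P mu F mF F0; rewrite /fubini_F /fubini_G /F /= => fub.
transitivity (\int[P]_x \int[mu]_y (expR (q * y * Z x) * normal_pdf 0 1 y)%:E)%E.
  apply: eq_integral => w _.
  under [RHS]eq_integral do rewrite -mulrA (mulrC _ (Z w)) mulrA.
  rewrite integral_expR_normal_pdf; last exact: oner_neq0.
  congr (expR _)%:E.
  by rewrite exprMn q2; field.
apply: etrans fub _; apply: eq_integral => x _.
under eq_integral do rewrite mulrC EFinM.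
rewrite ge0_integralZl//.
- rewrite hZ -EFinM mulrC; congr (expR _ * _)%:E; rewrite exprMn q2; by field.
- apply/measurable_EFinP; apply: measurableT_comp => //; exact: measurable_funM.
- by rewrite lee_fin normal_pdf_ge0.
Qed.

Lemma integral_expR_le (f g : T -> R) : measurable_fun setT f -> measurable_fun setT g ->
  (forall w, 0 <= f w <= g w) -> (\int[P]_w (f w)%:E <= \int[P]_w (g w)%:E)%E.
Proof.
move=> mf mg fg; apply: ge0_le_integral => //.
- by move=> w _; rewrite lee_fin; case/andP: (fg w).
- exact/measurable_EFinP.
- exact/measurable_EFinP.
- by move=> w _; rewrite lee_fin; case/andP: (fg w).
Qed.

(** For [u >= 0] the moment of the square is explicit. For [u < 0], with [a =
    - u], linearization does not apply directly, and the elementary inequality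
    [expR (- X) + expR X <= 2 + X ^+ 2 * expR X] bounds the negative
    exponential by moments with positive parameter: the exact term [expR (a *
    Z ^+ 2)], whose expectation is at least [1 + a * v], and a remainder of
    second order. *)
Lemma quad_expR_bound (Z : T -> R) (v u : R) : measurable_fun setT Z -> 0 <= v ->
  (forall t, (\int[P]_w (expR (t * Z w))%:E = (expR (t ^+ 2 * v / 2))%:E)%E) ->
  8 * (`|u| * v) <= 1 ->
  (\int[P]_w (expR (u * (Z w ^+ 2 - v)))%:E <= (expR (182 * (u * v) ^+ 2))%:E)%E.
Proof.
move=> mZ v0 hZ huv.
have mE a : measurable_fun setT (fun w => expR (a * Z w ^+ 2)).
  by apply: measurableT_comp => //; apply: measurable_funM => //; exact: measurable_funX.
have E0 : (\int[P]_w (expR (u * (Z w ^+ 2 - v)))%:E =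
    (expR (- (u * v)))%:E * \int[P]_w (expR (u * Z w ^+ 2))%:E)%E.
  under eq_integral do rewrite mulrBr addrC expRD EFinM.
  rewrite ge0_integralZl//; exact/measurable_EFinP.
rewrite E0 {E0}.
have inv_sqrt (x : R) : 8 * x <= 2 -> [/\ 0 < Num.sqrt (1 - 2 * x),
    0 < 1 - 2 * x & (Num.sqrt (1 - 2 * x))^-1 ^+ 2 = (1 - 2 * x)^-1].
  move=> x8; have h0 : 0 < 1 - 2 * x by lra.
  by rewrite sqrtr_gt0; split => //; rewrite exprVn sqr_sqrtr// ltW.
have sqr_le (p q : R) : 0 <= p -> 0 <= q -> p ^+ 2 <= q ^+ 2 -> p <= q.
  by move=> p0 q0; rewrite ler_pXn2r.
have sqrt_le (x : R) : 0 <= x -> 8 * x <= 1 -> (Num.sqrt (1 - 2 * x))^-1 <= expR (x + 4 * x ^+ 2).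
  move=> x0 x8; have x8' : 8 * x <= 2 by lra.
  have [s0 h0 s2] := inv_sqrt x x8'.
  apply: sqr_le; rewrite ?invr_ge0 ?expR_ge0 ?(ltW s0)// s2.
  rewrite -expRM_natl; apply: le_trans (expR_ge1Dx _).
  by rewrite -(ler_pM2l h0) divff ?gt_eqF//; nra.
have sqrt_ge (x : R) : 0 <= x -> 8 * x <= 1 -> 1 + x <= (Num.sqrt (1 - 2 * x))^-1.
  move=> x0 x8; have x8' : 8 * x <= 2 by lra.
  have [s0 h0 s2] := inv_sqrt x x8'.
  apply: sqr_le; rewrite ?invr_ge0 ?addr_ge0 ?(ltW s0)// s2.
  rewrite -(ler_pM2l h0) divff ?gt_eqF//; nra.
have sqrt_le2 (x : R) : 8 * x <= 2 -> (Num.sqrt (1 - 2 * x))^-1 <= 142 / 100.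
  move=> x8; have [s0 h0 s2] := inv_sqrt x x8.
  apply: sqr_le; rewrite ?invr_ge0 ?(ltW s0)// s2.
  by rewrite -(ler_pM2l h0) divff ?gt_eqF//; nra.
have [u0|u0] := leP 0 u.
  have x8 : 8 * (u * v) <= 1 by rewrite -[u]ger0_norm.
  have x0 : 0 <= u * v by rewrite mulr_ge0.
  rewrite (integral_expR_sqr mZ hZ)//; last by lra.
  rewrite -EFinM lee_fin; apply: le_trans (ler_wpM2l (expR_ge0 _) (sqrt_le _ x0 x8)) _.
  rewrite -expRD ler_expR addKr; have := sqr_ge0 (u * v); lra.
pose a := - u; have a0 : 0 < a by rewrite oppr_gt0.
pose x := a * v.
have x8 : 8 * x <= 1 by rewrite /x /a -ltr0_norm.
have x0 : 0 <= x by rewrite mulr_ge0// ltW.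
have uvE : u * v = - x by rewrite /x /a mulNr opprK.
have uE : u = - a by rewrite /a opprK.
have key : (\int[P]_w (expR (u * Z w ^+ 2))%:E <= (1 - x + 182 * x ^+ 2)%:E)%E.
  have [v00|vn0] := eqVneq v 0.
    rewrite /x v00 mulr0 expr0n /= mulr0 subr0 addr0.
    apply: (@le_trans _ _ (\int[P]_w (expR (0 * Z w))%:E)%E).
      apply: integral_expR_le => //.
        by apply: measurableT_comp => //; exact: measurable_funM.
      move=> w; rewrite expR_ge0 ler_expR mul0r.
      by rewrite mulr_le0_ge0 ?sqr_ge0// ltW.
    by rewrite hZ expr0n /= !mul0r expR0.
  have vp : 0 < v by rewrite lt_def vn0.
  (* The extra exponent [b] absorbs the polynomial factor [z ^+ 2]; this value
     keeps [2 * ((a + b) * v)] at most one half. *)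
  pose b := (8 * v)^-1; have b0 : 0 < b by rewrite invr_gt0 mulr_gt0.
  have bv : b * v = 8^-1 by rewrite /b invfM -mulrA mulVf ?mulr1.
  have pw w : expR (u * Z w ^+ 2) + expR (a * Z w ^+ 2) <=
      2 + 128 * x ^+ 2 * expR ((a + b) * Z w ^+ 2).
    set z := Z w ^+ 2; have z0 : 0 <= z by exact: sqr_ge0.
    rewrite uE mulNr; set X := a * z; have X0 : 0 <= X by rewrite mulr_ge0// ltW.
    have e1 : expR (- X) + expR X <= 2 + X ^+ 2 * expR X.
      have h1 : 1 - X <= expR (- X) by exact: expR_ge1Dx.
      have h2 : expR X * expR (- X) = 1 by exact: expRxMexpNx_1.
      have h3 : 1 <= expR X by rewrite -[leLHS]expR0 ler_expR.
      have h4 : expR X - 1 <= X * expR X by nra.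
      have h5 : (expR X - 1) ^+ 2 <= (X * expR X) ^+ 2.
        by rewrite lerXn2r ?nnegrE ?subr_ge0// mulr_ge0// expR_ge0.
      have h6 := ler_wpM2r (expR_ge0 (- X)) h5.
      have h7 : (expR X - 1) ^+ 2 * expR (- X) = expR X - 2 + expR (- X).
        transitivity ((expR X * expR (- X)) * expR X - 2 * (expR X * expR (- X)) + expR (- X)); first by ring.
        by rewrite h2; ring.
      have h8 : (X * expR X) ^+ 2 * expR (- X) = X ^+ 2 * expR X.
        transitivity (X ^+ 2 * expR X * (expR X * expR (- X))); first by ring.
        by rewrite h2 mulr1.
      lra.
    apply: le_trans e1 _; rewrite lerD2l (mulrDl a b z) expRD -/X.
    rewrite mulrCA [leLHS]mulrC ler_wpM2l ?expR_ge0//.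
    have h : (b * z) ^+ 2 <= 2 * expR (b * z).
      have bz0 : 0 <= b * z by rewrite mulr_ge0// ltW.
      have := expR_ge1Dxn 1 bz0; rewrite (_ : 2`! = 2)%N// => h; lra.
    have -> : X ^+ 2 = (8 * x) ^+ 2 * (b * z) ^+ 2.
      rewrite -exprMn; congr (_ ^+ 2); rewrite /X /x.
      by rewrite -[LHS]mulr1 -[in LHS](mulVf (_ : 8 != 0 :> R))// -bv; ring.
    have := ler_wpM2l (sqr_ge0 (8 * x)) h; lra.
  have mu_ := mE u; have ma := mE a; have mab := mE (a + b).
  have := @integral_expR_le (fun w => expR (u * Z w ^+ 2) + expR (a * Z w ^+ 2))
    (fun w => 2 + 128 * x ^+ 2 * expR ((a + b) * Z w ^+ 2)).
  move=> /(_ (measurable_funD mu_ ma)) h.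
  have {h}: (\int[P]_w (expR (u * Z w ^+ 2) + expR (a * Z w ^+ 2))%:E <=
     \int[P]_w (2 + 128 * x ^+ 2 * expR ((a + b) * Z w ^+ 2))%:E)%E.
    apply: h; first by apply: measurable_funD => //; exact: measurable_funM.
    by move=> w; rewrite pw addr_ge0// expR_ge0.
  under eq_integral do rewrite EFinD.
  rewrite ge0_integralD//; try exact/measurable_EFinP.
  under [X in (_ <= X)%E]eq_integral do rewrite EFinD EFinM.
  have c0 : 0 <= 128 * x ^+ 2 by rewrite mulr_ge0 ?sqr_ge0.
  rewrite ge0_integralD//; last 2 first.
  - by move=> w _; rewrite mule_ge0// lee_fin.
  - by apply: measurable_funeM; exact/measurable_EFinP.
  rewrite ge0_integralZl//; last exact/measurable_EFinP.
  have -> : (\int[P]__ 2 = 2%:E)%E.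
    by rewrite integral_cst// [X in (_ * X)%E](_ : _ = 1%E) ?mule1//; exact: probability_setT.
  rewrite (integral_expR_sqr mZ hZ (ltW a0)) -/x; last by lra.
  have abv : (a + b) * v = x + 8^-1 by rewrite mulrDl bv.
  have ab0 : 0 <= a + b by rewrite addr_ge0// ltW.
  have ab1 : 2 * ((a + b) * v) < 1 by rewrite abv; lra.
  rewrite (integral_expR_sqr mZ hZ ab0 ab1) abv.
  rewrite -EFinM -EFinD -leeBrDr// => /le_trans; apply; rewrite -EFinB lee_fin.
  have h1 := sqrt_ge _ x0 x8.
  have h2 : (Num.sqrt (1 - 2 * (x + 8^-1)))^-1 <= 142 / 100 by apply: sqrt_le2; lra.
  have := ler_wpM2l c0 h2; lra.
apply: le_trans (lee_wpmul2l _ key) _; first by rewrite lee_fin expR_ge0.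
rewrite -EFinM lee_fin uvE opprK sqrrN.
apply: (@le_trans _ _ (expR x * expR (- x + 182 * x ^+ 2))); last first.
  by rewrite -expRD addrA subrr add0r.
rewrite ler_wpM2l ?expR_ge0//; apply: le_trans (expR_ge1Dx _); lra.
Qed.

End law.
End Gauss.

(** * Step functions *)

Section Steps.
Context {R : realType}.
Local Notation D := (`[0%R, 1%R]%classic : set R).
Local Notation mu := (@lebesgue_measure R).

(** With [Z] left arbitrary this expression covers both the integral of a step
    function against a process and the step function itself, as the increments
    of the indicator of a half line. *)
Definition increments (g : seq (R * R * R)) (Z : R -> R) : R :=
  \sum_(q <- g) q.2 * (Z q.1.2 - Z q.1.1).

(** The endpoints of all intervals, sorted, subdivide each interval;
    independence of increments can then be applied to the sum. *)
Lemma common_partition (g : seq (R * R * R)) : step_valid g ->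
  exists (N : nat) (t c : nat -> R),
    [/\ 0 <= t 0%N, t N <= 1, forall j, (j < N)%N -> t j < t j.+1 &
      forall Z, increments g Z = \sum_(j < N) c j * (Z (t j.+1) - Z (t j))].
Proof.
move=> gv.
pose l := 0 :: map (fun q : R * R * R => q.1.1) g ++ map (fun q : R * R * R => q.1.2) g.
(* The point [0] is added to the list of endpoints so that it is not empty. *)
pose s := sort <=%R (undup l).
have sl x : (x \in s) = (x \in l) by rewrite mem_sort mem_undup.
have l01 x : x \in l -> 0 <= x <= 1.
  rewrite inE mem_cat => /predU1P[->|]; first by rewrite lexx ler01.
  case/orP => /mapP[q qg ->]; have [h1 h2 h3] := gv q qg.
    by rewrite h1 (le_trans h2).
  by rewrite h3 (le_trans h1).
have ss : sorted <%R s by rewrite sort_lt_sorted undup_uniq.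
have s0 : (0 < size s)%N by rewrite size_sort; case: (undup l) (mem_undup l 0) => //; rewrite !inE eqxx.
pose t j := nth 0 s j; pose N := (size s).-1.
have tin j : (j < size s)%N -> 0 <= t j <= 1.
  by move=> js; apply: l01; rewrite -sl mem_nth.
pose c j := \sum_(q <- g) q.2 *+ ((index q.1.1 s <= j) && (j < index q.1.2 s))%N.
exists N, t, c; split.
- by have /andP[] := tin 0%N s0.
- by have /andP[] := tin N (ltac:(by rewrite /N prednK)).
- by move=> j jN; rewrite /t (lt_sorted_ltn_nth 0 ss)// ?inE; move: jN; rewrite /N -ltnS prednK// => h; rewrite // ltnW.
- move=> Z; rewrite /increments.
  under [RHS]eq_bigr do rewrite mulr_suml.
  rewrite exchange_big /= big_seq [RHS]big_seq; apply: eq_bigr => q qg.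
  have us : q.1.1 \in s.
    rewrite sl inE mem_cat; apply/orP; right; apply/orP; left.
    exact: (map_f (fun q : R * R * R => q.1.1)).
  have vs : q.1.2 \in s.
    rewrite sl inE mem_cat; apply/orP; right; apply/orP; right.
    exact: (map_f (fun q : R * R * R => q.1.2)).
  have [_ uv _] := gv q qg.
  set a := index q.1.1 s; set b := index q.1.2 s.
  have ab : (a <= b)%N.
    rewrite leqNgt; apply/negP => ba.
    have := lt_sorted_ltn_nth 0 ss; move=> /(_ b a); rewrite !inE !index_mem => /(_ vs us).
    by rewrite !nth_index// -/b -/a ba ltNge uv.
  have bN : (b <= N)%N by rewrite /N -ltnS prednK// index_mem.
  have -> : q.1.1 = t a by rewrite /t nth_index.
  have -> : q.1.2 = t b by rewrite /t nth_index.
  rewrite -(telescope_sumr (fun j => Z (t j)) ab) mulr_sumr.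
  pose F j := q.2 *+ ((a <= j) && (j < b))%N * (Z (t j.+1) - Z (t j)).
  rewrite -(big_mkord xpredT F).
  rewrite [RHS](big_cat_nat (n := a))//=; last exact: (leq_trans ab bN).
  rewrite [X in _ = _ + X](big_cat_nat (n := b))//=.
  have -> : \sum_(0 <= j < a) F j = 0.
    by rewrite big_nat; apply: big1 => j /andP[_ ja]; rewrite /F leqNgt ja /= mulr0n mul0r.
  have -> : \sum_(b <= j < N) F j = 0.
    by rewrite big_nat; apply: big1 => j /andP[bj _]; rewrite /F (ltnNge j) bj andbF mulr0n mul0r.
  rewrite add0r addr0 big_nat [RHS]big_nat; apply: eq_bigr => j /andP[aj jb].
  by rewrite /F aj jb mulr1n.
Qed.

Lemma step_fun_increments g x : step_valid g ->
  step_fun g x = increments g (fun v => (x <= v)%R%:R).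
Proof.
move=> gv; rewrite /step_fun /increments big_seq [RHS]big_seq; apply: eq_bigr => q qg.
have [_ uv _] := gv q qg; congr (_ * _).
rewrite indicE mem_setE in_itv /= ltNge.
case: (leP x q.1.1) => xu /=; last by rewrite subr0.
by rewrite (le_trans xu uv) subrr.
Qed.

Lemma in_L2_cst (k : R) : in_L2 (fun _ : R => k).
Proof.
split; first exact: measurable_cst.
rewrite /sqnorm01 integral_cst//= lebesgue_measure_itv /= lte01 oppr0 adde0 mule1.
by rewrite ltry.
Qed.

Lemma in_L2_indic (a b : R) : in_L2 (\1_`]a, b] : R -> R).
Proof.
split; first by apply: measurable_indic; exact: measurable_itv.
apply: le_lt_trans (in_L2_cst 1).2; apply: ge0_le_integral => //.
- apply/measurable_EFinP; apply: measurable_funX; apply: measurable_indic.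
  exact: measurable_itv.
- move=> x _; rewrite lee_fin indicE; case: (_ \in _); rewrite ?expr1n ?expr0n//=.
Qed.

Lemma in_L2_integrable f : in_L2 f -> mu.-integrable D (EFin \o f).
Proof.
move=> fL; have := in_L2_mul_integrable fL (in_L2_cst 1).
by apply: eq_integrable => // x _ /=; rewrite mulr1.
Qed.

Lemma subset_unit_itv (a b : bool) (u v : R) : 0 <= u -> v <= 1 ->
  [set` Interval (BSide a u) (BSide b v)] `<=` D.
Proof.
move=> u0 v1 x /=; rewrite !in_itv /= => /andP[h1 h2]; apply/andP; split.
  by apply: le_trans u0 _; move: h1; case: a => //=; exact: ltW.
by apply: le_trans v1; move: h2; case: b => //=; exact: ltW.
Qed.

Lemma inner01_indic (f : R -> R) (u v : R) : in_L2 f -> 0 <= u -> u <= v -> v <= 1 ->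
  inner01 f (\1_`]u, v]) = \int[mu]_(x in `[0, v]) f x - \int[mu]_(x in `[0, u]) f x.
Proof.
move=> fL u0 uv v1; have fi := in_L2_integrable fL.
rewrite Rintegral_itvB ?bnd_simp//; last first.
  by apply: integrableS fi => //; exact: subset_unit_itv.
transitivity (\int[mu]_(x in D `&` `]u, v]%classic) f x).
  rewrite Rintegral_mkcondr; apply: eq_Rintegral => x _.
  by rewrite patchE indicE; case: (x \in _); rewrite ?mulr1 ?mulr0.
by congr (Rintegral _ _ _); apply/setIidPr; exact: subset_unit_itv.
Qed.

Lemma inner01_indic_self (u v : R) : 0 <= u -> u <= v -> v <= 1 ->
  inner01 (\1_`]u, v]) (\1_`]u, v]) = v - u :> R.
Proof.
move=> u0 uv v1; have lenE x : 0 <= x -> \int[mu]_(y in `[0, x]) (1 : R) = x.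
  move=> x0; rewrite Rintegral_cst//= mul1r lebesgue_measure_itv /= lte_fin.
  by have [xp|xp] := ltP 0 x; rewrite ?oppr0 ?adde0//=; apply/le_anti/andP.
have <- : inner01 (fun=> 1) (\1_`]u, v]) = v - u.
  by rewrite inner01_indic ?lenE//; [exact: le_trans uv|exact: in_L2_cst].
rewrite /inner01; apply: eq_Rintegral => x _.
by rewrite indicE; case: (_ \in _); rewrite ?mul1r ?mul0r ?mulr0.
Qed.

Lemma in_L2_step_fun (g : seq (R * R * R)) : in_L2 (step_fun g).
Proof. by apply: in_L2_lin => q; exact: in_L2_indic. Qed.

Lemma inner01_step_fun (f : R -> R) (g : seq (R * R * R)) : in_L2 f -> step_valid g ->
  inner01 f (step_fun g) = increments g (fun v => \int[mu]_(x in `[0, v]) f x).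
Proof.
move=> fL gv; rewrite /step_fun inner01_sumr//; last by move=> q; exact: in_L2_indic.
rewrite /increments big_seq [RHS]big_seq; apply: eq_bigr => q qg.
have [u0 uv v1] := gv q qg.
by rewrite inner01_indic.
Qed.

(** The pieces of the common partition are disjoint. *)
Lemma inner01_step_fun_sqr g (N : nat) (t c : nat -> R) : step_valid g ->
  0 <= t 0%N -> t N <= 1 -> (forall j, (j < N)%N -> t j < t j.+1) ->
  (forall Z, increments g Z = \sum_(j < N) c j * (Z (t j.+1) - Z (t j))) ->
  inner01 (step_fun g) (step_fun g) = \sum_(j < N) c j ^+ 2 * (t j.+1 - t j).
Proof.
move=> gv t0 tN tmono gE.
have tle i j : (i <= j)%N -> (j <= N)%N -> t i <= t j.
  elim: j => [|j IH]; first by rewrite leqn0 => /eqP ->.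
  rewrite leq_eqVlt => /predU1P[->//|]; rewrite ltnS => ij jN.
  by apply: le_trans (IH ij (ltnW jN)) _; apply/ltW/tmono.
have tin j : (j <= N)%N -> 0 <= t j <= 1.
  by move=> jN; rewrite (le_trans t0 (tle _ _ (leq0n j) jN)) (le_trans (tle _ _ jN (leqnn N))).
have sE : step_fun g = fun x => \sum_(j < N) c j * \1_`]t j, t j.+1] x.
  apply/funext => x; rewrite step_fun_increments// gE; apply: eq_bigr => j _.
  congr (_ * _); rewrite indicE mem_setE in_itv /= ltNge.
  case: (leP x (t j)) => xu /=; last by rewrite subr0.
  by rewrite (le_trans xu (ltW (tmono _ (ltn_ord j)))) subrr.
rewrite {2}sE inner01_sumr//; last 2 first.
- by move=> j; exact: in_L2_indic.
- exact: in_L2_step_fun.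
apply: eq_bigr => j _; rewrite expr2 -mulrA; congr (_ * _).
rewrite inner01C inner01_step_fun//; last exact: in_L2_indic.
have tj1 := tin _ (ltn_ord j : (j.+1 <= N)%N).
have tj := tin _ (ltnW (ltn_ord j)).
rewrite gE (eq_bigr (fun i : 'I_N => (j == i)%:R * (c i * (t i.+1 - t i)))).
  by rewrite sum_delta.
move=> i _; rewrite mulrCA; congr (_ * _).
have ti1 := tin _ (ltn_ord i : (i.+1 <= N)%N).
have ti := tin _ (ltnW (ltn_ord i)).
case/andP: tj1 tj ti1 ti => ? ? /andP[? ?] /andP[? ?] /andP[? ?].
rewrite -inner01_indic//; [|exact: in_L2_indic|by apply/ltW/tmono].
have [<-|ij] := eqVneq j i; first by rewrite mul1r inner01_indic_self// ltW// tmono.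
rewrite mul0r /inner01 (@eq_Rintegral _ _ _ _ _ (fun=> 0)) ?Rintegral_cst ?mul0r//.
move=> x _; rewrite !indicE !mem_setE !in_itv /=.
case: (boolP (t j < x <= t j.+1)) => [/andP[h1 h2]|]; last by rewrite mul0r.
case: (boolP (t i < x <= t i.+1)) => [/andP[h3 h4]|]; last by rewrite mulr0.
move: ij; rewrite neq_ltn => /orP[] lt.
  by have := tle j.+1 i lt (ltnW (ltn_ord i)); move=> /(le_trans h2)/(lt_le_trans h3); rewrite ltxx.
by have := tle i.+1 j lt (ltnW (ltn_ord j)); move=> /(le_trans h4)/(lt_le_trans h1); rewrite ltxx.
Qed.

End Steps.

(** * Exponential moments of step integrals *)

Section Processes.
Context {R : realType} {d : measure_display} {T : measurableType d}.
Variable P : probability T R.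
Local Notation D := (`[0%R, 1%R]%classic : set R).
Local Notation mu := (@lebesgue_measure R).

Lemma Rintegral_lin (A : set R) (I : Type) (s : seq I) (c : I -> R) (F : I -> R -> R) :
  measurable (A : set (g_sigma_algebraType (R.-ocitv.-measurable))) ->
  (forall i, mu.-integrable A (EFin \o F i)) ->
  \int[mu]_(x in A) (\sum_(i <- s) c i * F i x) =
  \sum_(i <- s) c i * \int[mu]_(x in A) F i x.
Proof.
move=> mA iF.
have iG i : mu.-integrable A (EFin \o (fun x => c i * F i x)).
  by have := integrableZl mA (c i) (iF i); apply: eq_integrable.
have iS (u : seq I) : mu.-integrable A (EFin \o (fun x => \sum_(i <- u) c i * F i x)).
  elim: u => [|i u IH].
    by apply: eq_integrable (integrable0 _ _) => // x _ /=; rewrite big_nil.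
  by apply: eq_integrable (integrableD mA (iG i) IH) => // x _ /=; rewrite big_cons EFinD.
elim: s => [|i s IH].
  rewrite big_nil (@eq_Rintegral _ _ _ _ _ (fun=> 0)) ?Rintegral_cst ?mul0r// => x _.
  by rewrite big_nil.
rewrite big_cons -IH -RintegralZl// -RintegralD//.
by apply: eq_Rintegral => x _; rewrite big_cons.
Qed.

Lemma sigma1_sub_measurable (X h : _ -> R) : measurable_fun setT h ->
  sub_measurable (@sigma1 _ _ T X) (fun w => h (X w)).
Proof.
move=> mh B mB; exists (h @^-1` B); last by rewrite setTI.
by rewrite -[X in measurable X]setTI; exact: mh.
Qed.

Lemma sigma1_measurable (X : T -> R) A : measurable_fun setT X -> sigma1 X A -> measurable A.
Proof. by move=> mX [B mB <-]; exact: mX. Qed.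

Lemma measurable_step_sum (d0 : measure_display) (T0 : measurableType d0)
    (Z : R -> T0 -> R) g : step_valid g ->
  (forall u, 0 <= u <= 1 -> measurable_fun setT (Z u)) ->
  measurable_fun setT (fun w => \sum_(q <- g) q.2 * (Z q.1.2 w - Z q.1.1 w)).
Proof.
move=> + mZ; elim: g => [|q g IH] gv.
  by under eq_fun do rewrite big_nil; exact: measurable_cst.
under eq_fun do rewrite big_cons.
have [u0 uv v1] := gv q (mem_head _ _).
apply: measurable_funD; last by apply: IH => p pg; apply: gv; rewrite inE pg orbT.
apply: measurable_funM => //; apply: measurable_funB; apply: mZ.
  by rewrite v1 (le_trans u0).
by rewrite u0 (le_trans uv).
Qed.

Section generated.
Context {I : Type} (J : set I) (X : I -> {RV P >-> R}).

(** The same set of outcomes with the sigma-algebra generated by the family: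
    measurability with respect to that sigma-algebra becomes measurability of
    functions on this type. *)
Definition generated_type :=
  g_sigma_algebraType (\bigcup_(i in J) preimage_set_system setT (X i) measurable).

Lemma sigma_gen_sub_measurable (f : T -> R) :
  measurable_fun (setT : set generated_type) (f : generated_type -> R) ->
  sub_measurable (sigma_gen J X) f.
Proof. by move=> mf B mB; have := mf measurableT B mB; rewrite setTI. Qed.

Lemma generated_measurable_fun i : J i ->
  measurable_fun (setT : set generated_type) (X i : generated_type -> R).
Proof.
move=> Ji _ B mB; apply: sub_sigma_algebra; exists i => //.
by exists B.
Qed.

Lemma sigma_gen_measurable A : sigma_gen J X A -> measurable A.
Proof.
apply: smallest_sub; first exact: sigma_algebra_measurable.
by move=> B [i Ji] [C mC <-]; exact: measurable_funPT.
Qed.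

End generated.

Lemma gauss_sum_expR (I : finType) (Z : I -> T -> R) (sd b : I -> R) :
  (forall i, measurable_fun setT (Z i)) -> (forall i, sd i != 0) ->
  (forall i, has_normal_law P (Z i) 0 (sd i)) ->
  mutually_independent P (fun i => sigma1 (Z i)) ->
  (\int[P]_w (expR (\sum_i b i * Z i w))%:E =
   (expR (\sum_i b i ^+ 2 * sd i ^+ 2 / 2))%:E)%E.
Proof.
move=> mZ sd0 lZ indZ.
under eq_integral do rewrite expR_sum.
rewrite (@mutually_independent_expectation _ _ _ P I (fun i => sigma1 (Z i))
  (fun i w => expR (b i * Z i w)))//.
- rewrite expR_sum -prodEFin; apply: eq_bigr => i _.
  by rewrite (normal_law_expR _ (mZ i) (sd0 i) (lZ i)).
- by move=> i B; exact: sigma1_measurable.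
- move=> i; apply: (@sigma1_sub_measurable (Z i) (fun x => expR (b i * x))).
  by apply: measurableT_comp => //; exact: measurable_funM.
- by move=> i; rewrite (normal_law_expR _ (mZ i) (sd0 i) (lZ i)) ltry.
- exact: index_enum_uniq.
Qed.

Lemma brownian_step_expR (W : R -> {RV P >-> R}) g a :
  brownian_motion W -> step_valid g ->
  (\int[P]_w (expR (a * step_integral W g w))%:E =
   (expR (a ^+ 2 * inner01 (step_fun g) (step_fun g) / 2))%:E)%E.
Proof.
move=> [_ _ lW iW] gv.
have [N [t [c [t0 tN tm gE]]]] := common_partition gv.
have tle i j : (i <= j)%N -> (j <= N)%N -> t i <= t j.
  elim: j => [|j IH]; first by rewrite leqn0 => /eqP ->.
  rewrite leq_eqVlt => /predU1P[->//|]; rewrite ltnS => ij jN.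
  by apply: le_trans (IH ij (ltnW jN)) _; apply/ltW/tm.
have indW := iW N t t0 tN (fun j jN => ltW (tm j jN)).
have dt0 (j : 'I_N) : 0 < t j.+1 - t j by rewrite subr_gt0 tm.
rewrite (inner01_step_fun_sqr gv t0 tN tm gE).
transitivity (\int[P]_w (expR (\sum_(j < N) (a * c j) * (W (t j.+1) w - W (t j) w)))%:E)%E.
  apply: eq_integral => w _; congr (expR _)%:E.
  rewrite /step_integral -/(increments g (fun v => W v w)) gE mulr_sumr.
  by apply: eq_bigr => j _; rewrite mulrA.
rewrite (@gauss_sum_expR _ (fun (j : 'I_N) w => W (t j.+1) w - W (t j) w)
  (fun j => Num.sqrt (t j.+1 - t j)))//.
- congr (expR _)%:E; rewrite mulr_sumr mulr_suml; apply: eq_bigr => j _.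
  by rewrite sqr_sqrtr ?ltW// exprMn mulrA.
- by move=> j; apply: measurable_funB.
- by move=> j; rewrite gt_eqF// sqrtr_gt0.
- move=> j; apply: lW; [|exact: tm|].
    by apply: le_trans t0 (tle _ _ _ _) => //; exact: ltnW.
  by apply: le_trans tN; apply: tle.
Qed.

(** The variance of the integral of [f] against the observed process: the
    signal contributes the quadratic form of [K] and the noise [sigma ^+ 2]
    times the squared norm. *)
Definition signal_variance m (lam : 'I_m -> R) (phi : 'I_m -> R -> R) (sigma : R) (f : R -> R) :=
  \sum_k lam k * inner01 (phi k) f ^+ 2 + sigma ^+ 2 * inner01 f f.

Section signal.
Variables (K : R -> R -> R) (sigma : R) (X : R -> {RV P >-> R}).
Variables (m : nat) (lam : 'I_m -> R) (phi : 'I_m -> R -> R).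
Variables (xi : 'I_m -> {RV P >-> R}) (W : R -> {RV P >-> R}).
Hypothesis KE : spectral_decomposition K lam phi.
Hypotheses (lxi : forall k, has_normal_law P (xi k) 0 1)
  (ixi : mutually_independent P (fun k => sigma1 (xi k)))
  (bW : brownian_motion W)
  (ixiW : independent2 P (sigma_gen setT xi) (sigma_gen `[0, 1] W))
  (XE : {ae P, forall w, forall t, t \in `[0, 1] ->
          X t w - X 0 w =
          \int[lebesgue_measure]_(u in `[0, t])
             (\sum_(k < m) Num.sqrt (lam k) * xi k w * phi k u)
          + sigma * W t w}).

Let phiL k : in_L2 (phi k). Proof. by case: KE => _ []. Qed.
Let lam0 k : 0 < lam k. Proof. by case: KE. Qed.

(** Both parts are linear in the increments; the signal part of the increments
    is integrated over half-open intervals, which gives the inner products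
    with [phi k]. *)
Lemma signal_step_integral g : step_valid g ->
  {ae P, forall w, step_integral X g w =
    \sum_k (Num.sqrt (lam k) * inner01 (phi k) (step_fun g)) * xi k w +
    sigma * step_integral W g w}.
Proof.
move=> gv; apply: filterS XE => w XEw.
have Xinc t : 0 <= t -> t <= 1 -> X t w = X 0 w +
    \sum_(k < m) (Num.sqrt (lam k) * xi k w) * \int[mu]_(u in `[0, t]) phi k u + sigma * W t w.
  move=> t0 t1; have /XEw : t \in `[0%R, 1%R] by rewrite in_itv /= t0.
  move=> /eqP; rewrite subr_eq => /eqP ->; rewrite addrC [RHS]addrAC addrA.
  rewrite [RHS]addrAC; congr (_ + _ + _); rewrite Rintegral_lin// => k.
  apply: integrableS (in_L2_integrable (phiL k)) => //.
  exact: subset_unit_itv.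
rewrite /step_integral.
transitivity (\sum_(q <- g) (\sum_(k < m) (Num.sqrt (lam k) * xi k w) *
    (q.2 * (\int[mu]_(u in `[0, q.1.2]) phi k u - \int[mu]_(u in `[0, q.1.1]) phi k u)) +
    sigma * (q.2 * (W q.1.2 w - W q.1.1 w)))).
  rewrite big_seq [RHS]big_seq; apply: eq_bigr => q qg.
  have [u0 uv v1] := gv q qg.
  rewrite (Xinc q.1.2) ?(le_trans u0)// (Xinc q.1.1) ?(le_trans uv)//.
  under [in RHS]eq_bigr do rewrite mulrBr mulrBr mulrCA [X in _ - X]mulrCA.
  rewrite sumrB -!mulr_sumr; ring.
rewrite big_split /= -mulr_sumr exchange_big /=; congr (_ + _).
apply: eq_bigr => k _; rewrite -mulr_sumr (inner01_step_fun (phiL k) gv) /increments.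
by rewrite mulrAC.
Qed.

(** The signal and the Brownian part are functions of independent families,
    and each has an explicit Laplace transform. *)
Lemma signal_step_expR g a : step_valid g ->
  (\int[P]_w (expR (a * step_integral X g w))%:E =
   (expR (a ^+ 2 * signal_variance lam phi sigma (step_fun g) / 2))%:E)%E.
Proof.
move=> gv.
pose b k := a * (Num.sqrt (lam k) * inner01 (phi k) (step_fun g)).
pose F w := expR (\sum_k b k * xi k w).
pose G w := expR ((a * sigma) * step_integral W g w).
have sW u : 0 <= u <= 1 -> (`[0%R, 1%R]%classic : set R) u by move=> h; rewrite /= in_itv.
have FF : sub_measurable (sigma_gen setT xi) F.
  apply: sigma_gen_sub_measurable; apply: measurableT_comp => //.
  apply: measurable_sum => k; apply: measurable_funM => //.
  exact: generated_measurable_fun.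
have GG : sub_measurable (sigma_gen `[0, 1] W) G.
  apply: sigma_gen_sub_measurable; apply: measurableT_comp => //.
  apply: measurable_funM => //; apply: (measurable_step_sum (Z := fun u => W u : generated_type (`[0%R, 1%R]%classic : set R) W -> R)) => // u u01.
  by apply: generated_measurable_fun; exact: sW.
have EF : (\int[P]_w (F w)%:E = (expR (\sum_k b k ^+ 2 * 1 ^+ 2 / 2))%:E)%E.
  by apply: gauss_sum_expR => // i; rewrite oner_neq0.
have EG : (\int[P]_w (G w)%:E =
    (expR ((a * sigma) ^+ 2 * inner01 (step_fun g) (step_fun g) / 2))%:E)%E.
  exact: brownian_step_expR.
have mF := sub_measurable_fun (@sigma_gen_measurable _ _ _) FF.
have mG := sub_measurable_fun (@sigma_gen_measurable _ _ _) GG.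
transitivity (\int[P]_w (F w * G w)%:E)%E.
  apply: ge0_ae_eq_integral => //.
  - apply/measurable_EFinP; apply: measurableT_comp => //; apply: measurable_funM => //.
    by apply: (measurable_step_sum (Z := fun u => X u : T -> R)).
  - by apply/measurable_EFinP; exact: measurable_funM.
  - by move=> w _; rewrite lee_fin; apply: mulr_ge0; exact: expR_ge0.
  apply: filterS (signal_step_integral gv) => w -> _.
  congr EFin; rewrite /F /G -expRD; congr expR; rewrite mulrDr mulrA; congr (_ + _).
  by rewrite mulr_sumr; apply: eq_bigr => k _; rewrite /b !mulrA.
rewrite (independent2_integralM (@sigma_gen_measurable _ _ _) (@sigma_gen_measurable _ _ _)
  ixiW FF GG) ?EG ?ltry//; last 2 first.
- by move=> w; exact: expR_ge0.
- by move=> w; exact: expR_ge0.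
rewrite EF -EFinM -expRD; congr (expR _)%:E.
rewrite /signal_variance -mulr_suml -mulrDl; congr (_ / _).
rewrite mulrDr mulr_sumr exprMn mulrA; congr (_ + _).
apply: eq_bigr => k _; rewrite expr1n mulr1 /b !exprMn sqr_sqrtr ?ltW//.
Qed.

End signal.
End Processes.

(** * Limits of step functions *)

Section Limits.
Context {R : realType}.
Local Notation D := (`[0%R, 1%R]%classic : set R).
Local Notation mu := (@lebesgue_measure R).

Lemma cvg_sqr_integral_lin d (T : measurableType d) (m : {measure set T -> \bar R})
    (A : set T) (I : finType) (c : I -> R) (F : I -> nat -> T -> R) :
  measurable A -> (forall k j, measurable_fun A (F k j)) ->
  (forall k, (\int[m]_(x in A) ((F k j x) ^+ 2)%:E)%E @[j --> \oo] --> 0%E) ->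
  (\int[m]_(x in A) ((\sum_k c k * F k j x) ^+ 2)%:E)%E @[j --> \oo] --> 0%E.
Proof.
move=> mA mF cF.
have cc0 k : 0 <= #|I|%:R * c k ^+ 2 by rewrite mulr_ge0 ?sqr_ge0.
apply: (@squeeze_cvge _ _ _ _ (fun=> 0%E) _
  (fun j => \sum_k (#|I|%:R * c k ^+ 2)%:E * \int[m]_(x in A) ((F k j x) ^+ 2)%:E)%E).
- apply: nearW => j; apply/andP; split.
    by apply: integral_ge0 => x _; rewrite lee_fin sqr_ge0.
  apply: (@le_trans _ _ (\int[m]_(x in A) (\sum_k (#|I|%:R * c k ^+ 2)%:E * ((F k j x) ^+ 2)%:E))%E).
    apply: ge0_le_integral => //.
    - by move=> x _; rewrite lee_fin sqr_ge0.
    - apply/measurable_EFinP; apply: measurable_funX; apply: measurable_sum => k.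
      exact: measurable_funM.
    - apply: emeasurable_sum => k; apply: measurable_funeM; apply/measurable_EFinP.
      exact: measurable_funX.
    - move=> x _; rewrite (_ : (\sum_k _)%E = (\sum_k #|I|%:R * c k ^+ 2 * F k j x ^+ 2)%:E); last first.
        by rewrite -sumEFin.
      rewrite lee_fin.
      apply: le_trans (sqr_sum_le _ _) _.
      rewrite mulr_sumr; apply: ler_sum => k _.
      by rewrite exprMn mulrA.
  rewrite ge0_integral_sum//.
  - apply: lee_sum => k _; rewrite ge0_integralZl//.
    by apply/measurable_EFinP; exact: measurable_funX.
    by move=> x _; rewrite lee_fin sqr_ge0.
    by rewrite lee_fin.
  - by move=> k; apply: measurable_funeM; apply/measurable_EFinP; exact: measurable_funX.
  - by move=> k x _; rewrite mule_ge0// lee_fin ?sqr_ge0.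
- exact: cvg_cst.
- rewrite [X in _ --> X](_ : 0%E = \sum_k (#|I|%:R * c k ^+ 2)%:E * (0 : \bar R))%E; last first.
    by rewrite big1// => k _; rewrite mule0.
  apply: cvg_nnesum => [k _|k _].
    apply: nearW => j; rewrite mule_ge0// ?lee_fin//.
    by apply: integral_ge0 => x _; rewrite lee_fin sqr_ge0.
  by apply: cvgeZl => //; exact: cF.
Qed.

(** The indices are chosen so that the integrals of [S (phi p)] are summable;
    the sum of the [S (phi p)] is then almost everywhere finite. *)
Lemma ae_cvg_subseq d (T : measurableType d) (m : {measure set T -> \bar R})
    (S : nat -> T -> R) :
  (forall j, measurable_fun setT (S j)) -> (forall j w, 0 <= S j w) ->
  (\int[m]_w (S j w)%:E)%E @[j --> \oo] --> 0%E ->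
  exists2 phi : nat -> nat, (forall p, (p <= phi p)%N) &
    {ae m, forall w, S (phi p) w @[p --> \oo] --> 0}.
Proof.
move=> mS S0 cS.
have I0 j : (0 <= \int[m]_w (S j w)%:E)%E by apply: integral_ge0 => w _; rewrite lee_fin.
have ex p : exists j, (p <= j)%N /\ (\int[m]_w (S j w)%:E <= (1 / (2 ^ p.+1)%:R)%:E)%E.
  have e0 : 0 < 1 / (2 ^ p.+1)%:R :> R by rewrite divr_gt0// ltr0n expn_gt0.
  have /fine_cvgP[[N1 _ f1] /cvgrPdist_lt/(_ _ e0)[N2 _ f2]] := cS.
  pose j := maxn p (maxn N1 N2); exists j; split; first exact: leq_maxl.
  have j1 : (N1 <= j)%N := leq_trans (leq_maxl N1 N2) (leq_maxr p _).
  have j2 : (N2 <= j)%N := leq_trans (leq_maxr N1 N2) (leq_maxr p _).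
  rewrite -(fineK (f1 j j1)) lee_fin; have := f2 j j2.
  by rewrite /= sub0r normrN => /ltr_normlW/ltW.
have [phi hphi] := choice ex.
exists phi; first by move=> p; case: (hphi p).
pose h w := (\sum_(0 <= p <oo) (S (phi p) w)%:E)%E.
have mh : measurable_fun setT h.
  by apply: ge0_emeasurable_sum => [p x _ _|p _]; [rewrite lee_fin|exact/measurable_EFinP].
have h0 w : (0 <= h w)%E by apply: nneseries_ge0 => p _ _; rewrite lee_fin.
have hi : (\int[m]_w h w < +oo)%E.
  rewrite integral_nneseries//; last 2 first.
  - by move=> p; exact/measurable_EFinP.
  - by move=> p w _; rewrite lee_fin.
  apply: (@le_lt_trans _ _ (\sum_(0 <= p <oo) (0 + (1 / (2 ^ p.+1)%:R)%:E))%E).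
    by apply: lee_nneseries => p _ *; rewrite ?add0e//; case: (hphi p).
  apply: (@le_lt_trans _ _ (\sum_(0 <= p <oo) 0 + 1%:E)%E).
    by apply: epsilon_trick.
  by rewrite eseries0// add0e ltry.
have hint : m.-integrable setT h.
  apply/integrableP; split => //.
  by under eq_integral do rewrite gee0_abs//.
have := integrable_ae measurableT hint.
apply: filterS => w /(_ I) hfin.
have hub n : \sum_(0 <= p < n) S (phi p) w <= fine (h w).
  rewrite -lee_fin fineK// -sumEFin; apply: nneseries_lim_ge => p _ _.
  by rewrite lee_fin.
apply: (@cvg_series_cvg_0 _ R^o).
apply: nondecreasing_is_cvgn.
  apply/nondecreasing_seqP => n.
  by rewrite /series /= big_nat_recr//= lerDl.
by exists (fine (h w)) => _ [n _ <-]; exact: hub.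
Qed.

Lemma cvg_sumr (I : Type) (r : seq I) (F : I -> nat -> R) (l : I -> R) :
  (forall i, F i m @[m --> \oo] --> l i) ->
  \sum_(i <- r) F i m @[m --> \oo] --> \sum_(i <- r) l i.
Proof.
move=> Fl; elim: r => [|i r IH].
  by under eq_fun do rewrite big_nil; rewrite big_nil; exact: cvg_cst.
by under eq_fun do rewrite big_cons; rewrite big_cons; exact: cvgD.
Qed.

Lemma cvg_sqr0 (x : nat -> R) : x m ^+ 2 @[m --> \oo] --> 0 -> x m @[m --> \oo] --> 0.
Proof.
move=> h; apply: norm_cvg0.
rewrite (_ : (fun m => `|x m|) = fun m => Num.sqrt (x m ^+ 2)); last first.
  by apply/funext => m; rewrite sqrtr_sqr.
rewrite -[X in _ --> X]sqrtr0; apply: (cvg_comp _ _ h); exact: sqrt_continuous.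
Qed.

Lemma cauchy_schwarz01 (f h : R -> R) : in_L2 f -> in_L2 h ->
  inner01 h f ^+ 2 <= inner01 h h * inner01 f f.
Proof.
move=> fL hL.
have q t : 0 <= inner01 f f - 2 * t * inner01 h f + t ^+ 2 * inner01 h h.
  have := inner01_ge0 (fun x => f x - t * h x).
  have thL := in_L2Z t hL; have L := in_L2B fL thL.
  rewrite inner01Bl// (inner01C f) (inner01C (fun x => t * h x)) !inner01Bl// !inner01Zl//.
  by rewrite (inner01C f (fun x => t * h x)) (inner01C h (fun x => t * h x)) !inner01Zl// => H; lra.
have hh0 := inner01_ge0 h; have ff0 := inner01_ge0 f.
have [hh|hh] := eqVneq (inner01 h h) 0.
  have q' t : 0 <= inner01 f f - 2 * t * inner01 h f by have := q t; rewrite hh mulr0 addr0.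
  have [->|x0] := eqVneq (inner01 h f) 0; first by rewrite expr0n mulr_ge0.
  have := q' ((inner01 f f + 1) / (2 * inner01 h f)).
  rewrite (_ : 2 * _ * _ = inner01 f f + 1); first by lra.
  by field.
have hp : 0 < inner01 h h by rewrite lt_def hh.
have := q (inner01 h f / inner01 h h).
move: hp; set a := inner01 h h; set b := inner01 h f; set c := inner01 f f => hp.
have -> : c - 2 * (b / a) * b + (b / a) ^+ 2 * a = (a * c - b ^+ 2) / a.
  by field; rewrite gt_eqF.
by rewrite pmulr_lge0 ?invr_gt0// subr_ge0.
Qed.

Section inner_limits.
Variables (f : R -> R) (s : nat -> R -> R).
Hypotheses (fL : in_L2 f) (sL : forall m, in_L2 (s m)).
Hypothesis fs : sqnorm01 (fun t => f t - s m t) @[m --> \oo] --> 0%E.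

Let dL m : in_L2 (fun t => f t - s m t). Proof. exact: in_L2B. Qed.

Let eps_cvg : inner01 (fun t => f t - s m t) (fun t => f t - s m t) @[m --> \oo] --> 0.
Proof.
have := fs; under eq_fun do rewrite sqnorm01E//.
by move=> /fine_cvgP[].
Qed.

Lemma cvg_inner01r h : in_L2 h -> inner01 h (s m) @[m --> \oo] --> inner01 h f.
Proof.
move=> hL.
have c0 : inner01 h (fun t => f t - s m t) @[m --> \oo] --> 0.
  apply: cvg_sqr0; apply: (squeeze_cvgr (f := fun=> 0)
    (h := fun m => inner01 h h * inner01 (fun t => f t - s m t) (fun t => f t - s m t))).
  - by apply: nearW => m; rewrite sqr_ge0 cauchy_schwarz01.
  - exact: cvg_cst.
  - by rewrite -[X in _ --> X](mulr0 (inner01 h h)); apply: cvgMl_tmp.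
have -> : (fun m => inner01 h (s m)) = (fun m => inner01 h f - inner01 h (fun t => f t - s m t)).
  apply/funext => m; rewrite [in RHS](inner01C h (fun t => _ - _)) inner01Bl//.
  by rewrite !(inner01C _ h) opprB addrC subrK.
rewrite -[X in _ --> X](subr0 (inner01 h f)); apply: cvgB => //; exact: cvg_cst.
Qed.

Lemma cvg_inner01_sqr : inner01 (s m) (s m) @[m --> \oo] --> inner01 f f.
Proof.
have -> : (fun m => inner01 (s m) (s m)) = (fun m => 2 * inner01 f (s m) - inner01 f f +
   inner01 (fun t => f t - s m t) (fun t => f t - s m t)).
  apply/funext => m; rewrite inner01Bl// (inner01C f (fun t => _ - _)) (inner01C (s m) (fun t => _ - _)).
  rewrite !inner01Bl// (inner01C (s m) f); ring.
rewrite [X in _ --> X](_ : _ = 2 * inner01 f f - inner01 f f + 0); last by ring.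
apply: cvgD => //; apply: cvgB; last exact: cvg_cst.
by apply: cvgMl_tmp; exact: cvg_inner01r.
Qed.

Lemma cvg_signal_variance m (lam : 'I_m -> R) (phi : 'I_m -> R -> R) sigma :
  (forall k, in_L2 (phi k)) ->
  signal_variance lam phi sigma (s j) @[j --> \oo] --> signal_variance lam phi sigma f.
Proof.
move=> phiL; apply: cvgD; last by apply: cvgMl_tmp; exact: cvg_inner01_sqr.
apply: cvg_sumr => k; apply: cvgMl_tmp.
apply: (cvg_comp _ (fun x => x ^+ 2) (cvg_inner01r (phiL k))).
exact: exprn_continuous.
Qed.

End inner_limits.

End Limits.

(** * Exponential moments of Wiener integrals *)

Section Sample.
Context {R : realType} {d : measure_display} {T : measurableType d}.
Variable P : probability T R.
Local Notation D := (`[0%R, 1%R]%classic : set R).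
Local Notation mu := (@lebesgue_measure R).

(** The same condition as for a Wiener integral, for a function [Z] that is
    not bundled as a random variable: linear combinations of the data are of
    this form. *)
Definition wiener_limit (X : R -> {RV P >-> R}) (f : R -> R) (Z : T -> R) : Prop :=
  exists g : nat -> seq (R * R * R),
    [/\ forall m, step_valid (g m),
        sqnorm01 (fun t => f t - step_fun (g m) t) @[m --> \oo] --> 0%E &
        (\int[P]_w ((step_integral X (g m) w - Z w) ^+ 2)%:E)%E
          @[m --> \oo] --> 0%E].

Definition scale_step (a : R) (g : seq (R * R * R)) : seq (R * R * R) :=
  [seq (q.1, a * q.2) | q <- g].

Lemma measurable_step_integral (X : R -> {RV P >-> R}) g : step_valid g ->
  measurable_fun setT (step_integral X g).
Proof. by move=> gv; apply: (measurable_step_sum (Z := fun u => X u : T -> R)). Qed.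

Lemma wiener_limit_basis_comb (X : R -> {RV P >-> R}) (e : nat -> R -> R) (Y : nat -> {RV P >-> R})
    l (v : 'rV[R]_l) :
  (forall k, in_L2 (e k)) ->
  (forall k, (k < l)%N -> is_wiener_integral X (e k) (Y k)) ->
  wiener_limit X (basis_comb e v) (fun w => \sum_(k < l) v 0 k * Y k w).
Proof.
move=> eL hY.
have /choice[g hg] : forall k : 'I_l, exists g : nat -> seq (R * R * R),
    [/\ forall m, step_valid (g m),
        sqnorm01 (fun t => e k t - step_fun (g m) t) @[m --> \oo] --> 0%E &
        (\int[P]_w ((step_integral X (g m) w - Y k w) ^+ 2)%:E)%E
          @[m --> \oo] --> 0%E].
  by move=> k; exact: hY.
pose G m := flatten [seq scale_step (v 0 k) (g k m) | k <- index_enum 'I_l].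
have sumG (F : R * R * R -> R) m : \sum_(q <- G m) F q =
    \sum_(k < l) \sum_(q <- g k m) F (q.1, v 0 k * q.2).
  rewrite big_flatten big_map /=; apply: eq_bigr => k _.
  by rewrite big_map.
exists G; split.
- move=> m q /flattenP[s /mapP[k _ ->] /mapP[q' q'g ->]] /=.
  by have [h _ _] := hg k; exact: (h m q').
- rewrite (_ : (fun m => sqnorm01 _) = (fun j => \int[mu]_(x in D)
    ((\sum_(k < l) v 0 k * (e k x - step_fun (g k j) x)) ^+ 2)%:E)%E).
    apply: (@cvg_sqr_integral_lin R _ _ mu D _ (fun k => v 0 k)
      (fun (k : 'I_l) m t => e k t - step_fun (g k m) t)).
    + exact: measurable_itv.
    + by move=> k j; apply: in_L2_measurable; apply: in_L2B => //; exact: in_L2_step_fun.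
    + by move=> k; have [] := hg k.
  apply/funext => m; apply: eq_integral => t _; congr ((_ ^+ 2)%:E).
  rewrite /basis_comb /step_fun sumG -sumrB; apply: eq_bigr => k _.
  by rewrite mulrBr mulr_sumr; congr (_ - _); apply: eq_bigr => q _; rewrite mulrA.
- rewrite (_ : (fun m => (\int[P]_w _)%E) = (fun j => \int[P]_(x in setT)
    ((\sum_(k < l) v 0 k * (step_integral X (g k j) x - Y k x)) ^+ 2)%:E)%E).
    apply: (@cvg_sqr_integral_lin R _ _ P setT _ (fun k => v 0 k)
      (fun (k : 'I_l) m w => step_integral X (g k m) w - Y k w)).
    + exact: measurableT.
    + move=> k j; apply: measurable_funB => //; apply: measurable_step_integral.
      by have [h _ _] := hg k.
    + by move=> k; have [] := hg k.
  apply/funext => m; apply: eq_integral => t _; congr ((_ ^+ 2)%:E).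
  rewrite /step_integral sumG -sumrB; apply: eq_bigr => k _.
  by rewrite mulrBr mulr_sumr; congr (_ - _); apply: eq_bigr => q _; rewrite mulrA.
Qed.

(** The variance depends on the decomposition of [K] only through [K]. *)
Lemma signal_variance_kernel (K : R -> R -> R) m (lam : 'I_m -> R) phi sigma f :
  spectral_decomposition K lam phi -> in_L2 f ->
  signal_variance lam phi sigma f =
  inner01 (fun t => inner01 (K t) f) f + sigma ^+ 2 * inner01 f f.
Proof.
move=> KE fL; rewrite /signal_variance -(compression_kernel KE fL fL); congr (_ + _).
by apply: eq_bigr => k _; rewrite expr2 mulrA.
Qed.

Section exponential_moment.
Variables (n : nat) (K : R -> R -> R) (sigma : R) (X : 'I_n -> R -> {RV P >-> R}).
Variables (m : nat) (lam : 'I_m -> R) (phi : 'I_m -> R -> R).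
Hypothesis KE : spectral_decomposition K lam phi.
Hypothesis XK : forall i, signal_plus_noise K sigma (X i).
Hypothesis indX : mutually_independent P (fun i => sigma_gen `[0, 1] (X i)).

Let lam0 k : 0 < lam k. Proof. by case: KE. Qed.

Lemma signal_variance_ge0 f : 0 <= signal_variance lam phi sigma f.
Proof.
apply: addr_ge0; last by rewrite mulr_ge0 ?sqr_ge0 ?inner01_ge0.
by apply: sumr_ge0 => k _; rewrite mulr_ge0 ?sqr_ge0// ltW.
Qed.

(** The sample supplies a decomposition of [K] of its own, exchanged here for
    the fixed one. *)
Lemma step_integral_expR i g a : step_valid g ->
  (\int[P]_w (expR (a * step_integral (X i) g w))%:E =
   (expR (a ^+ 2 * signal_variance lam phi sigma (step_fun g) / 2))%:E)%E.
Proof.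
move=> gv; have [m' [lam' [phi' [xi [W [KE' [lxi ixi] bW ixiW XE]]]]]] := XK i.
rewrite (signal_step_expR KE' lxi ixi bW ixiW XE)//.
by rewrite (signal_variance_kernel _ KE') 1?(signal_variance_kernel _ KE)//; exact: in_L2_step_fun.
Qed.

Lemma step_sample_bound (g : 'I_n -> seq (R * R * R)) u :
  (forall i, step_valid (g i)) ->
  (forall i, 8 * (`|u| * signal_variance lam phi sigma (step_fun (g i))) <= 1) ->
  (\int[P]_w (expR (\sum_i u * (step_integral (X i) (g i) w ^+ 2 -
      signal_variance lam phi sigma (step_fun (g i)))))%:E <=
   (expR (\sum_i 182 * (u * signal_variance lam phi sigma (step_fun (g i))) ^+ 2))%:E)%E.
Proof.
move=> gv hu; set V := fun i => signal_variance lam phi sigma (step_fun (g i)).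
pose f i w := expR (u * (step_integral (X i) (g i) w ^+ 2 - V i)).
have fb i : (\int[P]_w (f i w)%:E <= (expR (182 * (u * V i) ^+ 2))%:E)%E.
  apply: quad_expR_bound (hu i).
  - exact: measurable_step_integral.
  - exact: signal_variance_ge0.
  - by move=> t; exact: step_integral_expR.
have f0 i : (0 <= \int[P]_w (f i w)%:E)%E.
  by apply: integral_ge0 => w _; rewrite lee_fin expR_ge0.
have ffin i : (\int[P]_w (f i w)%:E < +oo)%E by apply: le_lt_trans (fb i) (ltry _).
under eq_integral do rewrite expR_sum.
rewrite (@mutually_independent_expectation _ _ _ P _ (fun i => sigma_gen `[0, 1] (X i)) f)//.
- rewrite expR_sum.
  rewrite (eq_bigr (fun i => (fine (\int[P]_w (f i w)%:E)%E)%:E)); last first.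
    by move=> i _; rewrite fineK// ge0_fin_numE.
  rewrite prodEFin lee_fin; apply: ler_prod => i _.
  by rewrite fine_ge0//= -lee_fin fineK// ge0_fin_numE.
- by move=> i B; exact: sigma_gen_measurable.
- move=> i; apply: sigma_gen_sub_measurable; apply: measurableT_comp => //.
  apply: measurable_funM => //; apply: measurable_funB => //; apply: measurable_funX.
  apply: (measurable_step_sum (Z := fun u => X i u : generated_type (`[0%R, 1%R]%classic : set R) (X i) -> R)) => // t t01.
  by apply: generated_measurable_fun; rewrite /= in_itv.
- by move=> i w; exact: expR_ge0.
- exact: index_enum_uniq.
Qed.

(** Step functions approximating [f] give the bound before the limit. Along a
    subsequence their integrals converge almost surely for all [i] at once, so
    Fatou's lemma applies to the exponentials, and continuity of the variance
    gives the limit of the bounds. The strict inequality on [u] keeps the step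
    functions in the admissible range from some index on. *)
Lemma sample_expR_bound (f : R -> R) (Z : 'I_n -> T -> R) (u : R) : in_L2 f ->
  (forall i, measurable_fun setT (Z i)) ->
  (forall i, wiener_limit (X i) f (Z i)) ->
  let v := signal_variance lam phi sigma f in
  8 * (`|u| * v) < 1 ->
  (\int[P]_w (expR (u * \sum_i (Z i w ^+ 2 - v)))%:E <=
   (expR (n%:R * (182 * (u * v) ^+ 2)))%:E)%E.
Proof.
move=> fL mZ hZ v uv.
have phiL k : in_L2 (phi k) by case: KE => _ [].
have [g hg] := choice hZ.
pose V i m := signal_variance lam phi sigma (step_fun (g i m)).
have Vv i : V i m @[m --> \oo] --> v.
  by have [_ h _] := hg i; apply: cvg_signal_variance => // j; exact: in_L2_step_fun.
have near1 i : \forall m \near \oo, 8 * (`|u| * V i m) < 1.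
  have : 8 * (`|u| * V i m) @[m --> \oo] --> 8 * (`|u| * v).
    by apply: cvgMl_tmp; apply: cvgMl_tmp; exact: Vv.
  by move=> /cvgr_lt h; exact: h _ uv.
have [N0 _ hN0] : \forall m \near \oo, forall i, 8 * (`|u| * V i m) < 1.
  by apply: filter_forall.
pose S j w := \sum_i (step_integral (X i) (g i (j + N0)%N) w - Z i w) ^+ 2.
have gv i j : step_valid (g i j) by have [h _ _] := hg i; exact: h.
have mU i j : measurable_fun setT (step_integral (X i) (g i j)) by exact: measurable_step_integral.
have mS j : measurable_fun setT (S j).
  by apply: measurable_sum => i; apply: measurable_funX; exact: measurable_funB.
have S0 j w : 0 <= S j w by apply: sumr_ge0 => i _; exact: sqr_ge0.
have cS : (\int[P]_w (S m w)%:E)%E @[m --> \oo] --> 0%E.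
  rewrite (_ : (fun m => _) = fun m => (\sum_i \int[P]_w ((step_integral (X i) (g i (m + N0)%N) w - Z i w) ^+ 2)%:E)%E); last first.
    apply/funext => m0; rewrite -ge0_integral_sum//.
    - by apply: eq_integral => w _; rewrite /S sumEFin.
    - by move=> i; apply/measurable_EFinP; apply: measurable_funX; exact: measurable_funB.
    - by move=> i w _; rewrite lee_fin sqr_ge0.
  rewrite [X in _ --> X](_ : 0%E = \sum_(i < n) (0 : \bar R))%E; last by rewrite big1.
  apply: cvg_nnesum => [i _|i _].
    by apply: nearW => m0; apply: integral_ge0 => w _; rewrite lee_fin sqr_ge0.
  have [_ _ h] := hg i.
  rewrite -(cvg_shiftn N0) in h; exact: h.
have [pi_ pige piae] := ae_cvg_subseq mS S0 cS.
pose q p := (pi_ p + N0)%N.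
have qge p : (p <= q p)%N by rewrite (leq_trans (pige p))// leq_addr.
have Vq i : V i (q p) @[p --> \oo] --> v.
  apply/cvgrPdist_lt => eps eps0; have /cvgrPdist_lt/(_ _ eps0)[N _ hN] := Vv i.
  by exists N => // p /= Np; apply: hN => /=; exact: leq_trans (qge p).
pose H p w := expR (\sum_i u * (step_integral (X i) (g i (q p)) w ^+ 2 - V i (q p))).
pose c p := expR (\sum_(i < n) 182 * (u * V i (q p)) ^+ 2).
have mH p : measurable_fun setT (H p).
  apply: measurableT_comp => //; apply: measurable_sum => i.
  by apply: measurable_funM => //; apply: measurable_funB => //; exact: measurable_funX.
have Hc p : (\int[P]_w (H p w)%:E <= (c p)%:E)%E.
  apply: step_sample_bound => [i|i]; first exact: gv.
  by apply/ltW/(hN0 (q p)); rewrite /= /q leq_addl.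
have cc : (c p)%:E @[p --> \oo] --> (expR (n%:R * (182 * (u * v) ^+ 2)))%:E.
  apply: cvg_EFin; first exact: nearW.
  have h : \sum_(i < n) 182 * (u * V i (q p)) ^+ 2 @[p --> \oo] --> n%:R * (182 * (u * v) ^+ 2).
    rewrite (_ : n%:R * _ = \sum_(i < n) 182 * (u * v) ^+ 2); last first.
      by rewrite sumr_const card_ord mulr_natl.
    apply: cvg_sumr => i; apply: cvgMl_tmp.
    have uV : u * V i (q p) @[p --> \oo] --> u * v by apply: cvgMl_tmp; exact: Vq.
    apply: (cvg_comp _ (fun x => x ^+ 2) uV).
    exact: exprn_continuous.
  by apply: (cvg_comp _ _ h); exact: continuous_expR.
pose G w := expR (u * \sum_i (Z i w ^+ 2 - v)).
have HG : {ae P, forall w, limn_einf (fun p => (H p w)%:E) = (G w)%:E}.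
  apply: filterS piae => w Sw.
  have UZ i : step_integral (X i) (g i (q p)) w @[p --> \oo] --> Z i w.
    have : step_integral (X i) (g i (q p)) w - Z i w @[p --> \oo] --> 0.
      apply: cvg_sqr0; apply: (squeeze_cvgr (f := fun=> 0) (h := fun p => S (pi_ p) w)).
      - apply: nearW => p; rewrite sqr_ge0 /S (bigD1 i) //= lerDl.
        by apply: sumr_ge0 => j _; exact: sqr_ge0.
      - exact: cvg_cst.
      - exact: Sw.
    move=> h; rewrite -[Z i w]add0r.
    rewrite (_ : (fun p => _) = fun p => (step_integral (X i) (g i (q p)) w - Z i w) + Z i w).
      by apply: cvgD => //; exact: cvg_cst.
    by apply/funext => p; rewrite subrK.
  have [-> //] : (limn_einf (fun p => (H p w)%:E) = (G w)%:E) * (limn_esup (fun p => (H p w)%:E) = (G w)%:E).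
  apply: cvg_limn_einf_sup; apply: cvg_EFin; first exact: nearW.
  have h : \sum_i u * (step_integral (X i) (g i (q p)) w ^+ 2 - V i (q p)) @[p --> \oo] -->
      u * \sum_i (Z i w ^+ 2 - v).
    rewrite mulr_sumr; apply: cvg_sumr => i; apply: cvgMl_tmp; apply: cvgB; last exact: Vq.
    by apply: (cvg_comp _ (fun x => x ^+ 2) (UZ i)); exact: exprn_continuous.
  by apply: (cvg_comp _ _ h); exact: continuous_expR.
have mHe p : measurable_fun setT (fun w => (H p w)%:E) by exact/measurable_EFinP.
have mG : measurable_fun setT G.
  apply: measurableT_comp => //; apply: measurable_funM => //; apply: measurable_sum => i.
  by apply: measurable_funB => //; exact: measurable_funX.
have H0 p w : (0 <= (H p w)%:E)%E by rewrite lee_fin expR_ge0.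
have fat := @fatou _ _ _ P _ measurableT (fun p w => (H p w)%:E) mHe (fun p w _ => H0 p w).
have einf_le (a : (\bar R)^nat) k : (einfs a k <= a k)%E.
  by apply: ereal_inf_lbound; exists k => //=.
apply: (@le_trans _ _ (\int[P]_w limn_einf (fun p => (H p w)%:E))%E).
  rewrite le_eqVlt; apply/orP; left; apply/eqP; apply: ge0_ae_eq_integral => //.
  - exact/measurable_EFinP.
  - apply: measurableT_comp => //; apply: measurable_fun_limn_esup => p.
    exact: measurableT_comp.
  - move=> w _; rewrite limn_einf_lim; apply: lime_ge; first exact: is_cvg_einfs.
    by apply: nearW => k; apply: le_ereal_inf_tmp => _ [j _ <-].
  - by apply: filterS HG => w -> _.
apply: le_trans fat _; rewrite limn_einf_lim -(cvg_lim _ cc)//.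
apply: lee_lim; [exact: is_cvg_einfs|by apply/cvg_ex; eexists; exact: cc|].
by apply: nearW => p; apply: le_trans (einf_le _ _) (Hc p).
Qed.

End exponential_moment.
End Sample.

(** * Fluctuation of the sample covariance *)

Section Assembly.
Context {R : realType}.

(** The integral of a non-negative function is a supremum over the simple
    functions below it, so it is monotone on arbitrary functions. The
    estimator is any minimizer, and its loss can fail to be measurable in the
    outcome. *)
Lemma le_integral_pointwise (d : measure_display) (T : measurableType d)
    (m : {measure set T -> \bar R}) (f g : T -> \bar R) :
  (forall w, 0 <= f w)%E -> (forall w, f w <= g w)%E ->
  (\int[m]_w f w <= \int[m]_w g w)%E.
Proof.
move=> f0 fg; have g0 w : (0 <= g w)%E by exact: le_trans (fg w).
rewrite !ge0_integralTE//; apply: le_ereal_sup => _ [h hf <-].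
by exists h => // x; apply: le_trans (hf x) (fg x).
Qed.

Lemma objectiveE (e : nat -> R -> R) l (Rn A : 'M[R]_l) (sigma c : R) :
  orthonormal01 e -> sym_psd A ->
  objective e Rn sigma c A =
  (frob (Rn - sigma ^+ 2 *: 1%:M - A) (Rn - sigma ^+ 2 *: 1%:M - A) + c * \tr A)%:E.
Proof.
move=> eO sA; rewrite /objective nuclear_norm_psd//.
rewrite (sqnorm_kernel_of eO (A := Rn - sigma ^+ 2 *: 1%:M - A)) -?EFinD// => t u.
rewrite /kernel_of mulr_sumr -!sumrB; apply: eq_bigr => j _.
rewrite mulr_sumr -!sumrB; apply: eq_bigr => k _; rewrite !mxE; ring.
Qed.

Lemma qform_sample_cov n l (y : 'I_n -> nat -> R) (v : 'rV[R]_l) :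
  qform (sample_cov l y) v = n%:R^-1 * \sum_i (\sum_(k < l) v 0 k * y i k) ^+ 2.
Proof.
rewrite /qform mxE mulr_sumr.
transitivity (\sum_(k < l) \sum_(j < l) \sum_i n%:R^-1 * ((v 0 j * y i j) * (v 0 k * y i k))).
  apply: eq_bigr => k _; rewrite mxE mulr_suml; apply: eq_bigr => j _.
  rewrite !mxE mulr_sumr mulr_sumr mulr_suml; apply: eq_bigr => i _; ring.
rewrite exchange_big /=; under eq_bigr do rewrite exchange_big /=.
rewrite exchange_big /=; apply: eq_bigr => i _.
rewrite expr2 mulr_suml mulr_sumr; apply: eq_bigr => j _.
by rewrite mulr_sumr mulr_sumr; apply: eq_bigr => k _.
Qed.

Lemma sample_cov_sym n l (y : 'I_n -> nat -> R) : (sample_cov l y)^T = sample_cov l y.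
Proof.
apply/matrixP => j k; rewrite !mxE; congr (_ * _); apply: eq_bigr => i _; ring.
Qed.

Section fluctuation.
Context {d : measure_display} {T : measurableType d}.
Variable P : probability T R.
Variables (n l : nat) (e : nat -> R -> R) (K : R -> R -> R) (sigma lmax : R).
Variables (X : 'I_n -> R -> {RV P >-> R}) (Y : 'I_n -> nat -> {RV P >-> R}).
Variables (m : nat) (lam : 'I_m -> R) (phi : 'I_m -> R -> R).
Hypotheses (n0 : (0 < n)%N) (eO : orthonormal01 e) (KE : spectral_decomposition K lam phi).
Hypotheses (XK : forall i, signal_plus_noise K sigma (X i))
  (indX : mutually_independent P (fun i => sigma_gen `[0, 1] (X i)))
  (YX : forall i k, (k < l)%N -> is_wiener_integral (X i) (e k) (Y i k)).
Hypotheses (lmax0 : 0 <= lmax) (lamM : forall p, lam p <= lmax).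

Let M := lmax + sigma ^+ 2.

(** The matrix [compression e lam phi l + sigma ^+ 2 *: 1%:M] is the
    covariance matrix of the data, hence the mean of the sample covariance. *)
Definition fluctuation (w : T) : 'M[R]_l :=
  sample_cov l (fun i k => Y i k w) - compression e lam phi l - sigma ^+ 2 *: 1%:M.

Lemma fluctuation_sym w : (fluctuation w)^T = fluctuation w.
Proof.
rewrite /fluctuation !linearB /= sample_cov_sym linearZ /= trmx1 /compression.
by rewrite trmx_mul trmxK.
Qed.

Let var (v : 'rV[R]_l) := signal_variance lam phi sigma (basis_comb e v).

Let varE (v : 'rV[R]_l) : var v = qform (compression e lam phi l) v + sigma ^+ 2 * frob v v.
Proof. by rewrite /var /signal_variance (qform_compression eO KE) (inner01_basis_comb eO). Qed.

Let var_ge0 v : 0 <= var v. Proof. exact: signal_variance_ge0 KE _. Qed.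

Let var_le (v : 'rV[R]_l) : var v <= M * frob v v.
Proof.
rewrite varE /M mulrDl lerD2r.
by have /andP[] := qform_compression_le eO KE lmax0 lamM v.
Qed.

Let nR : 0 < n%:R :> R. Proof. by rewrite ltr0n. Qed.

Lemma qform_fluctuation w (v : 'rV[R]_l) : qform (fluctuation w) v =
  n%:R^-1 * \sum_i ((\sum_(k < l) v 0 k * Y i k w) ^+ 2 - var v).
Proof.
rewrite /fluctuation !qformD !qformN qformZ qform1 qform_sample_cov sumrB mulrBr.
have -> : n%:R^-1 * (\sum_(i < n) var v) = var v.
  by rewrite sumr_const card_ord -[var v *+ n]mulr_natl mulKf ?gt_eqF.
rewrite varE; ring.
Qed.

Lemma measurable_expR_qform theta v :
  measurable_fun setT (fun w => expR (theta * qform (fluctuation w) v)).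
Proof.
under eq_fun do rewrite qform_fluctuation.
apply: measurableT_comp => //; apply: measurable_funM => //; apply: measurable_funM => //.
apply: measurable_sum => i; apply: measurable_funB => //; apply: measurable_funX.
by apply: measurable_sum => k; exact: measurable_funM.
Qed.

(** The form is an average of centred squares of variables with variance at
    most [(lmax + sigma ^+ 2) * frob v v]. The vector is not normalized, so
    that the net points and the sums of two basis vectors are covered alike.
    *)
Lemma expR_qform_bound theta a (v : 'rV[R]_l) :
  `|theta| * (M * frob v v) <= n%:R * a -> 16 * a <= 1 ->
  (\int[P]_w (expR (theta * qform (fluctuation w) v))%:E <=
   (expR (n%:R * (182 * a ^+ 2)))%:E)%E.
Proof.
move=> ha a16.
have eL k : in_L2 (e k) by case: eO.
have wl i : wiener_limit (X i) (basis_comb e v) (fun w => \sum_(k < l) v 0 k * Y i k w).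
  by apply: wiener_limit_basis_comb => // k kl; exact: YX.
pose u := theta / n%:R.
have uv : `|u| * var v <= a.
  rewrite /u normrM normfV [`|n%:R|]gtr0_norm//.
  rewrite -(ler_pM2l nR) mulrA mulrCA divff ?gt_eqF// mulr1.
  by apply: le_trans ha; rewrite ler_wpM2l.
have uv0 : 0 <= `|u| * var v by rewrite mulr_ge0.
have uv8 : 8 * (`|u| * signal_variance lam phi sigma (basis_comb e v)) < 1.
  by rewrite -/(var v); lra.
have mZ i : measurable_fun setT (fun w => \sum_(k < l) v 0 k * Y i k w).
  by apply: measurable_sum => k; exact: measurable_funM.
have := sample_expR_bound KE XK indX (in_L2_basis_comb eO v) mZ wl uv8.
rewrite -/(var v) => h.
apply: (@le_trans _ _ (expR (n%:R * (182 * (u * var v) ^+ 2)))%:E).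
  apply: le_trans h; rewrite le_eqVlt; apply/orP; left; apply/eqP.
  apply: eq_integral => w _; congr (expR _)%:E.
  by rewrite qform_fluctuation /u mulrA.
rewrite lee_fin ler_expR; apply: ler_wpM2l; first exact: ltW.
apply: ler_wpM2l => //; rewrite -[leLHS]real_normK ?num_real// normrM [`|var v|]ger0_norm//.
by rewrite lerXn2r ?nnegrE// (le_trans uv0).
Qed.

End fluctuation.
End Assembly.

(** * The resolution and the rate *)

Section Rates.
Context {R : realType}.

Lemma abs_ceil (x : R) : 1 <= x ->
  [/\ (0 < `|Num.ceil x|)%N, x <= `|Num.ceil x|%:R, `|Num.ceil x|%:R <= 2 * x &
      forall k : nat, x <= k%:R -> (`|Num.ceil x| <= k)%N].
Proof.
move=> x1; have x0 : 0 < x by exact: lt_le_trans ltr01 x1.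
have c0 : 0 <= Num.ceil x by rewrite ceil_ge0; lra.
have cE : `|Num.ceil x|%:R = (Num.ceil x)%:~R :> R.
  by rewrite -[in RHS](gez0_abs c0).
have xc : x <= `|Num.ceil x|%:R by rewrite cE ceil_ge.
split => //.
- by rewrite -(ltr_nat R); apply: lt_le_trans x0 xc.
- have := ceilB1_lt x; rewrite cE intrB; lra.
- move=> k xk; rewrite -(ler_nat R) cE -[k%:R]/(k%:Z%:~R) ler_int ceil_le_int.
  exact: xk.
Qed.

(** Set [a = n `^ (1 / (2 * s + 1))] and [b = (r * n) `^ (1 / (2 * (s + 1)))].
    The two rates are [r * a `^ (- 2 s)] and [r * b `^ (- 2 s)], and the
    exponents are such that they equal [r * a / n] and [b ^+ 2 / n]. The
    larger of [a] and [b] gives the smaller rate, and [l] is that number up to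
    rounding, which costs a factor two. *)
Lemma rate_cases (n r : nat) (s : R) : (0 < n)%N -> (0 < r)%N -> 0 < s ->
  let l := resolution n r s in
  let rho := Num.min (r%:R * n%:R `^ (- (2 * s / (2 * s + 1))))
                      (r%:R `^ (1 / (s + 1)) * n%:R `^ (- (s / (s + 1)))) in
  [/\ (0 < l)%N, 0 <= rho, r%:R * l%:R `^ (- (2 * s)) <= rho &
      ((l <= n)%N /\ r%:R * l%:R / n%:R <= 2 * rho) \/ l%:R ^+ 2 / n%:R <= 4 * rho].
Proof.
move=> n0 r0 s0 l rho.
have nR : 0 < n%:R :> R by rewrite ltr0n.
have rR : 0 < r%:R :> R by rewrite ltr0n.
have n1 : 1 <= n%:R :> R by rewrite ler1n.
have r1 : 1 <= r%:R :> R by rewrite ler1n.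
have inv1 : 1 / (2 * s + 1) <= 1 by rewrite ler_pdivrMr ?mul1r; lra.
pose a : R := n%:R `^ (1 / (2 * s + 1)).
pose b : R := (r * n)%:R `^ (1 / (2 * (s + 1))).
have powR_ge1 (x p : R) : 1 <= x -> 0 <= p -> 1 <= x `^ p.
  by move=> x1 p0; rewrite -(powRr0 x) ler_powR.
have a1 : 1 <= a by apply: powR_ge1 => //; rewrite divr_ge0//; lra.
have b1 : 1 <= b.
  apply: powR_ge1; last by rewrite divr_ge0//; lra.
  by rewrite ler1n muln_gt0 r0.
have a0 : 0 < a by exact: lt_le_trans ltr01 a1.
have b0 : 0 < b by exact: lt_le_trans ltr01 b1.
have s1 : 2 * s + 1 != 0 by rewrite gt_eqF//; lra.
have s2 : s + 1 != 0 by rewrite gt_eqF//; lra.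
have aE : a `^ (2 * s + 1) = n%:R.
  rewrite /a -powRrM (_ : _ * _ = 1); first by rewrite powRr1.
  by field.
have bE : b `^ (2 * s + 2) = r%:R * n%:R.
  rewrite /b -powRrM (_ : _ * _ = 1); first by rewrite powRr1// natrM.
  by field.
have rho1 : r%:R * n%:R `^ (- (2 * s / (2 * s + 1))) = r%:R * a `^ (- (2 * s)).
  by rewrite /a -powRrM; congr (_ * _ `^ _); field.
have rho1' : a `^ (- (2 * s)) = a / n%:R.
  rewrite -aE -[X in X / _](powRr1 (ltW a0)) -powRB; last by rewrite (gt_eqF a0) implybT.
  by congr (_ `^ _); ring.
have rho2 : r%:R `^ (1 / (s + 1)) * n%:R `^ (- (s / (s + 1))) = r%:R * b `^ (- (2 * s)).
  rewrite /b -powRrM natrM powRM ?(ltW rR) ?(ltW nR)// mulrA.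
  rewrite -[X in X * r%:R `^ _](powRr1 (ltW rR)) -powRD; last by rewrite (gt_eqF rR) implybT.
  by congr (_ `^ _ * _ `^ _); field.
have rho2' : r%:R * b `^ (- (2 * s)) = b ^+ 2 / n%:R.
  have -> : b `^ (- (2 * s)) = b ^+ 2 / (r%:R * n%:R).
    rewrite -bE -(powR_mulrn 2 (ltW b0)) -powRB; last by rewrite (gt_eqF b0) implybT.
    by congr (_ `^ _); ring.
  have gen (x y z : R) : y != 0 -> z != 0 -> y * (x / (y * z)) = x / z.
    by move=> y0 z0; field; rewrite y0 z0.
  by rewrite gen// gt_eqF.
have rhoE : rho = Num.min (r%:R * a `^ (- (2 * s))) (r%:R * b `^ (- (2 * s))).
  by rewrite /rho rho1 rho2.
have lE : l = maxn `|Num.ceil a| `|Num.ceil b| by [].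
have [ca0 ca1 ca2 ca3] := abs_ceil a1.
have [cb0 cb1 cb2 cb3] := abs_ceil b1.
have decr (x y : R) : 0 < x -> x <= y -> y `^ (- (2 * s)) <= x `^ (- (2 * s)).
  move=> x0 xy; have y0 : 0 < y by exact: lt_le_trans xy.
  rewrite !powRN lef_pV2 ?posrE ?powR_gt0//; apply: ge0_ler_powR => //.
  - by rewrite mulr_ge0// ltW.
  - by rewrite nnegrE ltW.
  - by rewrite nnegrE ltW.
have la : a <= l%:R by rewrite (le_trans ca1)// ler_nat lE leq_maxl.
have lb : b <= l%:R by rewrite (le_trans cb1)// ler_nat lE leq_maxr.
have l0 : (0 < l)%N by rewrite lE leq_max ca0.
have bias : r%:R * l%:R `^ (- (2 * s)) <= rho.
  by rewrite rhoE le_min !ler_pM2l// !decr.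
split => //.
  by rewrite rhoE le_min !mulr_ge0 ?powR_ge0// ltW.
have [ba|ab] := leP b a.
- left; have lca : l = `|Num.ceil a|%N.
    rewrite lE; apply/maxn_idPl; apply: cb3.
    exact: le_trans ba ca1.
  have rhoa : rho = r%:R * (a / n%:R).
    rewrite rhoE min_l; first by rewrite rho1'.
    by apply: ler_wpM2l; [exact: ltW|exact: decr ba].
  split.
    rewrite lca; apply: ca3; rewrite -[leRHS](powRr1 (ltW nR)) /a; exact: ler_powR.
  rewrite rhoa lca -mulrA [leRHS]mulrCA; apply: ler_wpM2l; first exact: ltW.
  by rewrite mulrA ler_pM2r ?invr_gt0.
- right; have lcb : l = `|Num.ceil b|%N.
    rewrite lE; apply/maxn_idPr; apply: ca3.
    exact: le_trans (ltW ab) cb1.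
  have rhob : rho = b ^+ 2 / n%:R.
    rewrite rhoE min_r; first exact: rho2'.
    by apply: ler_wpM2l; [exact: ltW|exact: decr (ltW ab)].
  rewrite rhob mulrA ler_pM2r ?invr_gt0// lcb.
  have := lerXn2r 2 (ler0n _ _) (mulr_ge0 (ler0n R 2) (ltW b0)) cb2; rewrite exprMn.
  by rewrite (_ : 2 ^+ 2 = 4)//; ring.
Qed.

Lemma delta_bounds (n l : nat) : (0 < n)%N ->
  2 * (l%:R / n%:R) <= delta n l l%:R ^+ 2 :> R /\
  ((l <= n)%N -> delta n l l%:R ^+ 2 <= 4 * (l%:R / n%:R) :> R).
Proof.
move=> n0; have nR : 0 < n%:R :> R by rewrite ltr0n.
have q0 : 0 <= l%:R / n%:R :> R by rewrite divr_ge0.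
have xE : (l%:R + l%:R) / n%:R = 2 * (l%:R / n%:R) :> R by rewrite mulrA; congr (_ / _); ring.
rewrite /delta xE; set q := l%:R / n%:R in q0 *.
have s2 : Num.sqrt (2 * q) ^+ 2 = 2 * q by rewrite sqr_sqrtr// mulr_ge0.
split.
  rewrite -[leLHS]s2 lerXn2r ?nnegrE ?sqrtr_ge0//; last by rewrite le_max lexx.
  by rewrite le_max sqrtr_ge0.
move=> ln; have q1 : q <= 1 by rewrite /q ler_pdivrMr// mul1r ler_nat.
have [_|_] := leP (Num.sqrt (2 * q)) (2 * q); last by rewrite s2; lra.
by rewrite exprMn; nra.
Qed.

End Rates.

(** * Rare large fluctuations *)

Section Tail.
Context {R : realType}.

(** The half in the exponent leaves the factor [expR (- x / 2)], which for
    large [x] pays for the cardinality of the net. *)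
Lemma sqr_le_expR (x : R) : 0 <= x -> x ^+ 2 <= 8 * expR (x / 2).
Proof.
move=> x0; have x2 : 0 <= x / 2 by rewrite divr_ge0.
have := expR_ge1Dxn 1 x2; rewrite (_ : 2`! = 2)%N// => h.
have := expR_ge0 (x / 2); nra.
Qed.

Lemma sqr_le_expRD (x : R) : x ^+ 2 <= 2 * (expR x + expR (- x)).
Proof.
wlog x0 : x / 0 <= x => [hw|].
  have [/hw//|/ltW x0] := leP 0 x.
  have := hw (- x); rewrite sqrrN opprK addrC; apply; by rewrite oppr_ge0.
have := expR_ge1Dxn 1 x0; rewrite (_ : 2`! = 2)%N// => h.
have := expR_ge0 (- x); lra.
Qed.

(** Both signs are kept so that the absolute value of the quadratic form is
    reached by an exponential without absolute value, for which moments are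
    available. *)
Definition net_signs l : {pred net_index l * bool} := [pred p | in_net p.1].

Lemma card_net_signs l : (#|@net_signs l| <= 2 * 2 ^ (66 * l))%N.
Proof.
have -> : #|@net_signs l| = (#|@in_net l| * #|{: bool}|)%N.
  by rewrite -cardX; apply: eq_card => -[z b]; rewrite !inE /= andbT.
by rewrite card_bool mulnC leq_mul2l /= (@card_in_net R).
Qed.

(** Let [alpha] be the largest absolute value of the form on the net. If [4 *
    alpha <= mu] the operator norm of [A] is at most [mu / 2] and the bound [x
    <= y] holds. Otherwise [q = theta * alpha] is at least [134 * l]; the
    squared Frobenius norm is at most [l ^+ 2 * (2 * alpha) ^+ 2], a multiple
    of [q ^+ 2], and [q ^+ 2 <= 8 * expR (q / 2) <= 8 * expR (- 67 * l) * expR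
    q]. The inequality is pointwise, so that no tail probability needs to be
    integrated. *)
Lemma fluctuation_tail_bound l (A : 'M[R]_l) (M theta mu x y : R) (n : nat) :
  (0 < l)%N -> (0 < n)%N -> A^T = A -> 0 < M -> 0 <= y ->
  0 < theta -> theta ^+ 2 * (256 * M ^+ 2) = l%:R * n%:R ->
  4 * (134 * l%:R) <= theta * mu ->
  ((forall v, `|qform A v| <= mu / 2 * frob v v) -> x <= y) ->
  x <= 2 * frob A A + y ->
  x <= y + 2 ^+ 14 * M ^+ 2 * (l%:R / n%:R) * (expR (- (67 * l%:R)) *
    \sum_(p in @net_signs l) expR ((-1) ^+ p.2 * theta * qform A (net_point p.1))).
Proof.
move=> l0 n0 sA M0 y0 th0 th2 thmu good bad; set Phi := \sum_(p in _) _.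
have nR : 0 < n%:R :> R by rewrite ltr0n.
have ln0 : 0 <= l%:R / n%:R :> R by rewrite divr_ge0.
have Phi0 : 0 <= Phi by apply: sumr_ge0 => p _; exact: expR_ge0.
have PhiE (z : net_index l) : in_net z -> expR (theta * `|qform A (net_point z)|) <= Phi.
  move=> hz; pose p : net_index l * bool := (z, qform A (net_point z) < 0).
  have pin : p \in @net_signs l by rewrite inE.
  rewrite /Phi (bigD1 p pin) /= (_ : _ * _ * qform A _ = theta * `|qform A (net_point z)|).
    by rewrite lerDl; apply: sumr_ge0 => i _; exact: expR_ge0.
  case: (ltrP (qform A (net_point z)) 0) => h /=; first by rewrite expr1 ltr0_norm// !mulN1r mulNr mulrN.
  by rewrite expr0 mul1r ger0_norm.
have [alpha [alpha0 zalpha exq]] : exists alpha, [/\ 0 <= alpha,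
    forall z : net_index l, in_net z -> `|qform A (net_point z)| <= alpha &
    0 < alpha -> expR (theta * alpha) <= Phi].
  exists (\big[Num.max/0]_(z | @in_net l z) `|qform A (net_point z)|); split.
  - exact: bigmax_ge_id.
  - by move=> z hz; apply: le_bigmax_cond.
  - apply: (big_ind (fun a => 0 < a -> expR (theta * a) <= Phi)).
    + by rewrite ltxx.
    + by move=> a b ha hb; rewrite maxEle; case: ifP.
    + by move=> z hz _; exact: PhiE.
clearbody Phi.
have hv := net_bound l0 sA zalpha.
have c14 : 0 <= 2 ^+ 14 :> R by rewrite exprn_ge0.
have rest0 : 0 <= 2 ^+ 14 * M ^+ 2 * (l%:R / n%:R) * (expR (- (67 * l%:R)) * Phi).
  apply: mulr_ge0; last by rewrite mulr_ge0// expR_ge0.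
  by rewrite mulr_ge0// mulr_ge0// sqr_ge0.
have [le|lt] := leP (2 * alpha) (mu / 2).
  apply: (@le_trans _ _ y); last by rewrite lerDl.
  by apply: good => v; apply: le_trans (hv v) _; rewrite ler_wpM2r ?frob_ge0.
have hA := frob_le_qform (mulr_ge0 (ler0n R 2) alpha0) sA hv.
have lge0 : 0 <= l%:R :> R by rewrite ler0n.
clear good hv zalpha PhiE.
set q := theta * alpha.
have q0 : 0 <= q by rewrite mulr_ge0// ltW.
have qbig : 134 * l%:R <= q.
  have h3 : theta * (mu / 4) <= q by rewrite ler_wpM2l ?(ltW th0)//; lra.
  by move: h3 thmu; rewrite mulrA; move: (theta * mu) => w; lra.
have lR : 0 < l%:R :> R by rewrite ltr0n.
have apos : 0 < alpha.
  have : 0 < q by apply: lt_le_trans qbig; rewrite mulr_gt0.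
  by rewrite /q pmulr_rgt0.
have {}exq := exq apos.
apply: le_trans bad _; rewrite addrC lerD2l.
apply: (@le_trans _ _ (2 ^+ 11 * M ^+ 2 * (l%:R / n%:R) * q ^+ 2)).
  apply: le_trans (ler_wpM2l (ler0n R 2) hA) _.
  rewrite le_eqVlt; apply/orP; left; apply/eqP.
  transitivity (8 * l%:R ^+ 2 * alpha ^+ 2); first by ring.
  transitivity (8 * (l%:R * n%:R) * (l%:R / n%:R) * alpha ^+ 2); first by field; rewrite gt_eqF.
  by rewrite -th2 /q; ring.
have c0 : 0 <= 2 ^+ 11 * M ^+ 2 * (l%:R / n%:R).
  by rewrite mulr_ge0// mulr_ge0 ?sqr_ge0// exprn_ge0.
apply: le_trans (ler_wpM2l c0 (sqr_le_expR q0)) _.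
rewrite (_ : 2 ^+ 14 * _ * _ * _ = 2 ^+ 11 * M ^+ 2 * (l%:R / n%:R) * (8 * (expR (- (67 * l%:R)) * Phi))); last by ring.
apply: ler_wpM2l => //; apply: ler_wpM2l => //.
have -> : expR (q / 2) = expR (- (q / 2)) * expR q.
  by rewrite -expRD; congr expR; field.
apply: ler_pM; rewrite ?expR_ge0// ler_expR; lra.
Qed.

End Tail.

(** * The Frobenius norm of the fluctuation *)

Section Entries.
Context {R : realType}.

(** The values of a quadratic form at [e_j + e_k] and [e_j - e_k] determine
    the entry [(j, k)] of its symmetric matrix. *)
Definition pair_point l (q : 'I_l * 'I_l * bool) : 'rV[R]_l :=
  delta_mx 0 q.1.1 + (-1) ^+ q.2 *: delta_mx 0 q.1.2.

Lemma qform_delta_pair l (A : 'M[R]_l) j k (t : R) : A^T = A ->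
  qform A (delta_mx 0 j + t *: delta_mx 0 k) = A j j + 2 * t * A j k + t ^+ 2 * A k k.
Proof.
move=> sA; have Akj : A k j = A j k by rewrite -[in LHS]sA mxE.
have E a b : frob ((delta_mx 0 a : 'rV[R]_l) *m A) (delta_mx 0 b) = A a b.
  rewrite -rowE frob_rowE (bigD1 b) //= big1 => [|i ib].
    by rewrite !mxE !eqxx mulr1 addr0.
  by rewrite !mxE (negPf ib) andbF mulr0.
rewrite qform_frob mulmxDl -scalemxAl !(frobDl, frobDr, frobZl, frobZr) !E Akj; ring.
Qed.

Lemma pair_point_norm l (q : 'I_l * 'I_l * bool) : frob (pair_point q) (pair_point q) <= 4.
Proof.
rewrite -qform1 /pair_point qform_delta_pair ?trmx1// !mxE !eqxx.
case: q => [[j k] b]; rewrite /= sqrr_sign.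
by case: (j == k); case: b; rewrite /=; lra.
Qed.

(** Four times an entry is the difference of two values of the quadratic form,
    and a square is dominated by the two exponentials. *)
Lemma frob_le_expR l (A : 'M[R]_l) (theta : R) : A^T = A ->
  4 * theta ^+ 2 * frob A A <= \sum_(p in predT : {pred ('I_l * 'I_l * bool) * bool})
    expR ((-1) ^+ p.2 * theta * qform A (pair_point p.1)).
Proof.
move=> sA.
rewrite -(pair_big xpredT xpredT (fun q (b : bool) => expR ((-1) ^+ b * theta * qform A (pair_point q)))) /=.
rewrite -(pair_big xpredT xpredT (fun q (c : bool) => \sum_(b : bool) expR ((-1) ^+ b * theta * qform A (pair_point (q, c))))) /=.
rewrite -(pair_big xpredT xpredT (fun j k => \sum_(c : bool) \sum_(b : bool) expR ((-1) ^+ b * theta * qform A (pair_point (j, k, c))))) /=.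
rewrite frobE mulr_sumr; apply: ler_sum => j _; rewrite mulr_sumr; apply: ler_sum => k _.
rewrite !big_bool /= !expr1 !expr0 !mulN1r !mul1r.
have h q : (theta * q) ^+ 2 <= 2 * (expR (- theta * q) + expR (theta * q)).
  by have := sqr_le_expRD (theta * q); rewrite mulNr addrC.
set q1 := qform _ _; set q2 := qform _ _.
have : 4 * A j k = q2 - q1.
  rewrite /q1 /q2 /pair_point !qform_delta_pair//= !expr0 !expr1; ring.
have := h q1; have := h q2; move: (expR _) (expR _) (expR _) (expR _) => e1 e2 e3 e4 h1 h2 hA.
apply: (@le_trans _ _ (theta ^+ 2 * (q2 - q1) ^+ 2 / 4)); first by rewrite -hA; lra.
have := sqr_ge0 (theta * (q1 + q2)); lra.
Qed.

Lemma integral_affine_le (d : measure_display) (T : measurableType d) (P : probability T R)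
    (J : finType) (S : {pred J}) (f : J -> T -> R) (B a b : R) :
  (forall p, measurable_fun setT (f p)) -> (forall p w, 0 <= f p w) ->
  (forall p, p \in S -> \int[P]_w (f p w)%:E <= B%:E)%E -> 0 <= a -> 0 <= b ->
  (\int[P]_w (a + b * \sum_(p in S) f p w)%:E <= (a + b * (#|S|%:R * B))%:E)%E.
Proof.
move=> mf f0 fB a0 b0.
have mS : measurable_fun setT (fun w => \sum_(p in S) f p w).
  by under eq_fun do rewrite -big_filter; exact: measurable_sum.
have S0 w : 0 <= \sum_(p in S) f p w by apply: sumr_ge0.
under eq_integral do rewrite EFinD.
rewrite ge0_integralD//=; last 2 first.
  by move=> w _; rewrite lee_fin mulr_ge0.
  by apply/measurable_EFinP; exact: measurable_funM.
have -> : (\int[P]__ a%:E = a%:E)%E.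
  rewrite integral_cst// [X in (_ * X)%E](_ : _ = 1%E) ?mule1//.
  exact: probability_setT.
rewrite [leRHS]EFinD leeD2l//.
under eq_integral do rewrite EFinM.
rewrite ge0_integralZl//=; last 2 first.
  by apply/measurable_EFinP.
  by move=> w _; rewrite lee_fin.
rewrite EFinM lee_wpmul2l//.
under eq_integral do rewrite -sumEFin -big_filter.
rewrite ge0_integral_sum//; last first.
- by move=> p w _; rewrite lee_fin.
- by move=> p; exact/measurable_EFinP.
rewrite big_filter mulr_natl -sumr_const -sumEFin; exact: lee_sum.
Qed.
End Entries.

(** * Averages of exponentials of the fluctuation *)

Section Moments.
Context {R : realType} {d : measure_display} {T : measurableType d}.
Variable P : probability T R.
Variables (n l : nat) (e : nat -> R -> R) (K : R -> R -> R) (sigma lmax : R).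
Variables (X : 'I_n -> R -> {RV P >-> R}) (Y : 'I_n -> nat -> {RV P >-> R}).
Variables (m : nat) (lam : 'I_m -> R) (phi : 'I_m -> R -> R).
Hypotheses (n0 : (0 < n)%N) (eO : orthonormal01 e) (KE : spectral_decomposition K lam phi).
Hypotheses (XK : forall i, signal_plus_noise K sigma (X i))
  (indX : mutually_independent P (fun i => sigma_gen `[0, 1] (X i)))
  (YX : forall i k, (k < l)%N -> is_wiener_integral (X i) (e k) (Y i k)).
Hypotheses (lmax0 : 0 <= lmax) (lamM : forall p, lam p <= lmax).

Let M := lmax + sigma ^+ 2.
Let D := fluctuation l e sigma Y lam phi.
Let nR : 0 < n%:R :> R. Proof. by rewrite ltr0n. Qed.
Let M0 : 0 <= M. Proof. by rewrite addr_ge0 ?sqr_ge0. Qed.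

(** Common form of the two averages needed: over the net, where [rad2] is [1],
    and over the sums and differences of basis vectors, where it is [4]. *)
Lemma integral_sum_expR_le (J : finType) (S : {pred J}) (pt : J -> 'rV[R]_l)
    (theta rad2 a b : R) (sg : J -> bool) : 0 <= theta -> 0 <= rad2 ->
  (forall p, p \in S -> frob (pt p) (pt p) <= rad2) ->
  (16 * theta * M * rad2) ^+ 2 <= n%:R ^+ 2 -> 0 <= a -> 0 <= b ->
  (\int[P]_w (a + b * \sum_(p in S) expR ((-1) ^+ sg p * theta * qform (D w) (pt p)))%:E
   <= (a + b * (#|S|%:R * expR ((16 * theta * M * rad2) ^+ 2 / n%:R)))%:E)%E.
Proof.
move=> th0 r0 hr hn a0 b0.
apply: (integral_affine_le (f := fun p w => expR ((-1) ^+ sg p * theta * qform (D w) (pt p)))) => //.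
  by move=> p; exact: measurable_expR_qform n0 eO KE _ _.
move=> p pS; pose q := theta * M * rad2 / n%:R.
have q0 : 0 <= q by rewrite /q divr_ge0// ?(ltW nR)// !mulr_ge0.
have q16 : 16 * q <= 1.
  rewrite /q mulrA ler_pdivrMr// mul1r !mulrA.
  rewrite -(@ler_pXn2r _ 2) ?nnegrE ?(ltW nR)// !mulr_ge0//.
have := @expR_qform_bound _ _ _ P n l e K sigma lmax X Y m lam phi n0 eO KE XK indX YX
  lmax0 lamM ((-1) ^+ sg p * theta) q (pt p).
move=> /(_ _ q16) h; apply: le_trans (h _) _.
  rewrite normrM normr_sign mul1r ger0_norm// -/M /q [leRHS]mulrC divfK ?gt_eqF// -mulrA.
  by rewrite ler_wpM2l// ler_wpM2l// hr.
rewrite lee_fin ler_expR /q.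
have nn : n%:R != 0 :> R by rewrite gt_eqF.
rewrite (_ : 16 * theta * M * rad2 = 16 * (theta * M * rad2)); last by ring.
move: (theta * M * rad2) => z.
have -> : n%:R * (182 * (z / n%:R) ^+ 2) = 182 * (z ^+ 2 / n%:R) :> R by field.
have -> : (16 * z) ^+ 2 / n%:R = 256 * (z ^+ 2 / n%:R) :> R by field.
have : 0 <= z ^+ 2 / n%:R by rewrite divr_ge0 ?sqr_ge0 ?(ltW nR).
by move: (_ / _) => y; lra.
Qed.

End Moments.

(** * The expected error *)

Section Oracle.
Context {R : realType} {d : measure_display} {T : measurableType d}.
Variable P : probability T R.
Variables (n l : nat) (e : nat -> R -> R) (K : R -> R -> R) (sigma lmax : R).
Variables (X : 'I_n -> R -> {RV P >-> R}) (Y : 'I_n -> nat -> {RV P >-> R}).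
Variables (m : nat) (lam : 'I_m -> R) (phi : 'I_m -> R -> R).
Hypotheses (n0 : (0 < n)%N) (eO : orthonormal01 e) (KE : spectral_decomposition K lam phi).
Hypotheses (XK : forall i, signal_plus_noise K sigma (X i))
  (indX : mutually_independent P (fun i => sigma_gen `[0, 1] (X i)))
  (YX : forall i k, (k < l)%N -> is_wiener_integral (X i) (e k) (Y i k)).
Hypotheses (lmax0 : 0 < lmax) (lamM : forall p, lam p <= lmax) (l0 : (0 < l)%N).
Let M := lmax + sigma ^+ 2.
Let mu := 2 ^+ 14 * M * delta n l l%:R.
Variable A : T -> 'M[R]_l.
Hypothesis estA : forall w,
  is_estimator e (sample_cov l (fun i k => Y i k w)) sigma mu (A w).

Let D := fluctuation l e sigma Y lam phi.
Let A0 := compression e lam phi l.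
Let nR : 0 < n%:R :> R. Proof. by rewrite ltr0n. Qed.
Let lR : 0 < l%:R :> R. Proof. by rewrite ltr0n. Qed.
Let M0 : 0 < M. Proof. by rewrite ltr_pwDl ?sqr_ge0. Qed.
Let mu0 : 0 <= mu.
Proof.
rewrite !mulr_ge0 ?exprn_ge0 ?(ltW M0)// le_max; apply/orP; left; exact: sqrtr_ge0.
Qed.

Let data w : sample_cov l (fun i k => Y i k w) - sigma ^+ 2 *: 1%:M = A0 + D w.
Proof. by rewrite /D /fluctuation -/A0 addrA [A0 + _]addrC subrK. Qed.

Let sA w : (A w)^T = A w. Proof. exact: (estA w).1.1. Qed.
Let pA w v : 0 <= qform (A w) v. Proof. exact: (estA w).1.2. Qed.
Let optA w (B : 'M[R]_l) : B^T = B -> (forall v, 0 <= qform B v) ->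
  frob (A0 + D w - A w) (A0 + D w - A w) + mu * \tr (A w) <=
  frob (A0 + D w - B) (A0 + D w - B) + mu * \tr B.
Proof.
move=> sB pB; have [psdA /(_ B (conj sB pB))] := estA w.
by rewrite (objectiveE _ _ _ eO psdA) (objectiveE _ _ _ eO (conj sB pB)) data lee_fin.
Qed.

Let err w := frob (A w - A0) (A w - A0).

(** The parameter is [theta = sqrt (l * n) / (16 * M)]. Each exponential over
    the net has expectation at most [expR l], and the [2 ^ (66 * l + 1)] of
    them are compensated by [expR (- 67 * l)] up to the factor two. *)
Lemma risk_low_rank b : 0 <= b -> (l <= n)%N ->
  (\int[P]_w (b + err w)%:E <=
   (b + m%:R * mu ^+ 2 + 2 ^+ 15 * M ^+ 2 * (l%:R / n%:R))%:E)%E.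
Proof.
move=> b0 ln.
have ln0 : 0 < l%:R * n%:R :> R by rewrite mulr_gt0.
set theta := Num.sqrt (l%:R * n%:R) / (16 * M).
have s2 : Num.sqrt (l%:R * n%:R) ^+ 2 = l%:R * n%:R :> R by rewrite sqr_sqrtr// ltW.
have s0 : 0 < Num.sqrt (l%:R * n%:R) :> R by rewrite sqrtr_gt0.
have th0 : 0 < theta by rewrite divr_gt0// mulr_gt0.
have thM : 16 * theta * M = Num.sqrt (l%:R * n%:R).
  by rewrite /theta; field; rewrite gt_eqF.
have th2 : theta ^+ 2 * (256 * M ^+ 2) = l%:R * n%:R.
  by rewrite -s2 -thM; ring.
have thmu : 4 * (134 * l%:R) <= theta * mu.
  have [hd _] := @delta_bounds R n l n0.
  have d0 : 0 <= delta n l (l%:R : R) by rewrite le_max sqrtr_ge0.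
  have h : l%:R <= Num.sqrt (l%:R * n%:R) * delta n l (l%:R : R).
    rewrite -(@ler_pXn2r _ 2) ?nnegrE// ?(ltW lR)// ?mulr_ge0 ?(ltW s0)// exprMn s2.
    apply: (@le_trans _ _ (l%:R * n%:R * (2 * (l%:R / n%:R)))).
      have -> : l%:R * n%:R * (2 * (l%:R / n%:R)) = 2 * l%:R ^+ 2 :> R by field; rewrite gt_eqF.
      by have := sqr_ge0 (l%:R : R); lra.
    by rewrite ler_wpM2l// ltW.
  have -> : theta * mu = 2 ^+ 10 * (Num.sqrt (l%:R * n%:R) * delta n l (l%:R : R)).
    rewrite -thM /mu; ring.
  apply: (@le_trans _ _ (2 ^+ 10 * l%:R)); last by rewrite ler_wpM2l// exprn_ge0.
  rewrite mulrA ler_wpM2r ?(ltW lR)//; lra.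
have y0 : 0 <= m%:R * mu ^+ 2 by rewrite mulr_ge0 ?sqr_ge0.
pose S w := \sum_(p in @net_signs l) expR ((-1) ^+ p.2 * theta * qform (D w) (net_point p.1)).
have hw w : err w <= m%:R * mu ^+ 2 +
    2 ^+ 14 * M ^+ 2 * (l%:R / n%:R) * (expR (- (67 * l%:R)) * S w).
  apply: (@fluctuation_tail_bound _ l (D w) M theta mu (err w) (m%:R * mu ^+ 2) n) => //.
  - exact: fluctuation_sym.
  - exact: (error_le_rank (sA w) (pA w) (@optA w) erefl mu0).
  apply: le_trans (error_le_noise_norm (sA w) (pA w) (@optA w) erefl mu0) _.
  by rewrite lerD2l ler_wpM2r ?sqr_ge0// ler_nat geq_minl.
pose c := 2 ^+ 14 * M ^+ 2 * (l%:R / n%:R) * expR (- (67 * l%:R)).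
have c0 : 0 <= c.
  rewrite /c mulr_ge0 ?expR_ge0//; rewrite mulr_ge0 ?divr_ge0 ?(ltW lR) ?(ltW nR)//.
  by rewrite mulr_ge0 ?sqr_ge0// exprn_ge0.
apply: (@le_trans _ _ (\int[P]_w (b + m%:R * mu ^+ 2 + c * S w)%:E)%E).
  apply: le_integral_pointwise => w; rewrite lee_fin.
    by rewrite addr_ge0 ?frob_ge0.
  by rewrite -addrA lerD2l /c -mulrA.
apply: le_trans (integral_sum_expR_le n0 eO KE XK indX YX (ltW lmax0) lamM (rad2 := 1)
  (S := @net_signs l) (pt := fun p => net_point p.1) snd (ltW th0) ler01 _ _ (addr_ge0 b0 y0) c0) _.
- by move=> [z s] hz; apply: net_point_norm.
- by rewrite mulr1 thM s2 expr2 ler_wpM2r ?(ltW nR)// ler_nat.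
rewrite lee_fin lerD2l -/M mulr1 thM s2 mulfK ?gt_eqF//.
rewrite /c -mulrA.
rewrite (_ : 2 ^+ 15 * _ * _ = 2 ^+ 14 * M ^+ 2 * (l%:R / n%:R) * 2); last by ring.
rewrite ler_wpM2l//.
  by rewrite mulr_ge0 ?divr_ge0 ?(ltW lR) ?(ltW nR)// mulr_ge0 ?sqr_ge0// exprn_ge0.
have e2 : 2 <= expR 1 :> R by have := @expR_ge1Dx R 1; lra.
have card : #|@net_signs l|%:R <= 2 * expR (66 * l%:R) :> R.
  apply: (@le_trans _ _ (2 * 2 ^ (66 * l))%:R); first by rewrite ler_nat card_net_signs.
  rewrite natrM natrX ler_wpM2l// -natrM -[(66 * l)%:R]mulr1 expRM_natl.
  by rewrite lerXn2r ?nnegrE ?expR_ge0.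
apply: (@le_trans _ _ (expR (- (67 * l%:R)) * (2 * expR (66 * l%:R) * expR l%:R))).
  by rewrite ler_wpM2l ?expR_ge0// ler_wpM2r ?expR_ge0.
rewrite -mulrA -expRD mulrCA -expRD (_ : _ + _ = 0) ?expR0 ?mulr1//; ring.
Qed.

(** The Frobenius norm of the fluctuation has expectation of order [l ^+ 2 /
    n], by exponential moments with [theta = sqrt n / (64 * M)]. For [l <= n]
    the penalty contributes [l * mu ^+ 2], of the same order; for [l > n]
    comparison with the zero matrix leaves the norm of the compression, at
    most [lmax ^+ 2 * l], which is below [M ^+ 2 * l ^+ 2 / n]. *)
Lemma risk_large_scale b : 0 <= b ->
  (\int[P]_w (b + err w)%:E <=
   (b + (2 ^+ 31 + 2 ^+ 16 * expR 1) * M ^+ 2 * (l%:R ^+ 2 / n%:R))%:E)%E.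
Proof.
move=> b0.
set theta := Num.sqrt n%:R / (64 * M).
have s2 : Num.sqrt n%:R ^+ 2 = n%:R :> R by rewrite sqr_sqrtr// ltW.
have s0 : 0 < Num.sqrt n%:R :> R by rewrite sqrtr_gt0.
have th0 : 0 < theta by rewrite divr_gt0// mulr_gt0.
have thM : 16 * theta * M * 4 = Num.sqrt n%:R.
  by rewrite /theta; field; rewrite gt_eqF.
pose S w := \sum_(p in predT : {pred ('I_l * 'I_l * bool) * bool})
  expR ((-1) ^+ p.2 * theta * qform (D w) (pair_point p.1)).
have q0 : 0 <= l%:R / n%:R :> R by rewrite divr_ge0 ?(ltW lR) ?(ltW nR).
have ll0 : 0 <= l%:R ^+ 2 / n%:R :> R by rewrite divr_ge0 ?sqr_ge0 ?(ltW nR).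
have hD w : frob (D w) (D w) <= 2 ^+ 10 * (M ^+ 2 / n%:R) * S w.
  have := frob_le_expR theta (fluctuation_sym l e sigma Y lam phi w : (D w)^T = D w).
  rewrite -/(S w); move: (frob _ _) (S w) => x y h.
  have t2 : 2 ^+ 10 * (M ^+ 2 / n%:R) * (4 * theta ^+ 2) = 1.
    rewrite -[in X in _ / X]s2 -thM; field.
    by rewrite (gt_eqF M0) (gt_eqF th0).
  have c0 : 0 <= 2 ^+ 10 * (M ^+ 2 / n%:R).
    by rewrite mulr_ge0 ?exprn_ge0// divr_ge0 ?sqr_ge0// ltW.
  by have := ler_wpM2l c0 h; rewrite [X in X <= _]mulrA t2 mul1r.
have hw w : err w <= 16 * frob (D w) (D w) + 2 ^+ 31 * M ^+ 2 * (l%:R ^+ 2 / n%:R).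
  have D0 := frob_ge0 (D w).
  have [ln|nl] := leqP l n.
    apply: le_trans (error_le_noise_norm (sA w) (pA w) (@optA w) erefl mu0) _.
    apply: lerD; first by move: D0; move: (frob _ _) => x; lra.
    have [_ /(_ ln) hd] := @delta_bounds R n l n0.
    apply: (@le_trans _ _ (l%:R * mu ^+ 2)).
      by rewrite ler_wpM2r ?sqr_ge0// ler_nat geq_minr.
    have -> : l%:R * mu ^+ 2 = (2 ^+ 14) ^+ 2 * M ^+ 2 * (l%:R * delta n l (l%:R : R) ^+ 2).
      by rewrite /mu; ring.
    have -> : 2 ^+ 31 * M ^+ 2 * (l%:R ^+ 2 / n%:R) =
        (2 ^+ 14) ^+ 2 * M ^+ 2 * (l%:R * (8 * (l%:R / n%:R))) by field; rewrite gt_eqF.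
    apply: ler_wpM2l; first by rewrite mulr_ge0 ?sqr_ge0.
    apply: ler_wpM2l; first exact: ltW.
    apply: le_trans hd _; move: q0; lra.
  apply: le_trans (error_le_signal_norm (pA w) (@optA w) erefl mu0) _.
  rewrite addrC lerD2l.
  have hA := frob_compression_le eO KE lamM l.
  apply: (@le_trans _ _ (18 * (lmax ^+ 2 * l%:R))); first by rewrite ler_wpM2l.
  have h1 : lmax ^+ 2 <= M ^+ 2.
    by rewrite lerXn2r ?nnegrE ?(ltW lmax0) ?(ltW M0)// lerDl sqr_ge0.
  have h2 : l%:R <= l%:R ^+ 2 / n%:R :> R.
    by rewrite ler_pdivlMr// expr2 ler_wpM2l ?(ltW lR)// ler_nat ltnW.
  have h3 : lmax ^+ 2 * l%:R <= M ^+ 2 * (l%:R ^+ 2 / n%:R).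
    by rewrite ler_pM ?sqr_ge0 ?(ltW lR).
  rewrite -mulrA ler_pM//; first by rewrite mulr_ge0 ?sqr_ge0 ?(ltW lR).
  rewrite (_ : 31 = 5 + 26)%N// exprD; have := @exprn_ege1 R 26 2 (ler1n _ _).
  by move: (2 ^+ 26) => z; lra.
pose c := 2 ^+ 14 * (M ^+ 2 / n%:R).
have c0 : 0 <= c by rewrite /c mulr_ge0 ?exprn_ge0// divr_ge0 ?sqr_ge0// ltW.
pose y := b + 2 ^+ 31 * M ^+ 2 * (l%:R ^+ 2 / n%:R).
have y0 : 0 <= y by rewrite addr_ge0// mulr_ge0// mulr_ge0 ?sqr_ge0// exprn_ge0.
apply: (@le_trans _ _ (\int[P]_w (y + c * S w)%:E)%E).
  apply: le_integral_pointwise => w; rewrite lee_fin.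
    by rewrite addr_ge0 ?frob_ge0.
  rewrite /y -addrA lerD2l; apply: le_trans (hw w) _; rewrite [leLHS]addrC lerD2l.
  apply: le_trans (ler_wpM2l _ (hD w)) _ => //.
  rewrite /c le_eqVlt; apply/orP; left; apply/eqP; ring.
apply: le_trans (integral_sum_expR_le n0 eO KE XK indX YX (ltW lmax0) lamM (rad2 := 4)
  (S := predT) (pt := fun p => pair_point p.1) snd (ltW th0) (ler0n _ _) _ _ y0 c0) _.
- by move=> p _; exact: pair_point_norm.
- by rewrite -/M thM s2 expr2 ler_peMl ?(ltW nR)// ler1n.
rewrite lee_fin -/M thM s2 divff ?gt_eqF// /y -addrA lerD2l.
rewrite !card_prod card_ord card_bool !natrM /c.
rewrite le_eqVlt; apply/orP; left; apply/eqP; move: (expR 1) => x; field.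
by rewrite gt_eqF.
Qed.

End Oracle.

(** * The risk bound *)

Theorem theorem9 (R : realType) :
  exists c : R, 0 < c /\
  forall lmax sigma cstar : R, 0 < lmax -> 0 < sigma -> 0 < cstar ->
  exists C : R, 0 < C /\
  forall (n r : nat) (s : R) (e : nat -> R -> R),
    (1 <= n)%N -> (1 <= r)%N -> 0 < s -> orthonormal_basis01 e ->
  let l := resolution n r s in
  let mu := c * (lmax + sigma ^+ 2) * delta n l (l%:R) in
  forall K : R -> R -> R, sobolev_kernels e r s cstar lmax K ->
  forall (d : measure_display) (T : measurableType d) (P : probability T R)
    (X : 'I_n -> R -> {RV P >-> R}) (Y : 'I_n -> nat -> {RV P >-> R})
    (Ahat : T -> 'M[R]_l),
    (forall i, signal_plus_noise K sigma (X i)) ->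
    mutually_independent P (fun i => sigma_gen `[0, 1] (X i)) ->
    (forall i k, (k < l)%N -> is_wiener_integral (X i) (e k) (Y i k)) ->
    (forall w, is_estimator e (sample_cov l (fun i k => Y i k w)) sigma mu (Ahat w)) ->
    (\int[P]_w sqnorm_square (fun t u => kernel_of e (Ahat w) t u - K t u)%R
      <= (C * Num.min (r%:R * n%:R `^ (- (2 * s / (2 * s + 1))))
                      (r%:R `^ (1 / (s + 1)) * n%:R `^ (- (s / (s + 1)))))%:E)%E.
Proof.
(* The value of [theta] in the net argument and [2 * l / n <= delta ^+ 2] turn
   this constant into [2 ^+ 10 * l <= theta * mu], above the threshold [4 *
   (134 * l)]. *)
exists (2 ^+ 14); split; first by rewrite exprn_gt0.
move=> lmax sigma cstar lmax0 sigma0 cstar0.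
set M := lmax + sigma ^+ 2.
have M2 : 0 <= M ^+ 2 by exact: sqr_ge0.
have e1 : 0 <= expR 1 :> R by exact: expR_ge0.
exists (2 * lmax ^+ 2 * cstar ^+ 2 + (2 ^+ 33 + 2 ^+ 18 * expR 1) * M ^+ 2); split.
  rewrite ltr_pwDl//; first by rewrite !mulr_gt0// exprn_gt0.
  by rewrite mulr_ge0// addr_ge0 ?mulr_ge0 ?exprn_ge0.
move=> n r s e n0 r0 s0 eB l mu K [m [lam [phi [mr KE phiS lamM]]]] d T P X Y Ahat XK indX YX est.
have eO : orthonormal01 e by case: eB.
have {}lamM p : lam p <= lmax.
  by apply: le_trans (ltW lamM); exact: le_bigmax.
have [phiL phiO] : orthonormal01 phi by case: KE.
have := @rate_cases R n r s n0 r0 s0; cbv zeta; rewrite -/l.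
set rho := Num.min _ _ => -[l0 rho0 biasrate cases].
set b := 2 * lmax ^+ 2 * cstar ^+ 2 * rho.
have b0 : 0 <= b by rewrite /b mulr_ge0// mulr_ge0 ?sqr_ge0// mulr_ge0 ?sqr_ge0.
pose err w := frob (Ahat w - compression e lam phi l) (Ahat w - compression e lam phi l).
have rR : 0 <= r%:R :> R by rewrite ler0n.
have mrR : m%:R <= r%:R :> R by rewrite ler_nat.
have bias : \sum_p lam p ^+ 2 - frob (compression e lam phi l) (compression e lam phi l) <= b.
  pose h := cstar ^+ 2 * l%:R `^ (- (2 * s)).
  have h0 : 0 <= h by rewrite mulr_ge0 ?sqr_ge0 ?powR_ge0.
  apply: le_trans (@compression_bias _ e eO m lam phi K KE lmax _ lamM l h _ h0) _.
  - exact: ltW.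
  - move=> p; apply: sobolev_tail => //; try exact: ltW.
    by rewrite phiO eqxx.
  have c0 : 0 <= 2 * lmax ^+ 2 * cstar ^+ 2 by rewrite mulr_ge0 ?sqr_ge0// mulr_ge0 ?sqr_ge0.
  apply: le_trans (ler_wpM2l c0 biasrate).
  rewrite (_ : m%:R * _ = 2 * lmax ^+ 2 * cstar ^+ 2 * (m%:R * l%:R `^ (- (2 * s)))).
    by apply: ler_wpM2l => //; apply: ler_wpM2r => //; exact: powR_ge0.
  by rewrite /h; ring.
apply: (@le_trans _ _ (\int[P]_w (b + err w)%:E)%E).
  apply: le_integral_pointwise => w; first by apply: integral_ge0 => z _; rewrite lee_fin sqr_ge0.
  by rewrite (sqnorm_kernel_sub eO KE) lee_fin addrC lerD2r.
rewrite mulrDl -/b.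
have K0 : 0 <= 2 ^+ 18 * expR 1 * M ^+ 2 :> R by rewrite mulr_ge0// mulr_ge0// exprn_ge0.
case: cases => [[ln rate]|rate].
  apply: le_trans (risk_low_rank n0 eO KE XK indX YX lmax0 lamM l0 est b0 ln) _.
  rewrite lee_fin -addrA lerD2l.
  have [_ /(_ ln) hd] := @delta_bounds R n l n0.
  have q0 : 0 <= l%:R / n%:R :> R by rewrite divr_ge0.
  have r1 : 1 <= r%:R :> R by rewrite ler1n.
  apply: (@le_trans _ _ (2 ^+ 31 * M ^+ 2 * (r%:R * l%:R / n%:R))).
    apply: (@le_trans _ _ ((2 ^+ 30 + 2 ^+ 15) * M ^+ 2 * (r%:R * l%:R / n%:R))); last first.
      apply: ler_wpM2r; first by rewrite -mulrA mulr_ge0.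
      apply: ler_wpM2r => //.
      rewrite (_ : 31 = 15 + 16)%N// (_ : 30 = 15 + 15)%N//; rewrite !exprD.
      have := @exprn_ege1 R 15 2 (ler1n _ _).
      rewrite (_ : 16 = 1 + 15)%N// exprD expr1; move: (2 ^+ 15) => z; nra.
    rewrite mulrDl mulrDl; apply: lerD.
      apply: (@le_trans _ _ (r%:R * mu ^+ 2)); first by rewrite ler_wpM2r ?sqr_ge0.
      have -> : r%:R * mu ^+ 2 = 2 ^+ 28 * M ^+ 2 * (r%:R * delta n l (l%:R : R) ^+ 2).
        by rewrite /mu; ring.
      have -> : 2 ^+ 30 * M ^+ 2 * (r%:R * l%:R / n%:R) =
         2 ^+ 28 * M ^+ 2 * (r%:R * (4 * (l%:R / n%:R))) by ring.
      by apply: ler_wpM2l; [rewrite mulr_ge0// exprn_ge0|exact: ler_wpM2l].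
    by apply: ler_wpM2l; [rewrite mulr_ge0// exprn_ge0|rewrite -mulrA ler_peMl].
  have h0 : 0 <= 2 ^+ 31 * M ^+ 2 by rewrite mulr_ge0// exprn_ge0.
  apply: le_trans (ler_wpM2l h0 rate) _.
  pose z := 2 ^+ 18 * expR 1 * M ^+ 2 * rho.
  have z0 : 0 <= z by rewrite mulr_ge0.
  rewrite [leRHS](_ : _ = 2 ^+ 33 * rho * M ^+ 2 + z); last by rewrite /z; move: (expR 1) => x; ring.
  apply: (@le_trans _ _ (2 ^+ 33 * rho * M ^+ 2)); last by rewrite lerDl.
  have : 0 <= 2 ^+ 31 * (M ^+ 2 * rho) by rewrite mulr_ge0 ?exprn_ge0// mulr_ge0.
  rewrite (_ : 2 ^+ 31 * _ * _ = 2 * (2 ^+ 31 * (M ^+ 2 * rho))); last by ring.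
  rewrite (_ : 2 ^+ 33 * _ * _ = 4 * (2 ^+ 31 * (M ^+ 2 * rho))); last by ring.
  by move: (2 ^+ 31 * _) => y; lra.
apply: le_trans (risk_large_scale n0 eO KE XK indX YX lmax0 lamM l0 est b0) _.
rewrite lee_fin lerD2l -/M.
have h0 : 0 <= (2 ^+ 31 + 2 ^+ 16 * expR 1) * M ^+ 2 :> R.
  by rewrite mulr_ge0// addr_ge0 ?mulr_ge0 ?exprn_ge0.
apply: le_trans (ler_wpM2l h0 rate) _.
rewrite le_eqVlt; apply/orP; left; apply/eqP; move: (expR 1) => x; ring.
Qed.
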